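(* Let $G$ be a connected Lie group and let $(K_n)_{n=1}^\infty$ be a sequence of centered probability densities on $G$. Assume that (i) there exists a neighborhood $W$ of the identity $e$ with $\inf\{K_n(g):g\in W,\,n\in\mathbb{N}\}>0$, and (ii) there are $c,b>0$ with $K_n(g)\le c\,e^{-b\rho(g)^2}$ for all $g\in G$, $n\in\mathbb{N}$. Define $T_nf=K_n*f$, $f\in L^p$. Then there exist constants $\omega,c',b'>0$ such that $$\|e^{\lambda\psi}T_{m+n}\cdots T_{m+1}e^{-\lambda\psi}\|_{2\to2}\le e^{\omega\lambda^2n}$$ for all $m\in\mathbb{N}_0$, $n\in\mathbb{N}$, $\lambda\in\mathbb{R}$, $\psi\in\mathcal{E}$, and $$(K_{m+n}*\cdots*K_{m+1})(g)\le c'\,\Delta(g)^{-1/2}e^{-b'\rho(g)^2/n}$$ for all $m\in\mathbb{N}_0$, $n\in\mathbb{N}$ and $g\in G$.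
   Context: $\mathbb{N}=\{1,2,3,\dots\}$, $\mathbb{N}_0=\{0,1,2,\dots\}$; $dg$ is a left Haar measure on $G$ and $\Delta:G\to(0,\infty)$ is the modular function, normalized so that $d(g^{-1})=\Delta(g^{-1})dg$ is a right Haar measure; $L^p=L^p(G;dg)$ (complex-valued); $\|\cdot\|_{p\to q}$ is the norm of bounded operators $L^p\to L^q$. Convolution: $(f_1*f_2)(g)=\int_G dh\,f_1(h)f_2(h^{-1}g)$. A probability density on $G$ is a Borel measurable $K:G\to[0,\infty)$ with $\int_G dg\,K(g)=1$. Distance: fix a relatively compact, open, symmetric ($U=U^{-1}$) neighborhood $U$ of $e$ (which generates $G$), and set $\rho(g)=\inf\{n\in\mathbb{N}: g\in U^n\}$, where $U^n=\{g_1\cdots g_n: g_i\in U\}$. $(L(g)f)(h)=f(g^{-1}h)$, $\partial_g=L(g)-I$. $\mathcal{E}$ is the class of all locally bounded Borel measurable $\psi:G\to\mathbb{R}$ (not assumed bounded) with $\sup_{u\in U}\|\partial_u\psi\|_\infty\le1$. For a density $P$ and $Sf=P*f$, $e^{\lambda\psi}Se^{-\lambda\psi}$ is the operator $f\mapsto e^{\lambda\psi}S(e^{-\lambda\psi}f)$, i.e. $g\mapsto\int_G dh\,P(h)e^{\lambda(\psi(g)-\psi(h^{-1}g))}f(h^{-1}g)$. Centered: let $G_0=\overline{[G,G]}$ be the closure of the commutator subgroup, $\pi_0:G\to G/G_0$ the canonical homomorphism. $G/G_0$ is a connected abelian Lie group, so $G/G_0\cong\mathbb{R}^q\times\mathbb{T}^r$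 for some integers $q,r\ge0$, $\mathbb{T}=\mathbb{R}/\mathbb{Z}$. Put $G_1=\pi_0^{-1}(\{0\}\times\mathbb{T}^r)$, and let $\pi_1:G\to G/G_1\cong\mathbb{R}^q$ have components $\pi_1^{(i)}:G\to\mathbb{R}$. A density $K$ is centered if $\int_G dg\,K(g)\pi_1^{(i)}(g)=0$ for all $i\in\{1,\dots,q\}$. *)

(* Defs.v *)
From HB Require Import structures.
From mathcomp Require Import all_boot all_order all_algebra.
From mathcomp Require Import generic_quotient ring_quotient archimedean.
From mathcomp Require Import complex.
From mathcomp Require Import all_classical all_reals all_analysis.

Set Implicit Arguments.
Unset Strict Implicit.
Unset Printing Implicit Defensive.

Import Order.TTheory GRing.Theory Num.Theory.
Import numFieldNormedType.Exports.

Local Open Scope classical_set_scope.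
Local Open Scope ring_scope.

(* C^k regularity on an open set U of a finite-dimensional normed space: all
   iterated directional derivatives of order at most k exist and are continuous
   on U. *)
Fixpoint Ck_on (R : realType) (E F : normedModType R) (k : nat) (U : set E)
    (f : E -> F) : Prop :=
  (forall x, U x -> {for x, continuous f}) /\
  (if k is k'.+1 then
     forall v, (forall x, U x -> derivable f x v) /\ Ck_on k' U ('D_v f)
   else True).

Definition smooth_on (R : realType) (E F : normedModType R) (U : set E)
  (f : E -> F) : Prop := forall k, Ck_on k U f.

(* The base point inherited from ptopologicalType plays no role; it is only
   there because measurableType requires one. *)
HB.mixin Record isTopologicalGroup G of Group G & PointedTopological G := {
  mulg_continuous : continuous (fun x : G * G => (x.1 * x.2)%g) ;
  invg_continuous : continuous (fun x : G => (x^-1)%g)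
}.

#[short(type="topGroupType")]
HB.structure Definition TopGroup :=
  {G of isTopologicalGroup G & Group G & PointedTopological G}.

(* A chart of G is a homeomorphism [coord], with inverse [param], from the open
   set [dom] to the open subset [coord @` dom] of R^d. *)
Record chart (R : realType) (d : nat) (G : topologicalType) := Chart {
  dom : set G ;
  coord : G -> 'rV[R]_d ;
  param : 'rV[R]_d -> G ;
  dom_open : open dom ;
  chart_image_open : open (coord @` dom) ;
  coordK : forall x, dom x -> param (coord x) = x ;
  coord_continuous : forall x, dom x -> {for x, continuous coord} ;
  param_continuous : forall y, (coord @` dom) y -> {for y, continuous param}
}.

Definition chart_image (R : realType) (d : nat) (G : topologicalType)
  (c : chart R d G) : set 'rV[R]_d := coord c @` dom c.

(* Lie groups of dimension d: Hausdorff second countable topological groups with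
   a smooth atlas in which multiplication and inversion are smooth. *)
HB.mixin Record isLieGroup (R : realType) (d : nat) G of TopGroup G := {
  lie_hausdorff : hausdorff_space G ;
  lie_second_countable : @second_countable G ;
  atlas : set (chart R d G) ;
  atlas_cover : forall g : G, exists2 c, atlas c & dom c g ;
  atlas_compat : forall c1 c2, atlas c1 -> atlas c2 ->
    smooth_on [set x | chart_image c1 x /\ dom c2 (param c1 x)]
      (fun x => coord c2 (param c1 x)) ;
  mulg_smooth : forall c1 c2 c3, atlas c1 -> atlas c2 -> atlas c3 ->
    smooth_on [set x : 'rV[R]_d * 'rV[R]_d |
        [/\ chart_image c1 x.1, chart_image c2 x.2
          & dom c3 (param c1 x.1 * param c2 x.2)%g]]
      (fun x : 'rV[R]_d * 'rV[R]_d =>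
        coord c3 (param c1 x.1 * param c2 x.2)%g) ;
  invg_smooth : forall c1 c2, atlas c1 -> atlas c2 ->
    smooth_on [set x | chart_image c1 x /\ dom c2 ((param c1 x)^-1)%g]
      (fun x => coord c2 ((param c1 x)^-1)%g)
}.

#[short(type="lieGroupType")]
HB.structure Definition LieGroup (R : realType) (d : nat) :=
  {G of isLieGroup R d G & TopGroup G}.

Notation borel G := (g_sigma_algebraType (@open G)).

Section Abelianization.
Variable G : topGroupType.

Definition is_subgroup (H : set G) : Prop :=
  H 1%g /\ (forall x y, H x -> H y -> H (x^-1 * y)%g).

Definition commutator_subgroup : set G :=
  [set g | forall H, is_subgroup H -> (forall x y, H [~ x, y]%g) -> H g].

Definition G0 : set G := closure commutator_subgroup.

Lemma commutator_subgroup_subgroup : is_subgroup commutator_subgroup.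
Proof.
split=> [H [] //|x y Hx Hy H sH cH].
by apply: (sH.2); [exact: Hx|exact: Hy].
Qed.

Lemma G0_subgroup : is_subgroup G0.
Proof.
have [H1 HV] := commutator_subgroup_subgroup.
split=> [|x y Gx Gy]; first exact: subset_closure.
move=> B /= nB.
have cf : continuous (fun z : G * G => (z.1^-1 * z.2)%g).
  move=> z.
  apply: (@cvg_comp _ _ _ (fun z : G * G => ((z.1^-1)%g, z.2))
    (fun x : G * G => (x.1 * x.2)%g) _ (nbhs ((z.1^-1)%g, z.2))).
    apply: cvg_pair; last exact: cvg_snd.
    apply: (@cvg_comp _ _ _ fst (fun a : G => (a^-1)%g) _ (nbhs z.1)).
      exact: cvg_fst.
    exact: invg_continuous.
  exact: (mulg_continuous ((z.1^-1)%g, z.2)).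
have [[P Q] /= [nP nQ] PQB] := cf (x, y) B nB.
have [a [Ha Pa]] := Gx P nP.
have [b [Hb Qb]] := Gy Q nQ.
exists (a^-1 * b)%g; split; first exact: HV.
by apply: (PQB (a, b)); split.
Qed.

Definition coset_rel (x y : G) : bool := `[< G0 (x^-1 * y)%g >].

Lemma coset_rel_equiv : equiv_class_of coset_rel.
Proof.
have [H1 HV] := G0_subgroup.
have Hsym x y : G0 (x^-1 * y)%g -> G0 (y^-1 * x)%g.
  by move=> /HV /(_ H1); rewrite invgM invgK mulg1.
split=> [x|x y|y x z]; rewrite /coset_rel.
- by apply/asboolP; rewrite mulVg.
- by apply/asboolP/asboolP; exact: Hsym.
- move=> /asboolP xy /asboolP yz; apply/asboolP.
  by have := HV _ _ (Hsym _ _ xy) yz; rewrite invgM invgK mulgA mulgK.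
Qed.

Canonical coset_equiv := EquivRelPack coset_rel_equiv.

(* The space G / G0 of cosets of the closed normal subgroup G0. *)
Definition abelianization : Type := quotient_topology {eq_quot coset_equiv}%qT.
HB.instance Definition _ := Topological.on abelianization.
HB.instance Definition _ := Quotient.on abelianization.

Definition pi0 (g : G) : abelianization := (\pi_abelianization g)%qT.

End Abelianization.

Section Circle.
Variable R : realType.

Definition int_closed : zmodClosed R :=
  GRing.ZmodClosed.clone R (@Num.int_num_subdef R) _.

(* R / Z with the quotient topology and the quotient addition. *)
Definition circle : Type := quotient_topology (Quotient.quot int_closed).
HB.instance Definition _ := Topological.on circle.
HB.instance Definition _ := Quotient.on circle.
HB.instance Definition _ :=
  GRing.Zmodule.copy circle (Quotient.quot int_closed).
End Circle.

(* phi is an isomorphism of topological groups from G / G0 onto R^q x T^r. *)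
Definition is_abelianization_iso (R : realType) (G : topGroupType) (q r : nat)
    (phi : abelianization G -> 'rV[R]_q * 'rV[circle R]_r) : Prop :=
  [/\ forall x y : G, phi (pi0 (x * y)%g) = phi (pi0 x) + phi (pi0 y),
      continuous phi
    & exists psi, [/\ cancel phi psi, cancel psi phi & continuous psi]].

(* With G1 the preimage of {0} x T^r, the map G -> G / G1 = R^q is the
   R^q-component of G -> G / G0 = R^q x T^r. *)
Definition pi1 (R : realType) (G : topGroupType) (q r : nat)
    (phi : abelianization G -> 'rV[R]_q * 'rV[circle R]_r) (i : 'I_q) (g : G) : R :=
  (phi (pi0 g)).1 ord0 i.

Section Measure.
Variables (R : realType) (G : topGroupType).
Variable mu : {measure set (borel G) -> \bar R}.
Local Open Scope ereal_scope.

(* Every locally finite Borel measure on a second countable locally compact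
   Hausdorff space is regular, so regularity is not required separately. *)
Definition left_haar_measure : Prop :=
  [/\ mu setT != 0,
      forall C : set G, compact C -> mu C < +oo
    & forall (g : G) (A : set (borel G)), measurable A ->
        mu ((fun h : G => (g * h)%g) @` A) = mu A].

(* d(g^-1) = Delta(g^-1) dg, as measures; equivalently
   mu (A g) = Delta(g) mu(A). *)
Definition modular_function (Delta : G -> R) : Prop :=
  [/\ forall g, (0 < Delta g)%R,
      forall g h, Delta (g * h)%g = (Delta g * Delta h)%R,
      continuous Delta
    & forall A : set (borel G), measurable A ->
        mu ((fun g : G => (g^-1)%g) @` A) =
        \int[mu]_(g in A) (Delta (g : G)^-1%g)%:E].

Definition probability_density (K : G -> R) : Prop :=
  [/\ measurable_fun [set: borel G] (K : borel G -> R),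
      forall g, (0 <= K g)%R
    & \int[mu]_g (K g)%:E = 1].

Definition centered (q r : nat)
    (phi : abelianization G -> 'rV[R]_q * 'rV[circle R]_r) (K : G -> R) : Prop :=
  forall i : 'I_q, \int[mu]_g (K g * pi1 phi i g)%:E = 0.

Definition convolution (f1 f2 : G -> R) (g : G) : R :=
  (\int[mu]_h (f1 h * f2 ((h : G)^-1 * g)%g))%R.

(* K_(m+n) * ... * K_(m+1); the value for n = 0 is irrelevant. *)
Fixpoint convolutions (K : nat -> G -> R) (m n : nat) : G -> R :=
  match n with
  | 0 => fun=> 0%R
  | 1 => K m.+1
  | n'.+1 => convolution (K (m + n)%N) (convolutions K m n')
  end.

(* Convolution of a real kernel with a complex function. *)
Definition cconvolution (K : G -> R) (f : G -> R[i]) (g : G) : R[i] :=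
  Complex (convolution K (fun h => complex.Re (f h)) g)
          (convolution K (fun h => complex.Im (f h)) g).

(* The integral defining (K * f)(g) converges absolutely for almost every g. *)
Definition cconvolution_defined (K : G -> R) (f : G -> R[i]) : Prop :=
  {ae mu, forall g : borel G,
    mu.-integrable [set: borel G]
      (fun h : borel G =>
         (K h * complex.Re (f ((h : G)^-1 * (g : G))%g))%:E) /\
    mu.-integrable [set: borel G]
      (fun h : borel G =>
         (K h * complex.Im (f ((h : G)^-1 * (g : G))%g))%:E)}.

(* T_(m+n) ... T_(m+1) f, where T_k f = K_k * f. *)
Fixpoint Tprod (K : nat -> G -> R) (m n : nat) (f : G -> R[i]) : G -> R[i] :=
  if n is n'.+1 then cconvolution (K (m + n)%N) (Tprod K m n' f) else f.

Fixpoint Tprod_defined (K : nat -> G -> R) (m n : nat) (f : G -> R[i]) : Prop :=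
  if n is n'.+1 then
    Tprod_defined K m n' f /\
    cconvolution_defined (K (m + n)%N) (Tprod K m n' f)
  else True.

Definition exp_weight (lambda : R) (psi : G -> R) (f : G -> R[i]) : G -> R[i] :=
  fun g => ((expR (lambda * psi g))%:C%C * f g)%R.

Definition L2norm (f : G -> R[i]) : \bar R :=
  Lnorm mu 2%:E (fun g : borel G => (Normc.normc (f g))%:E).

Definition inL2 (f : G -> R[i]) : Prop :=
  [/\ measurable_fun [set: borel G] (fun g : borel G => complex.Re (f g)),
      measurable_fun [set: borel G] (fun g : borel G => complex.Im (f g))
    & L2norm f < +oo].

Definition opnorm22 (A : (G -> R[i]) -> (G -> R[i])) : \bar R :=
  ereal_sup [set L2norm (A f) | f in [set f | inL2 f /\ L2norm f <= 1]].

(* (partial_u psi)(h) = psi(u^-1 h) - psi(h); the sup norm is the norm of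
   L^oo(G; dg). *)
Definition class_E (U : set G) (psi : G -> R) : Prop :=
  [/\ measurable_fun [set: borel G] (psi : borel G -> R),
      forall g : G, exists M : R, \forall h \near g, (`|psi h| <= M)%R
    & ereal_sup [set Lnorm mu +oo (fun h : borel G =>
          (psi (u^-1 * (h : G))%g - psi h)%:E) | u in U] <= 1].

End Measure.

(* The existence of g1, ..., gn in U with g = g1 ... gn. *)
Definition set_power (G : topGroupType) (U : set G) (n : nat) : set G :=
  [set g | exists u : 'I_n -> G,
     (forall i, U (u i)) /\ g = (\prod_(i < n) u i)%g].

(* U automatically generates a connected G, so that the infimum below is over a
   nonempty set. *)
Definition admissible_nbhd (G : topGroupType) (U : set G) : Prop :=
  [/\ precompact U, open U, U 1%g & forall g, U g -> U (g^-1)%g].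

Definition rho (R : realType) (G : topGroupType) (U : set G) (g : G) : R :=
  inf [set n%:R | n in [set n : nat | (0 < n)%N /\ set_power U n g]].

(* Main.v *)
(* Write ||f|| for the L2 norm and phi for a nonnegative L2 function. The square
   of the norm of e^(lambda psi) T e^(-lambda psi) phi is a double integral over
   h, k of K(h) K(k) times a correlation of shifts of phi; its term linear in
   lambda is governed by the drift F(k) = int (psi(k x) - psi(x)) phi(x)^2 dx.
   F is almost additive: its defect at (k, h) is at most
   2 ||phi|| rho(k) D(h), with D(h) the L2 distance from phi to its translate by
   h. By a Hyers-Ulam type stability theorem F is then within
   O(||phi|| sup_U D) rho^2 of a continuous homomorphism G -> R. Such a
   homomorphism is a combination of the components of pi1, so it has mean zero
   against a centered density. The remaining error, of order
   |lambda| ||phi|| sup_U D, is absorbed by the loss int int K(h) K(k)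
   D(h^-1 k)^2 e^(-rho(h) - rho(k)), which controls (sup_U D)^2 because K is
   bounded below near the identity. This gives the factor e^(omega lambda^2) for
   one step and the first estimate by iteration. The pointwise bound is Davies'
   method: take psi = rho, bound one more convolution by Cauchy-Schwarz, with
   weight Delta^(1/2) e^(lambda rho), and choose lambda proportional to
   rho(g) / n. *)

Require Import Defs.
From HB Require Import structures.
From mathcomp Require Import all_boot all_order all_algebra complex.
From mathcomp Require Import finmap generic_quotient ring_quotient.
From mathcomp Require Import all_classical all_reals all_analysis.
From mathcomp Require Import measurable_realfun ess_sup_inf.
From mathcomp Require Import lra ring.

Set Implicit Arguments.
Unset Strict Implicit.
Unset Printing Implicit Defensive.

Import Order.TTheory GRing.Theory Num.Theory.
Import numFieldNormedType.Exports.

Local Open Scope classical_set_scope.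
Local Open Scope ring_scope.

(** The bound [e^(omega lambda^2)] leaves no room for a term of order [|lambda|], the kernels are
    not symmetric, and [psi] is only measurable and Lipschitz up to null sets, so it cannot be
    expanded along coordinates. Centering annihilates homomorphisms and nothing else. Averaging
    against [phi^2] brings [psi] close to one: the defect of the drift only sees how [phi^2] changes
    under a shift. Hence a dichotomy: either [phi] is nearly invariant and the drift is nearly a
    homomorphism, or convolution contracts [phi]. The contraction comes from
    [2xy = x^2 + y^2 - (x - y)^2]; it has order zero in [lambda] and is quadratic in [sup_U D],
    while the error is linear in both [|lambda|] and [sup_U D], so that [2st <= s^2 + t^2] leaves
    only [lambda^2]. The stability theorem is proved by compactness, hence [omega] is not explicit.
    For [|lambda| > 1] no cancellation is used: Gaussian moments give [C e^(lambda^2 / (2 b))], and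
    [C] is absorbed since [lambda^2 >= 1]. *)

Section TopGroup.
Variable G : topGroupType.
Implicit Types (U V : set G) (x y : G).

(** * Continuity of the group operations *)

Lemma cvg_mulg (T : Type) (F : set_system T) (FF : Filter F) (f g : T -> G)
    (a b : G) :
  f @ F --> a -> g @ F --> b -> (fun t => f t * g t)%g @ F --> (a * b)%g.
Proof.
move=> fa gb.
apply: (@cvg_comp _ _ _ (fun t => (f t, g t)) (fun x : G * G => (x.1 * x.2)%g)
  _ (nbhs (a, b))); first exact: cvg_pair.
exact: (mulg_continuous (a, b)).
Qed.

Lemma continuous_mulg (T : topologicalType) (f g : T -> G) :
  continuous f -> continuous g -> continuous (fun t => f t * g t)%g.
Proof. by move=> cf cg t; apply: cvg_mulg; [exact: cf|exact: cg]. Qed.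

Lemma continuous_mulgl x : continuous (fun y => x * y)%g.
Proof. by apply: continuous_mulg => t; [exact: cvg_cst|exact: cvg_id]. Qed.

Lemma continuous_expg n : continuous (fun x => x ^+ n)%g.
Proof.
elim: n => [|n IH]; first by move=> x; exact: cvg_cst.
under [X in continuous X]funext => x do rewrite expgS.
by apply: continuous_mulg => // t; exact: cvg_id.
Qed.

Lemma open_translate x U : open U -> open [set y | U (x^-1 * y)%g].
Proof. by move=> oU; apply: open_comp => // y _; exact: continuous_mulgl. Qed.

Lemma nbhs_translate x V : nbhs 1%g V -> nbhs x [set y | V (x^-1 * y)%g].
Proof.
move=> V1; have := @continuous_mulgl (x^-1)%g x V; rewrite /nbhs /= mulVg.
exact.
Qed.

(** * Powers of a generating set *)

Lemma set_power1 U g : U g -> set_power U 1 g.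
Proof. by move=> Ug; exists (fun=> g); rewrite big_ord_recl big_ord0 mulg1. Qed.

Lemma set_powerS U n g :
  set_power U n.+1 g <-> exists a b, [/\ U a, set_power U n b & g = (a * b)%g].
Proof.
split=> [[u [Uu ->]]|[a [b [Ua [u [Uu ->]] ->]]]].
  exists (u ord0), (\prod_(i < n) u (lift ord0 i))%g.
  by rewrite big_ord_recl; split => //; exists (fun i => u (lift ord0 i)).
exists (fun i => oapp u a (unlift ord0 i)); split.
  by move=> i; case: (unlift ord0 i).
rewrite big_ord_recl unlift_none; congr (_ * _)%g.
by apply: eq_bigr => i _; rewrite liftK.
Qed.

Lemma set_powerD U m n g h : set_power U m g -> set_power U n h ->
  set_power U (m + n) (g * h)%g.
Proof.
elim: m g => [|m IH] g; first by case=> u [_ ->]; rewrite big_ord0 mul1g.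
move=> /set_powerS[a [b [Ua Ub ->]]] Uh; rewrite addSn; apply/set_powerS.
by exists a, (b * h)%g; rewrite mulgA; split => //; exact: IH.
Qed.

Lemma set_powerV U n g : (forall x, U x -> U x^-1%g) -> set_power U n g ->
  set_power U n g^-1%g.
Proof.
move=> UV; elim: n g => [|n IH] g.
  by case=> u [_ ->]; rewrite big_ord0 invg1; exists u; rewrite big_ord0; split=> // -[].
move=> /set_powerS[a [b [Ua Ub ->]]]; rewrite invgM -addn1.
by apply: set_powerD; [exact: IH|apply: set_power1; exact: UV].
Qed.

Lemma set_power_le U m n g : U 1%g -> (m <= n)%N -> set_power U m g ->
  set_power U n g.
Proof.
move=> U1 mn Ug; rewrite -(subnK mn) -[g]mul1g; apply: set_powerD => //.
by exists (fun=> 1%g); rewrite big1.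
Qed.

Lemma set_power_open U n : open U -> (0 < n)%N -> open (set_power U n).
Proof.
move=> oU; case: n => // n _.
rewrite [X in open X](_ : _ = \bigcup_(b in set_power U n) [set g | U (g * b^-1)%g]); last first.
  apply/seteqP; split=> g /=.
    by move=> /set_powerS[a [b [Ua Ub ->]]]; exists b => //=; rewrite mulgK.
  by case=> b Ub /= Ug; apply/set_powerS; exists (g * b^-1)%g, b; rewrite mulgVK.
apply: bigcup_open => b _; apply: open_comp => // y _.
by apply: continuous_mulg => t; [exact: cvg_id|exact: cvg_cst].
Qed.

(** The union [H] of the powers is open. A translate [x U] that meets [H] forces [x] into [H]
    because [U] is symmetric, so the complement of [H] is open as well and connectedness leaves only
    the whole group. *)
Lemma connected_set_power U : connected [set: G] -> open U -> U 1%g ->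
  (forall x, U x -> U x^-1%g) -> forall g, exists2 n, (0 < n)%N & set_power U n g.
Proof.
move=> cG oU U1 UV; pose H := \bigcup_(n in [set n | (0 < n)%N]) set_power U n.
have oH : open H by apply: bigcup_open => n /= n0; exact: set_power_open.
suff HT : H = setT.
  move=> g.
  suff [n n0 Hg] : H g by exists n.
  by move: HT => /(congr1 (fun A => A g)) ->.
apply: cG.
- by exists 1%g, 1%N; [by []|exact: set_power1].
- by exists H => //; rewrite setTI.
- exists H; last by rewrite setTI.
  rewrite -[X in closed X]setCK; apply: open_closedC.
  rewrite [X in open X](_ : _ = \bigcup_(x in ~` H) [set y | U (x^-1 * y)%g]).
    by apply: bigcup_open => x _; exact: open_translate.
  apply/seteqP; split=> [x Hx|y [x Hx /= Uxy] [n /= n0 Hy]].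
    by exists x => //=; rewrite mulVg.
  apply: Hx; exists (n + 1)%N; first by rewrite /= addn1.
  rewrite (_ : x = y * (x^-1 * y)^-1)%g; last by rewrite invgM invgK mulVKg.
  by apply: set_powerD => //; apply: set_power1; exact: UV.
Qed.

(** Listing the centres allows a statement about all of them to be taken along a filter at once, and
    their number to bound measures. *)
Lemma compact_translates (C V : set G) : compact C -> open V -> V 1%g ->
  exists s : seq G, forall g, C g -> exists2 x, x \in s & V (x^-1 * g)%g.
Proof.
rewrite compact_cover => cC oV V1.
have [||s _ sC] := cC G setT (fun x => [set y | V (x^-1 * y)%g]).
- by move=> x _; exact: open_translate.
- by move=> x _; exists x => //=; rewrite mulVg.
by exists s => g /sC[x /= xs Vx]; exists x.
Qed.

End TopGroup.

(** * Word length *)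

Section Rho.
Variables (R : realType) (G : topGroupType) (U : set G).
Hypothesis hG : connected [set: G].
Hypothesis hU : admissible_nbhd U.
Implicit Types (g h u v : G).
Local Notation rho := (rho R U).

Lemma admissible1 : U 1%g. Proof. by case: hU. Qed.
Lemma admissible_open : open U. Proof. by case: hU. Qed.
Lemma admissibleV u : U u -> U u^-1%g. Proof. by case: hU => _ _ _; exact. Qed.
Lemma admissible_compact : compact (closure U).
Proof. by case: hU; rewrite precompactE. Qed.

Lemma rho_ex g : exists n, [/\ (0 < n)%N, set_power U n g & rho g = n%:R].
Proof.
have [n0 n00 Un0] := connected_set_power hG admissible_open admissible1 admissibleV g.
have /ex_minnP[n /andP[n1 /asboolP Un] nmin] :
  exists n, (0 < n)%N && `[< set_power U n g >].
  by exists n0; rewrite n00; apply/asboolP.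
exists n; split => //; apply/eqP; rewrite eq_le; apply/andP; split.
  apply: ge_inf; last by exists n.
  by exists 0 => _ [m _ <-].
apply: lb_le_inf; first by exists n%:R, n.
move=> _ [m [m0 Um] <-]; rewrite ler_nat; apply: nmin.
by rewrite m0; apply/asboolP.
Qed.

Lemma rho_le n g : (0 < n)%N -> set_power U n g -> rho g <= n%:R.
Proof.
by move=> n0 Un; apply: ge_inf; [exists 0 => _ [m _ <-]|exists n].
Qed.

(** Powers start at exponent 1, so [rho] is 1, not 0, at the identity. This is what makes
    [rho g <= rho g ^+ 2] available in the stability estimate. *)
Lemma rho_ge1 g : 1 <= rho g.
Proof. by have [n [n0 _ ->]] := rho_ex g; rewrite ler1n. Qed.

Lemma rho_gt0 g : 0 < rho g. Proof. exact: lt_le_trans (rho_ge1 g). Qed.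
Lemma rho_ge0 g : 0 <= rho g. Proof. exact/ltW/rho_gt0. Qed.

Lemma rhoM g h : rho (g * h)%g <= rho g + rho h.
Proof.
have [n [n0 Un ->]] := rho_ex g; have [m [m0 Um ->]] := rho_ex h.
by rewrite -natrD; apply: rho_le; [rewrite addn_gt0 n0|exact: set_powerD].
Qed.

Lemma rhoV g : rho g^-1%g = rho g.
Proof.
have le h : rho h^-1%g <= rho h.
  by have [n [n0 Un ->]] := rho_ex h; apply: rho_le => //; apply: set_powerV => //; exact: admissibleV.
by apply/eqP; rewrite eq_le le -{1}[g]invgK le.
Qed.

Lemma rhoU u : U u -> rho u = 1.
Proof.
move=> Uu; apply/eqP; rewrite eq_le rho_ge1 andbT.
by apply: (@rho_le 1%N) => //; exact: set_power1.
Qed.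

(** The extra 1 accounts for [n = 0], where [rho 1 = 1]. *)
Lemma rhoX u n : U u -> rho (u ^+ n)%g <= n.+1%:R.
Proof.
move=> Uu; elim: n => [|n IH].
  by rewrite expg0 rhoU//; exact: admissible1.
rewrite expgS (le_trans (rhoM _ _))// rhoU// -natr1 addrC lerD2r; exact: IH.
Qed.

Lemma set_power_rho n g : (0 < n)%N -> set_power U n g = (rho g <= n%:R).
Proof.
move=> n0; apply/propext; split=> [|le]; first exact: rho_le.
have [m [m0 Um E]] := rho_ex g; apply: set_power_le Um; first exact: admissible1.
by rewrite -(ler_nat R) -E.
Qed.

(** Induction on words rather than on shortest words: [x] is the length of some word for [g], hence
    only an upper bound of [rho g]. *)
Lemma rho_ind (P : G -> R -> Prop) :
  (forall u, U u -> P u 1) ->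
  (forall u g x, U u -> rho g <= x -> P g x -> P (u * g)%g (x + 1)) ->
  forall g, P g (rho g).
Proof.
move=> P1 PS g; have [n [n0 Un ->]] := rho_ex g.
elim: n g n0 Un => // -[|n] IH g _.
  move=> /set_powerS[a [b [Ua [u [_ ->]] ->]]].
  by rewrite big_ord0 mulg1; exact: P1.
move=> /set_powerS[a [b [Ua Ub ->]]]; rewrite -natr1.
by apply: PS => //; [exact: rho_le|exact: IH].
Qed.

(** * Stability of homomorphisms into the reals *)

Definition additive_map (eta : G -> R) :=
  continuous eta /\ forall g h, eta (g * h)%g = eta g + eta h.

(** Unlike that of a quasimorphism, the defect may grow with the lengths. For the drift, the factor
    [rho h] comes from the subadditivity of [D], which turns a bound on [U] into one linear in the
    length. *)
Definition quasi_additive (delta : R) (F : G -> R) :=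
  forall g h, `|F (g * h)%g - F g - F h| <= delta * rho g * rho h.

(** Prefixing one letter to a word of length [x] costs [t] for the letter and at most [delta * x]
    for the defect; the linear costs add up to at most [delta * x ^+ 2]. *)
Lemma quasi_additive_growth delta t F : 0 <= delta -> quasi_additive delta F ->
  (forall u, U u -> `|F u| <= t) ->
  forall g, `|F g| <= rho g * t + delta * rho g ^+ 2.
Proof.
move=> d0 qF Ft; apply: (@rho_ind (fun g x => `|F g| <= x * t + delta * x ^+ 2)).
  by move=> u Uu; rewrite mul1r expr1n mulr1; apply: ler_wpDr => //; exact: Ft.
move=> u g x Uu gx Fg.
have := qF u g; rewrite rhoU// mulr1 => /ler_normlP[q1 q2].
have := Ft u Uu => /ler_normlP[f1 f2].
have := Fg => /ler_normlP[g1 g2].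
have dg : delta * rho g <= delta * x by rewrite ler_wpM2l.
have dx : 0 <= delta * x.
  by rewrite mulr_ge0// (le_trans _ gx)// rho_ge0.
rewrite mulrDl mul1r sqrrD mulr1 expr1n mulr2n !mulrDr mulr1.
by apply/ler_normlP; split; lra.
Qed.

(** Dividing by the exponent turns a bound on [F] over [U] into a much smaller one at an element
    with a high power in [U]. This stands in for continuity, which [F] need not have. *)
Lemma quasi_additive_expg delta F u n : 0 <= delta -> quasi_additive delta F ->
  U u -> `|F (u ^+ n.+1)%g - n.+1%:R * F u| <= delta * n.+1%:R ^+ 2.
Proof.
move=> d0 qF Uu; elim: n => [|n IH].
  by rewrite expg1 mul1r subrr normr0 expr1n mulr1.
have := qF u (u ^+ n.+1)%g; rewrite rhoU// mulr1 -expgS => /ler_normlP[q1 q2].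
have := IH => /ler_normlP[i1 i2].
have : delta * rho (u ^+ n.+1)%g <= delta * n.+2%:R by rewrite ler_wpM2l// rhoX.
rewrite -[n.+2%:R]natr1 in i1 i2 *; set x := n.+1%:R in i1 i2 *.
have x1 : delta <= delta * x by rewrite ler_peMr// /x ler1n.
rewrite sqrrD mulr1 expr1n mulr2n !mulrDr mulr1 mulrDl mul1r => le.
by apply/ler_normlP; split; lra.
Qed.

(** For [v] near the identity the power [v ^+ n.+1] still lies in [U], so [|eta v| <= M / n.+1];
    additivity carries this smallness to every point. *)
Lemma bounded_additive_continuous (eta : G -> R) M :
  (forall g h, eta (g * h)%g = eta g + eta h) ->
  (forall u, U u -> `|eta u| <= M) -> continuous eta.
Proof.
move=> etaM etaU.
have etaX n g : eta (g ^+ n)%g = n%:R * eta g.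
  elim: n => [|n IH].
    have := etaM 1%g 1%g; rewrite mulg1 expg0 mul0r => E; lra.
  by rewrite expgS etaM IH -natr1 mulrDl mul1r addrC.
move=> x; apply/cvgrPdist_le => e e0.
have M0 : 0 <= M by apply: le_trans (etaU _ admissible1); exact: normr_ge0.
have [n Hn] : exists n, M <= n.+1%:R * e.
  exists (Num.trunc (M / e)); rewrite -ler_pdivrMr//; apply/ltW/truncnS_gt.
have nU : nbhs (1%g : G) [set v | U (v ^+ n.+1)%g].
  have := @continuous_expg G n.+1 1%g U; rewrite expg1n; apply.
  by apply: open_nbhs_nbhs; split; [exact: admissible_open|exact: admissible1].
have := nbhs_translate x nU; apply: filterS => y /= Uy.
have := etaM x (x^-1 * y)%g; rewrite mulVKg => ->.
rewrite opprD addrA subrr add0r normrN.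
have := etaU _ Uy; rewrite etaX normrM normr_nat => le.
rewrite -(@ler_pM2l _ n.+1%:R)//; lra.
Qed.

End Rho.

Lemma filter_all_seq (T : eqType) (I : Type) (F : set_system I) (FF : Filter F)
    (P : T -> set I) (s : seq T) :
  (forall x, F (P x)) -> F [set i | forall x, x \in s -> P x i].
Proof.
move=> FP; elim: s => [|x s IH]; first by apply: filterS filterT => i _ x.
apply: filterS (filterI (FP x) IH) => i [Pi IHi] y; rewrite inE => /predU1P[->//|].
exact: IHi.
Qed.

(** The image of the ultrafilter has a cluster point in a compact segment, and a set of indices that
    stays away from a cluster point cannot belong to it. *)
Lemma ultra_bounded_cvg (R : realType) (I : Type) (F : set_system I)
    (UF : UltraFilter F) (f : I -> R) (B : R) :
  (forall i, `|f i| <= B) -> exists l : R, forall e : R, 0 < e -> F [set i | `|f i - l| <= e].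
Proof.
move=> fB; have [|l [_ cl]] := @segment_compact R (- B) B (f @ F) _.
  by apply: (@filterE _ F) => i /=; rewrite in_itv /= -ler_norml; exact: fB.
exists l => e e0.
have [//|nF] := in_ultra_setVsetC [set i | `|f i - l| <= e] UF.
have nl : nbhs l [set y | `|y - l| <= e].
  by apply/nbhs_ballP; exists e => //= y; rewrite /ball/= distrC => /ltW.
have [y []] := cl _ _ (nF : (f @ F) [set y | ~ `|y - l| <= e]) nl.
by [].
Qed.

Section Stability.
Variables (R : realType) (G : topGroupType) (U : set G).
Hypothesis hG : connected [set: G].
Hypothesis hU : admissible_nbhd U.
Implicit Types (g h u v : G).
Local Notation rho := (rho R U).

(* Otherwise there are maps H_k with defect at most 1/k staying away from all
   homomorphisms on U. Their limit along an ultrafilter is a homomorphism, and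
   the convergence is uniform on U because |H_k| is small on {v | v^16 in U}. *)
Lemma quasi_additive_near : exists k : nat, forall H : G -> R,
  quasi_additive U k.+1%:R^-1 H -> (forall u, U u -> `|H u| <= 2) ->
  exists2 eta : G -> R, additive_map eta & forall u, U u -> `|H u - eta u| <= 2^-1.
Proof.
apply: contrapT => /forallNP nk.
have /choice[H HP] : forall k : nat, exists H : G -> R,
    [/\ quasi_additive U k.+1%:R^-1 H, forall u, U u -> `|H u| <= 2
      & forall eta : G -> R, additive_map eta ->
          exists2 u, U u & 2^-1 < `|H u - eta u|].
  move=> k; have /existsNP[H /not_implyP[qH /not_implyP[bH nH]]] := nk k.
  exists H; split => // eta ea; apply: contrapT => nu; apply: nH.
  exists eta => // u Uu; rewrite leNgt; apply/negP => lt; apply: nu; by exists u.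
(* Pointwise limits are wanted at all [g] simultaneously, and [G] may be uncountable: an ultrafilter
   replaces the extraction of a subsequence. *)
have [F [UF Foo]] := ultraFilterLemma (eventually_filter).
have k0 k : 0 <= (k.+1%:R : R)^-1 by rewrite invr_ge0.
have Hbd g k : `|H k g| <= rho g * 2 + rho g ^+ 2.
  have [qH bH _] := HP k.
  apply: (le_trans (quasi_additive_growth hG hU (k0 k) qH bH g)).
  by rewrite lerD2l ler_piMl ?exprn_ge0 ?rho_ge0// invf_le1// ler1n.
have /choice[eta etaP] g := ultra_bounded_cvg UF (Hbd g).
have small (c e : R) : 0 < e -> F [set k : nat | k.+1%:R^-1 * c <= e].
  move=> e0; apply: Foo; exists (Num.trunc (c / e)) => // k /= ck.
  rewrite ler_pdivrMl// mulrC -ler_pdivrMl// mulrC; apply: ltW.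
  by apply: lt_le_trans (truncnS_gt _) _; rewrite ler_nat.
have FI A B : F A -> F B -> F (A `&` B) by exact: filterI.
have Fex A : F A -> exists k, A k by exact: filter_ex.
have etaM g h : eta (g * h)%g = eta g + eta h.
  apply/eqP; rewrite -subr_eq0 opprD addrA -normr_le0; apply/ler_addgt0Pr => e e0.
  have e4 : (0 : R) < e / 4 by rewrite divr_gt0.
  have /Fex[k [[[kgh kg] kh] ks]] := FI _ _ (FI _ _ (FI _ _ (etaP (g * h)%g _ e4) (etaP g _ e4)) (etaP h _ e4)) (small (rho g * rho h) _ e4).
  have [/(_ g h) qH _ _] := HP k; move: kgh kg kh ks => /= kgh kg kh ks.
  have := le_trans (qH) (eq_ind _ (fun x => x <= e / 4) ks _ (mulrA _ _ _)).
  move: kgh kg kh => /ler_normlP[b1 b2] /ler_normlP[c1 c2] /ler_normlP[d1 d2] /ler_normlP[a1 a2].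
  by apply/ler_normlP; split; lra.
have etaU u : U u -> `|eta u| <= 2.
  move=> Uu; apply/ler_addgt0Pr => e e0.
  have /Fex[k /= ke] := etaP u _ e0.
  have [_ /(_ u Uu) bH _] := HP k.
  by rewrite (_ : eta u = H k u - (H k u - eta u)) ?(le_trans (ler_normB _ _)) ?lerD//; lra.
have eta_hom : additive_map eta.
  by split=> //; exact: (bounded_additive_continuous hU etaM etaU).
pose V := U `&` [set v | U (v ^+ 16)%g].
have oV : open V.
  apply: openI; first exact: (admissible_open hU).
  apply: open_comp (admissible_open hU) => v _; exact: continuous_expg.
have V1 : V 1%g by split=> /=; rewrite ?expg1n; exact: (admissible1 hU).
have [s sU] := compact_translates (admissible_compact hU) oV V1.
(* Write [u = x v] with [x] in the finite list. The errors are 1/32 for [H k x - eta x], 1/16 for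
   the defect at [(x, v)], at most (2 + 1)/16 for [H k v] as [256 / k.+1 <= 1], and 2/16 for
   [eta v]: 13/32 in all, below 1/2. *)
have e1 : 0 < 32^-1 :> R by rewrite invr_gt0.
have e2 : 0 < 16^-1 :> R by rewrite invr_gt0.
have F1 : F [set k | forall x, x \in s -> `|H k x - eta x| <= 32^-1].
  by apply: filter_all_seq => x; exact: etaP.
have F2 : F [set k | forall x, x \in s -> k.+1%:R^-1 * rho x <= 16^-1].
  by apply: filter_all_seq => x; exact: small.
have [k [[/= ks1 ks2] /= k3]] := Fex _ (FI _ _ (FI _ _ F1 F2) (small 256 _ ltr01)).
have [qH bH /(_ eta eta_hom)[u Uu]] := HP k; move: (k0 k) k3 ks2 qH; move: (k.+1%:R^-1) => dl dl0 k3 ks2 qH; rewrite ltNge => /negP; apply.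
have [x xs [/= Uv Uv16]] := sU u (subset_closure Uu).
set v := (x^-1 * u)%g in Uv Uv16.
have uE : u = (x * v)%g by rewrite /v mulVKg.
have := ks1 x xs; have := ks2 x xs; have := qH x v; rewrite (rhoU R hG hU Uv) mulr1.
have := quasi_additive_expg hG hU 15 dl0 qH Uv.
have qeta : quasi_additive U 0 eta by move=> g h; rewrite etaM !mul0r normr_le0; apply/eqP; lra.
have := quasi_additive_expg hG hU 15 (lexx 0) qeta Uv.
have := bH _ Uv16; have := etaU _ Uv16; rewrite uE mul0r; have eE := etaM x v.
move: k3 => /=; rewrite (_ : 16%:R ^+ 2 = 256 :> R); last by rewrite -natrX.
move=> k3 /ler_normlP[a1 a2] /ler_normlP[b1 b2] /ler_normlP[c1 c2] /ler_normlP[d1 d2].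
move=> /ler_normlP[f1 f2] f3 /ler_normlP[g1 g2].
by apply/ler_normlP; split; lra.
Qed.

(** Let [D] be the distance on [U] from [F] to the homomorphisms. If [D > k.+1 * delta], subtract a
    homomorphism at distance below [2 D] and divide by [D]: the result satisfies the hypotheses of
    [quasi_additive_near], which produces a homomorphism at distance [D / 2] from [F], a
    contradiction. From [U] the bound spreads by [quasi_additive_growth]. *)
Lemma quasi_additive_stable : exists2 C : R, 0 < C &
  forall (F : G -> R) delta M, 0 <= delta -> quasi_additive U delta F ->
    (forall g, `|F g| <= M * rho g) ->
    exists2 eta : G -> R, additive_map eta &
      forall g, `|F g - eta g| <= C * delta * rho g ^+ 2.
Proof.
have [k Hk] := quasi_additive_near.
(* Two units above the [k.+1] of the infimum: one to come within [delta] of it, one for the growth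
   away from [U]. *)
exists (k.+3%:R) => // F delta M d0 qF FM.
have FU u : U u -> `|F u| <= M by move=> Uu; have := FM u; rewrite (rhoU R hG hU Uu) mulr1.
(* Without defect [F] itself is a homomorphism. Otherwise [delta > 0] serves as the slack in
   approaching the infimum. *)
move: d0; rewrite le_eqVlt => /predU1P[d0|d0].
  have FA g h : F (g * h)%g = F g + F h.
    have := qF g h; rewrite -d0 !mul0r normr_le0 => /eqP; lra.
  exists F; first by split => //; exact: (bounded_additive_continuous hU FA FU).
  by move=> g; rewrite subrr normr0 -d0 mulr0 mul0r.
pose S := [set t : R | 0 <= t /\ exists2 eta : G -> R, additive_map eta & forall u, U u -> `|F u - eta u| <= t].
have M0 : 0 <= M by apply: le_trans (FU _ (admissible1 hU)).
have S0 : S !=set0.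
  exists M; split => //; exists (fun=> 0).
    by split=> [x|g h]; [exact: cvg_cst|rewrite addr0].
  by move=> u Uu; rewrite subr0; exact: FU.
have lbS : lbound S 0 by move=> t [].
have infS : has_inf S by split => //; exists 0.
have near_inf e : 0 < e -> exists t, S t /\ t < inf S + e.
  by move=> e0; have [t St lt] := inf_adherent e0 infS; exists t.
have inf_le : inf S <= k.+1%:R * delta.
  rewrite leNgt; apply/negP => lt; set D := inf S in lt near_inf.
  have D0 : 0 < D by apply: le_lt_trans lt; rewrite mulr_ge0// ltW.
  have [t [[_ [eta0 [ceta0 etaM0] Feta0]] tD]] := near_inf D D0.
  have [||eta [ceta etaM] Heta] := Hk (fun g => (F g - eta0 g) / D).
  - move=> g h; rewrite etaM0.
    rewrite (_ : _ - _ - _ = (F (g * h)%g - F g - F h) / D); last by field; rewrite gt_eqF.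
    rewrite normrM (@gtr0_norm _ D^-1) ?invr_gt0// ler_pdivrMr//.
    apply: (le_trans (qF g h)).
    rewrite (_ : _ * D = k.+1%:R^-1 * D * rho g * rho h); last by ring.
    rewrite !ler_wpM2r ?(rho_ge0 R hG hU)//.
    by rewrite ler_pdivlMl//; exact: ltW.
  - move=> u Uu; rewrite normrM (@gtr0_norm _ D^-1) ?invr_gt0// ler_pdivrMr//.
    by apply: (le_trans (Feta0 u Uu)); lra.
  have : S (D / 2).
    split; first by lra.
    exists (fun g => eta0 g + D * eta g).
      split=> [x|g h]; last by rewrite etaM0 etaM; lra.
      by apply: cvgD; [exact: ceta0|apply: cvgM; [exact: cvg_cst|exact: ceta]].
    move=> u Uu; have := Heta u Uu.
    rewrite -(ler_pM2l D0) -{1}(gtr0_norm D0) -normrM mulrBr mulrCA divff ?gt_eqF// mulr1.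
    by rewrite opprD addrA.
  move=> /(ge_inf (proj2 infS)); rewrite -/D; lra.
have [t [[t0 [eta [ceta etaM] Feta]] tD]] := near_inf delta d0.
exists eta => // g.
have qE : quasi_additive U delta (fun g => F g - eta g).
  move=> x y; rewrite etaM (_ : _ - _ - _ = F (x * y)%g - F x - F y); first exact: qF.
  by lra.
apply: (le_trans (quasi_additive_growth hG hU (ltW d0) qE Feta g)).
have r1 := rho_ge1 R hG hU g; have r2 : rho g <= rho g ^+ 2 by rewrite expr2 ler_peMr// (le_trans ler01).
have tk : t <= k.+2%:R * delta by rewrite -natr1 mulrDl mul1r; lra.
apply: (@le_trans _ _ (rho g ^+ 2 * (k.+2%:R * delta) + delta * rho g ^+ 2)).
  by rewrite lerD2r ler_pM// (le_trans ler01).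
by rewrite -[k.+3%:R]natr1; lra.
Qed.

End Stability.

(** * Homomorphisms into the reals factor through pi1 *)

Section Additive.
Variable R : realType.

(** The difference [g t = f t - t * f 1] vanishes on the integers, hence is periodic, hence bounded
    by its extrema on [[0, 1]]; a bounded additive function is zero. *)
Lemma additive_real_linear (f : R -> R) : continuous f ->
  (forall s t, f (s + t) = f s + f t) -> forall t, f t = t * f 1.
Proof.
move=> cf fD.
pose g t := f t - t * f 1.
have gD s t : g (s + t) = g s + g t by rewrite /g fD; ring.
have cg : continuous g.
  move=> t; apply: cvgB; first exact: cf.
  by apply: cvgM; [exact: cvg_id|exact: cvg_cst].
have g1 : g 1 = 0 by rewrite /g mul1r subrr.
have g0 : g 0 = 0 by have := gD 0 0; rewrite addr0; lra.
have gn (n : nat) t : g (n%:R * t) = n%:R * g t.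
  elim: n => [|n IH]; first by rewrite !mul0r.
  by rewrite -natr1 !mulrDl !mul1r gD IH.
have gz (z : int) : g z%:~R = 0.
  case: z => n; first by have := gn n 1; rewrite mulr1 g1 mulr0.
  have := gD n.+1%:R (- n.+1%:R); rewrite subrr g0; have := gn n.+1 1.
  by rewrite mulr1 g1 mulr0 NegzE mulrNz => ->; rewrite add0r => <-.
have [M Mg] : exists M, forall t, `|g t| <= M.
  have cgI : {within `[0, 1], continuous g} by apply: continuous_subspaceT.
  have [c _ cM] := EVT_max ler01 cgI.
  have [d _ dm] := EVT_min ler01 cgI.
  exists (`|g c| + `|g d|) => t.
  have -> : g t = g (t - (Num.floor t)%:~R) by have := gD (t - (Num.floor t)%:~R) (Num.floor t)%:~R; rewrite subrK gz addr0.
  have tI : t - (Num.floor t)%:~R \in `[0, 1].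
    rewrite in_itv /= subr_ge0 floor_le_tmp /= lerBlDl ltW//.
    by rewrite -[X in _ + X]/(1%:~R) -intrD floorD1_gt.
  have := cM _ tI; have := dm _ tI.
  have := ler_norm (g c); have := ler_norm (- g d); rewrite normrN.
  have := normr_ge0 (g c); have := normr_ge0 (g d).
  by move=> *; apply/ler_normlP; split; lra.
move=> t; apply/eqP; rewrite -subr_eq0 -/(g t) -normr_le0 leNgt; apply/negP => gt0.
have := Mg ((Num.trunc (M / `|g t|)).+1%:R * t); rewrite gn normrM normr_nat.
by rewrite -ler_pdivlMr// leNgt truncnS_gt.
Qed.

Lemma row_sum_coord (V : zmodType) n (v : 'rV[V]_n) :
  v = \sum_i \row_j (if j == i then v ord0 i else 0).
Proof.
apply/rowP => j; rewrite summxE (bigD1 j)//= mxE eqxx big1 ?addr0//.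
by move=> i ij; rewrite mxE eq_sym (negPf ij).
Qed.

(** The entries range over an arbitrary topological space because they are reals in one use and
    points of the circle in the other. *)
Lemma continuous_coord_row (T : topologicalType) (V : topologicalType) (z : V) n (i : 'I_n)
    (f : T -> V) : continuous f ->
  continuous (fun t => \row_j (if j == i then f t else z)).
Proof.
move=> cf t A [P nP PA].
have nf : nbhs t [set s | P ord0 i (f s)].
  by apply: (cf t); have := nP ord0 i; rewrite mxE eqxx.
apply: filterS nf => s Ps; apply: PA => k j; rewrite mxE ord1.
have [->//|ji] := eqVneq j i.
by have := nP ord0 j; rewrite mxE (negPf ji) => /nbhs_singleton.
Qed.

Lemma continuous_pair (S T V : topologicalType) (f : S -> T) (g : S -> V) :
  continuous f -> continuous g -> continuous (fun s => (f s, g s)).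
Proof. by move=> cf cg s; apply: cvg_pair; [exact: cf|exact: cg]. Qed.

End Additive.

Section Homomorphisms.
Variables (R : realType) (G : topGroupType) (eta : G -> R).
Hypothesis eta_hom : additive_map eta.

Lemma additive_map1 : eta 1%g = 0.
Proof. by case: eta_hom => _ /(_ 1%g 1%g); rewrite mulg1; lra. Qed.

Lemma additive_mapV g : eta g^-1%g = - eta g.
Proof. by case: eta_hom => _ /(_ g g^-1%g); rewrite mulgV additive_map1; lra. Qed.

(** The kernel of [eta] is a closed subgroup, and it contains the commutators because addition of
    reals is commutative. *)
Lemma additive_map_G0 g : G0 g -> eta g = 0.
Proof.
have [ceta etaM] := eta_hom.
have cH : closed [set g | eta g = 0].
  rewrite (_ : mkset _ = eta @^-1` [set 0])//.
  by apply: closed_comp => // x _; exact: ceta.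
move=> Gg; have : closure [set g | eta g = 0] g; last by rewrite -(closure_id _).1.
apply: closureS Gg => x; apply.
  split=> /=; first exact: additive_map1.
  by move=> a b ea eb; rewrite etaM additive_mapV ea eb oppr0 addr0.
move=> a b /=; rewrite commgEl conjgE !etaM !additive_mapV; lra.
Qed.

Local Open Scope quotient_scope.

Lemma additive_map_pi0 x y : pi0 x = pi0 y -> eta x = eta y.
Proof.
move=> /eqmodP/asboolP/additive_map_G0; case: eta_hom => _ ->.
by rewrite additive_mapV; lra.
Qed.

(** Transported to [R^q x T^r], [eta] is linear on each real axis. On a circle its pullback to the
    line is linear too, but 1 and 0 are the same point there, so the slope vanishes and only the
    [R^q] coordinates survive. *)
Lemma additive_map_pi1 (q r : nat) (phi : abelianization G -> 'rV[R]_q * 'rV[circle R]_r) :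
  is_abelianization_iso phi ->
  exists a : 'I_q -> R, forall g, eta g = \sum_i a i * pi1 phi i g.
Proof.
move=> [phiM cphi [psi [phiK psiK cpsi]]].
have [ceta etaM] := eta_hom.
pose etab (x : abelianization G) : R := eta (repr x).
have etabE g : etab (pi0 g) = eta g.
  by apply: additive_map_pi0; rewrite /pi0 reprK.
have cetab : continuous etab.
  by apply: repr_comp_continuous => // a b /eqP ab; apply/eqP/additive_map_pi0.
pose f v := etab (psi v).
have cf : continuous f by move=> v; apply: continuous_comp; [exact: cpsi|exact: cetab].
have fE g : f (phi (pi0 g)) = eta g by rewrite /f phiK etabE.
have fD v w : f (v + w) = f v + f w.
  have pE u : u = phi (pi0 (repr (psi u))) by rewrite /pi0 reprK psiK.
  by rewrite (pE v) (pE w) -phiM !fE etaM.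
have f0 : f 0 = 0 by have := fD 0 0; rewrite addr0; lra.
have fsum1 (I : finType) (F : I -> 'rV[R]_q) : f (\sum_i F i, 0) = \sum_i f (F i, 0).
  apply: (big_ind2 (fun u x => f (u, 0) = x)) => // u x v y <- <-.
  by rewrite -fD; congr f; congr pair; rewrite addr0.
have fsum2 (I : finType) (F : I -> 'rV[circle R]_r) : f (0, \sum_i F i) = \sum_i f (0, F i).
  apply: (big_ind2 (fun u x => f (0, u) = x)) => // u x v y <- <-.
  by rewrite -fD; congr f; congr pair; rewrite addr0.
pose e (i : 'I_q) (t : R) : 'rV[R]_q := \row_j (if j == i then t else 0).
have fe i t : f (e i t, 0) = t * f (e i 1, 0).
  apply: (additive_real_linear (f := fun t => f (e i t, 0))).
    have cp : continuous (fun s : R => (e i s, 0 : 'rV[circle R]_r)).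
      apply: continuous_pair => s; last exact: cvg_cst.
      by apply: (@continuous_coord_row _ _ 0 _ i id) => x; exact: cvg_id.
    by move=> s; exact: (cvg_comp _ _ (cp s) (cf _)).
  move=> s u; rewrite -fD; congr f; congr pair; last by rewrite addr0.
  by apply/rowP => j; rewrite !mxE; case: ifP; rewrite ?addr0.
pose ec (i : 'I_r) (c : circle R) : 'rV[circle R]_r := \row_j (if j == i then c else 0).
pose cpi (t : R) : circle R := \pi_(circle R) t.
have cpiD s t : cpi (s + t) = cpi s + cpi t by exact: (raddfD (\pi_(Quotient.quot (int_closed R)))).
have fc i c : f (0, ec i c) = 0.
  have lin t : f (0, ec i (cpi t)) = t * f (0, ec i (cpi 1)).
    apply: (additive_real_linear (f := fun t => f (0, ec i (cpi t)))).
      have cp : continuous (fun s : R => (0 : 'rV[R]_q, ec i (cpi s))).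
        apply: continuous_pair => s; first exact: cvg_cst.
        have := @continuous_coord_row R (circle R) 0 r i cpi; apply.
        exact: pi_continuous.
      by move=> s; exact: (cvg_comp _ _ (cp s) (cf _)).
    move=> s u; rewrite -fD; congr f; congr pair; first by rewrite addr0.
    by apply/rowP => j; rewrite !mxE cpiD; case: ifP; rewrite ?addr0.
  have cpi1 : cpi 1 = 0.
    have : (1 : R) - 0 \in int_closed R by rewrite subr0; exact: int_num1.
    by rewrite Quotient.idealrBE => /eqP E; rewrite /cpi E; exact: (raddf0 (\pi_(Quotient.quot (int_closed R)))).
  have -> : c = cpi (repr c) by rewrite /cpi reprK.
  rewrite lin cpi1 (_ : ec i 0 = 0) ?f0 ?mulr0//.
  by apply/rowP => j; rewrite !mxE if_same.
exists (fun i => f (e i 1, 0)) => g.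
rewrite -fE; case E : (phi (pi0 g)) => [v c].
have -> : f (v, c) = f (v, 0) + f (0, c) by rewrite -fD; congr f; congr pair; rewrite ?addr0 ?add0r.
rewrite (row_sum_coord c) fsum2 [X in _ + X]big1 ?addr0; last by move=> i _; exact: fc.
rewrite (row_sum_coord v) fsum1; apply: eq_bigr => i _.
by rewrite -/(e i _) fe mulrC /pi1 E.
Qed.

End Homomorphisms.

(** * Haar measure *)

Section Density.
Context d (T : measurableType d) (R : realType).
Variables (mu nu : {measure set T -> \bar R}) (w : T -> R).
Hypothesis mw : measurable_fun [set: T] w.
Hypothesis w0 : forall x, 0 <= w x.
Hypothesis nuE : forall A, measurable A -> nu A = (\int[mu]_(x in A) (w x)%:E)%E.
Local Open Scope ereal_scope.
Import HBNNSimple.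

Lemma nnsfun_integral_density (h : {nnsfun T >-> R}) :
  \int[nu]_x (h x)%:E = \int[mu]_x ((h x)%:E * (w x)%:E).
Proof.
have mwE : measurable_fun [set: T] (fun x => (w x)%:E) by exact/measurable_EFinP.
have mI r : measurable_fun setT (fun x => (\1_(h @^-1` [set r]) x)%:E : \bar R).
  exact/measurable_EFinP.
transitivity (\sum_(r \in range h) \int[nu]_x (r * \1_(h @^-1` [set r]) x)%:E).
  rewrite -ge0_integral_fsum//.
  - by apply: eq_integral => x _; rewrite fsumEFin// -fimfunE.
  - by move=> r; exact/measurable_EFinP/measurable_funM.
  - by move=> r x _; rewrite nnfun_muleindic_ge0.
transitivity (\sum_(r \in range h) \int[mu]_x ((r * \1_(h @^-1` [set r]) x)%:E * (w x)%:E)); last first.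
  rewrite -ge0_integral_fsum//.
  - apply: eq_integral => x _; rewrite -ge0_mule_fsuml; last by move=> r; rewrite nnfun_muleindic_ge0.
    by rewrite fsumEFin// -fimfunE.
  - by move=> r; apply: emeasurable_funM => //; exact/measurable_EFinP/measurable_funM.
  - by move=> r x _; rewrite mule_ge0 ?nnfun_muleindic_ge0// lee_fin.
apply: eq_fsbigr => r /[!inE] -[t _ <-].
have ht0 : (0 <= (h t)%:E) by rewrite lee_fin.
under eq_integral do rewrite EFinM.
rewrite ge0_integralZl// integral_indic// setIT nuE//.
under [RHS]eq_integral do rewrite EFinM -muleA.
rewrite ge0_integralZl//; last 2 first.
- by apply: emeasurable_funM.
- by move=> x _; rewrite -EFinM lee_fin mulr_ge0.
congr (_ * _); rewrite integral_mkcond; apply: eq_integral => x _.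
by rewrite patchE indicE; case: ifP => _ /=; rewrite ?mul1e ?mul0e.
Qed.

Lemma ge0_integral_density (f : T -> \bar R) : measurable_fun [set: T] f ->
  (forall x, 0 <= f x) -> \int[nu]_x f x = \int[mu]_x (f x * (w x)%:E).
Proof.
move=> mf f0; pose h := nnsfun_approx measurableT mf.
have hf x : (h n x)%:E @[n --> \oo] --> f x by apply: cvg_nnsfun_approx.
transitivity (limn (fun n => \int[nu]_x (h n x)%:E)).
  rewrite -monotone_convergence//.
  - by apply: eq_integral => x _; apply/esym/cvg_lim => //; exact: hf.
  - by move=> n; exact/measurable_EFinP/measurable_funP.
  - by move=> n x _; rewrite lee_fin.
  - by move=> x _ a b ab; rewrite lee_fin; exact/lefP/nd_nnsfun_approx.
transitivity (limn (fun n => \int[mu]_x ((h n x)%:E * (w x)%:E))).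
  by congr (limn _); apply/funext => n; exact: nnsfun_integral_density.
rewrite -monotone_convergence//.
- apply: eq_integral => x _; apply/cvg_lim => //.
  by apply: cvgeZr => //; exact: hf.
- by move=> n; apply: emeasurable_funM; exact/measurable_EFinP.
- by move=> n x _; rewrite mule_ge0// lee_fin.
- move=> x _ a b ab; rewrite lee_wpmul2r ?lee_fin//; exact/lefP/nd_nnsfun_approx.
Qed.

End Density.

Lemma countable_bigcup_measurable d (T : measurableType d) I (D : set I)
    (F : I -> set T) : countable D -> (forall i, D i -> measurable (F i)) ->
  measurable (\bigcup_(i in D) F i).
Proof.
move=> /pfcard_geP[->|[f]] mF; first by rewrite bigcup_set0.
rewrite (_ : \bigcup_(i in D) F i = \bigcup_n F (f n)).
  by apply: bigcupT_measurable => n; apply: mF; exact: funS.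
apply/seteqP; split=> x [i Di Fx]; last by exists (f i) => //; exact: funS.
by have [n _ fn] := @surj _ _ _ _ f i Di; exists n => //; rewrite fn.
Qed.

(** * Borel measurability of the group operations *)

Section BorelGroup.
Variable G : topGroupType.
Hypothesis sc : @second_countable G.

Lemma open_borel (A : set G) : open A -> measurable (A : set (borel G)).
Proof. exact: sub_sigma_algebra. Qed.

Lemma continuous_borel (R : realType) (f : G -> R) : continuous f ->
  measurable_fun [set: borel G] (f : borel G -> R).
Proof.
move=> /continuousP cf; apply: (measurability _ (RGenOpens.measurableE R)).
move=> _ [_ [a [b ->] <-]]; rewrite setTI; apply: open_borel.
exact/cf/interval_open.
Qed.

Lemma continuous_borelT (d : measure_display) (T : measurableType d) (H : topGroupType)
  (f : T -> borel H) : (forall A : set H, open A -> measurable (f @^-1` A)) ->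
  measurable_fun [set: T] f.
Proof.
move=> fo; apply: (@measurability _ _ T (borel H) setT f (@open H) erefl).
by move=> _ [A oA <-]; rewrite setTI; exact: fo.
Qed.

Lemma measurable_invg : measurable_fun [set: borel G] (fun x : borel G => (x : G)^-1%g : borel G).
Proof.
apply: continuous_borelT => A oA; apply: open_borel.
by apply: open_comp => // x _; exact: invg_continuous.
Qed.

(** The product sigma-algebra is generated by rectangles; the countable base writes the preimage of
    an open set as a countable union of open rectangles. *)
Lemma measurable_mulg :
  measurable_fun [set: borel G * borel G] (fun x : borel G * borel G => ((x.1 : G) * (x.2 : G))%g : borel G).
Proof.
apply: continuous_borelT => A oA.
have [B cB [Bo Bb]] := sc.
rewrite (_ : _ @^-1` _ = \bigcup_(P in [set P : set G * set G | B P.1 /\ B P.2 /\ forall x y, P.1 x -> P.2 y -> A (x * y)%g]) (P.1 `*` P.2)).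
  apply: countable_bigcup_measurable; last first.
    by move=> P [B1 [B2 _]]; apply: measurableX; apply: open_borel; exact: Bo.
  apply: sub_countable (countableX cB cB); apply: subset_card_le.
  by move=> P [B1 [B2 _]].
apply/seteqP; split=> [[x y]/= Axy|[x y] [P [_ [_]] PA [P1 P2]]]; last exact: PA.
have [[P Q] /= [nP nQ] PQA] := @mulg_continuous G (x, y) A (open_nbhs_nbhs (conj oA Axy)).
have [P' [BP' P'x] P'P] := Bb x P nP.
have [Q' [BQ' Q'y] Q'Q] := Bb y Q nQ.
exists (P', Q') => //; split => //; split => // a b Pa Qb.
by apply: (PQA (a, b)); split; [exact: P'P|exact: Q'Q].
Qed.
End BorelGroup.

Section Haar.
Variables (R : realType) (G : topGroupType).
Hypothesis sc : @second_countable G.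
Variable mu : {measure set (borel G) -> \bar R}.
Hypothesis hmu : left_haar_measure mu.
Local Open Scope ereal_scope.

Lemma measurable_mulgl (a : G) :
  measurable_fun [set: borel G] (fun x : borel G => (a * x)%g : borel G).
Proof.
apply: continuous_borelT => A oA; apply: open_borel.
by apply: open_comp => // x _; exact: continuous_mulgl.
Qed.

Lemma haar_translate (a : G) (A : set (borel G)) : measurable A ->
  mu [set x | A (a * x)%g] = mu A.
Proof.
case: hmu => _ _ inv mA; rewrite -(inv (a^-1)%g A mA); congr (mu _).
apply/seteqP; split=> [x /= Ax|_ [x Ax <-]] /=; last by rewrite mulVKg.
by exists (a * x)%g => //; rewrite mulKg.
Qed.

Lemma integral_translate (a : G) (f : borel G -> \bar R) :
  measurable_fun setT f -> (forall x, 0 <= f x) ->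
  \int[mu]_x f (a * x)%g = \int[mu]_x f x.
Proof.
move=> mf f0.
pose phi : {mfun borel G >-> borel G} := HB.pack (fun x : borel G => (a * x)%g : borel G)
  (isMeasurableFun.Build _ _ _ _ _ (measurable_mulgl a)).
have := @ge0_integral_pushforward _ _ _ _ _ phi (measurable_mulgl a) mu setT f measurableT mf (fun x _ => f0 x).
rewrite preimage_setT => <-.
by apply: eq_measure_integral => A mA _; exact: haar_translate.
Qed.

Lemma ae_translate (a : G) (P : borel G -> Prop) : {ae mu, forall x, P x} ->
  {ae mu, forall x, P (a * x)%g}.
Proof.
move=> [N [mN N0 NP]]; exists [set x | N (a * x)%g]; split.
- by rewrite -[X in measurable X]setTI; apply: measurable_mulgl.
- by rewrite haar_translate.
- by move=> x /= nP; apply: NP.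
Qed.

Section Modular.
Variable Delta : G -> R.
Hypothesis hDelta : modular_function mu Delta.

Lemma integral_invg (f : borel G -> \bar R) :
  measurable_fun setT f -> (forall x, 0 <= f x) ->
  \int[mu]_x f ((x : G)^-1)%g = \int[mu]_x (f x * (Delta ((x : G)^-1)%g)%:E).
Proof.
move=> mf f0; have [D0 DM cD DE] := hDelta.
pose phi : {mfun borel G >-> borel G} := HB.pack (fun x : borel G => (x : G)^-1%g : borel G)
  (isMeasurableFun.Build _ _ _ _ _ (@measurable_invg G)).
have := @ge0_integral_pushforward _ _ _ _ _ phi (@measurable_invg G) mu setT f measurableT mf (fun x _ => f0 x).
rewrite preimage_setT => <-.
apply: (@ge0_integral_density _ _ _ mu (pushforward mu phi) (fun x : borel G => Delta ((x : G)^-1)%g)) => //.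
- apply: continuous_borel => x.
  by apply: cvg_comp; [exact: invg_continuous|exact: cD].
- by move=> x; apply/ltW/D0.
move=> A mA; rewrite -DE//; congr (mu _); apply/seteqP; split=> x /=.
  by move=> Ax; exists ((x : G)^-1%g) => //; rewrite invgK.
by move=> [y Ay <-]; rewrite /phi /= invgK.
Qed.

End Modular.

(** * Volume growth and integrability of exponentials of the length *)

Section Growth.
Variable U : set G.
Hypothesis hG : connected [set: G].
Hypothesis hU : admissible_nbhd U.
Local Notation rho := (rho R U).

Lemma borel_set_power n : (0 < n)%N -> measurable (set_power U n : set (borel G)).
Proof. by move=> n0; apply: open_borel; apply: set_power_open => //; exact: admissible_open hU. Qed.

(** Lengths are integers, so a sublevel set of [rho] is empty or an open power of [U]. *)
Lemma measurable_rho : measurable_fun [set: borel G] (rho : borel G -> R).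
Proof.
apply: (measurability _ (RGenOInfty.measurableE R)) => _ [_ [x ->] <-].
rewrite setTI (_ : _ @^-1` _ = ~` [set g | (rho g <= x)%R]); last first.
  apply/seteqP; split=> g /=; rewrite in_itv /= andbT.
    by move=> lt le; have := lt_le_trans lt le; rewrite ltxx.
  by move=> /negP; rewrite -ltNge.
apply: measurableC.
have [x1|x1] := ltP x 1%R.
  rewrite (_ : mkset _ = set0)//; apply/seteqP; split=> g //=.
  by have := rho_ge1 R hG hU g; lra.
have t0 : (0 < Num.trunc x)%N by rewrite truncn_gt0.
rewrite (_ : mkset _ = set_power U (Num.trunc x)); first exact: borel_set_power.
apply/seteqP; split=> g /=; rewrite (set_power_rho R hG hU)//.
  have [n [n0 Un ->]] := rho_ex R hG hU g.
  by rewrite ler_nat => le; rewrite truncn_ge_nat// (le_trans ler01).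
by move=> le; apply: le_trans le _; rewrite truncn_le (le_trans ler01).
Qed.

Lemma mu_admissible_lty : mu U < +oo.
Proof.
have [_ fin _] := hmu; apply: le_lt_trans (fin _ (admissible_compact hU)).
apply: le_measure; rewrite ?inE.
- by apply: open_borel; exact: admissible_open.
- rewrite -[closure U]setCK; apply: measurableC; apply: open_borel.
  by apply: closed_openC; exact: closed_closure.
- exact: subset_closure.
Qed.

Lemma measurable_translate (x : G) (A : set G) : open A ->
  measurable ([set g | A (x^-1 * g)%g] : set (borel G)).
Proof. by move=> oA; apply: open_borel; exact: open_translate. Qed.

Lemma mu_translates_le (A : set G) (s : seq G) : open A ->
  measurable ([set g | exists2 x, x \in s & A (x^-1 * g)%g] : set (borel G)) /\
  mu [set g | exists2 x, x \in s & A (x^-1 * g)%g] <= (size s)%:R%:E * mu A.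
Proof.
move=> oA; elim: s => [|x s [mS IH]].
  rewrite (_ : mkset _ = set0); last by apply/seteqP; split=> g //= -[].
  by rewrite measure0 mul0e.
have -> : [set g | exists2 y, y \in x :: s & A (y^-1 * g)%g] =
    [set g | A (x^-1 * g)%g] `|` [set g | exists2 x, x \in s & A (x^-1 * g)%g].
  apply/seteqP; split=> g /=.
    by move=> [y]; rewrite inE => /predU1P[->|ys] Ay; [left|right; exists y].
  by move=> [Ax|[y ys Ay]]; [exists x; rewrite ?mem_head|exists y; rewrite // inE ys orbT].
have mX := measurable_translate x oA; split; first exact: measurableU.
apply: (le_trans (measureU2 _ _ _)) => //.
rewrite /= -add1n natrD EFinD ge0_muleDl ?lee_fin// mul1e leeD//.
by rewrite haar_translate//; exact: open_borel.
Qed.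

Lemma set_powerSr n g : set_power U n.+1 g ->
  exists a b, [/\ set_power U n a, U b & g = (a * b)%g].
Proof.
have UV := @admissibleV _ _ hU.
move=> /(set_powerV UV)/set_powerS[a [b [Ua Ub E]]].
exists b^-1%g, a^-1%g; split; [exact: set_powerV|exact: UV|].
by rewrite -[g]invgK E invgM.
Qed.

(** Finitely many translates of [U] cover the relatively compact set [U U]. By induction on words,
    [U^(n+1)] is covered by at most [N^n] translates of [U], all of measure [mu U]. *)
Lemma set_power_growth : exists2 N : nat, (0 < N)%N &
  forall n, mu (set_power U n.+1) <= (N ^ n)%:R%:E * mu U.
Proof.
have oU := admissible_open hU; have U1 := admissible1 hU.
have cUU : compact ((fun x : G * G => (x.1 * x.2)%g) @` (closure U `*` closure U)).
  apply: continuous_compact; last by apply: compact_setX; exact: admissible_compact.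
  by apply: continuous_subspaceT => x; exact: mulg_continuous.
have [s sU] := compact_translates cUU oU U1.
(* The successor makes positivity of [N] immediate; [ln (2 N)] is taken later. *)
exists (size s).+1 => // n.
have [t [ts tU]] : exists t : seq G, (size t <= (size s).+1 ^ n)%N /\
    forall g, set_power U n.+1 g -> exists2 x, x \in t & U (x^-1 * g)%g.
  elim: n => [|n [t [ts IH]]].
    exists [:: 1%g]; split=> // g /set_powerSr[a [b [[u [_ ->]] Ub ->]]].
    by exists 1%g; rewrite ?mem_head// big_ord0 invg1 !mul1g.
  exists [seq (x * y)%g | x <- t, y <- s]; split.
    by rewrite size_allpairs expnSr leq_mul.
  move=> g /set_powerSr[a [b [/IH[x xt Ua] Ub ->]]].
  have [|y ys Uy] := sU (x^-1 * a * b)%g.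
    by exists (x^-1 * a, b)%g => //; split => /=; exact: subset_closure.
  exists (x * y)%g; first by apply/allpairsP; exists (x, y).
  by rewrite invgM -!mulgA mulgA; move: Uy; rewrite !mulgA.
have [mS le] := mu_translates_le t oU.
apply: (@le_trans _ _ ((size t)%:R%:E * mu U)).
  apply: le_trans le; apply: le_measure; rewrite ?inE//; exact: borel_set_power.
by rewrite lee_wpmul2r// lee_fin ler_nat.
Qed.

Lemma haar_sigma_finite : sigma_finite setT mu.
Proof.
have [N N0 growth] := set_power_growth.
exists (fun n => set_power U n.+1).
  apply/seteqP; split=> g // _.
  by have [[|n] [n0 Un _]] := rho_ex R hG hU g => //; exists n.
move=> n; split; first exact: borel_set_power.
apply: le_lt_trans (growth n) _; rewrite lte_mul_pinfty ?lee_fin//.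
exact: mu_admissible_lty.
Qed.

(** With [D = ln (2 N)], an element of length [n+1] has weight [(2 N)^-(n+1)], while [U^(n+1)] has
    measure at most [N^n mu U]: the sum over [n] is dominated by a geometric series of ratio 1/2. *)
Lemma integrable_exp_rho : exists2 D : R, (0 < D)%R &
  \int[mu]_g (expR (- D * rho g))%:E < +oo.
Proof.
have [N N0 growth] := set_power_growth.
have N2 : (1 < (2 * N)%:R :> R)%R by rewrite ltr1n mul2n -addnn (leq_add N0 N0).
pose D : R := ln (2 * N)%:R.
have D0 : (0 < D)%R by rewrite ln_gt0.
exists D => //.
have muU := mu_admissible_lty.
have expD n : expR (- D * n%:R) = ((2 * N)%:R ^- n)%R.
  rewrite mulrC expRM_natl expRN lnK ?exprVn// posrE (lt_trans ltr01)//.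
pose f n (g : borel G) : \bar R := (expR (- D * n.+1%:R) * \1_(set_power U n.+1) g)%:E.
have mf n : measurable_fun setT (f n).
  apply/measurable_EFinP/measurable_funM => //.
  by apply: measurable_indic; exact: borel_set_power.
have f0 n g : 0 <= f n g by rewrite lee_fin mulr_ge0 ?expR_ge0.
apply: (@le_lt_trans _ _ (\int[mu]_g \sum_(n <oo) f n g)).
  apply: ge0_le_integral => //.
  - apply/measurable_EFinP/measurableT_comp => //; apply: measurable_funM => //.
    exact: measurable_rho.
  - by apply: ge0_emeasurable_sum.
  move=> g _; have [[|n] [n0 Un ->]] := rho_ex R hG hU g => //.
  have := @nneseries_lim_ge R (fun n => f n g) xpredT 0 n.+1 (fun n _ _ => f0 n g).
  apply: le_trans; rewrite big_nat_recr//=.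
  rewrite [X in _ <= _ + X](_ : _ = (expR (- D * n.+1%:R))%:E).
    by rewrite leeDr// sume_ge0.
  by rewrite /f indicE mem_set// mulr1.
rewrite integral_nneseries//.
have C0 : (0 <= fine (mu U))%R by rewrite fine_ge0.
apply: (@le_lt_trans _ _ (\sum_(n <oo) (fine (mu U) / (2 ^ n.+1)%:R)%:E)); last first.
  by apply: le_lt_trans (epsilon_trick0 _ C0) _; rewrite ltry.
apply: lee_nneseries => [n _ _|n _]; first exact: integral_ge0.
under eq_integral do rewrite /f EFinM.
rewrite ge0_integralZl ?lee_fin ?expR_ge0//; last first.
  by apply/measurable_EFinP/measurable_indic; exact: borel_set_power.
rewrite integral_indic//; last exact: borel_set_power.
rewrite setIT (le_trans (lee_wpmul2l _ (growth n))) ?lee_fin ?expR_ge0//.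
rewrite muleA -EFinM -[mu U]fineK ?ge0_fin_numE// -EFinM lee_fin.
rewrite mulrC ler_wpM2l// expD natrM exprMn natrX.
rewrite invfM -mulrA natrX -[X in (_ <= X)%R]mulr1 ler_wpM2l ?invr_ge0 ?exprn_ge0//.
rewrite exprS invfM -mulrA mulVf ?expf_neq0 ?pnatr_eq0 -?lt0n// mulr1.
by rewrite invf_le1 ?ler1n ?ltr0n.
Qed.

End Growth.
End Haar.

(** * Square integrable functions *)

Section SquareIntegrable.
Context d (T : measurableType d) (R : realType).
Variable mu : {measure set T -> \bar R}.
Implicit Types f g : T -> R.
Local Notation int f := (mu.-integrable [set: T] (EFin \o f)).

Lemma ae_imply2 (P Q S : T -> Prop) : {ae mu, forall x, P x} ->
  {ae mu, forall x, Q x} -> (forall x, P x -> Q x -> S x) ->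
  {ae mu, forall x, S x}.
Proof. by move=> aP aQ PQS; near=> x; apply: PQS; near: x. Unshelve. all: by end_near. Qed.

Lemma integrable_measurable f : int f -> measurable_fun setT f.
Proof. by move=> /measurable_int/measurable_EFinP. Qed.

Lemma integrable_normr f : int f -> int (fun x => `|f x|).
Proof.
move=> fi; have mf := integrable_measurable fi; apply/integrableP; split.
  by apply/measurable_EFinP; exact: measurableT_comp.
have /integrableP[_] := fi; apply: le_lt_trans.
by under eq_integral do rewrite /= normr_id.
Qed.

Lemma integrable_cst0 : int (fun=> 0).
Proof. by rewrite (_ : EFin \o _ = cst 0%E)//; exact: integrable0. Qed.

Lemma integrable_ae_le f g : measurable_fun setT f -> int g ->
  {ae mu, forall x, `|f x| <= g x} -> int f.
Proof.
move=> mf ig ae; apply/integrableP; split; first exact/measurable_EFinP.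
have /integrableP[mg] := ig; apply: le_lt_trans.
apply: ae_ge0_le_integral => //; try exact: measurableT_comp.
- by apply: measurableT_comp => //; exact/measurable_EFinP.
- apply: filterS ae => x fg _ /=; rewrite lee_fin (le_trans fg)//.
  exact: ler_norm.
Qed.

Lemma integrable_le f g : measurable_fun setT f -> int g ->
  (forall x, `|f x| <= g x) -> int f.
Proof. by move=> mf ig fg; apply: (integrable_ae_le mf ig); exact: aeW. Qed.

Lemma RintegralE f : int f -> (\int[mu]_x f x)%:E = (\int[mu]_x (f x)%:E)%E.
Proof. by move=> fi; rewrite /Rintegral fineK//; exact: integrable_fin_num. Qed.

Lemma Rintegral_ae_ge0 f : int f -> {ae mu, forall x, 0 <= f x} ->
  0 <= \int[mu]_x f x.
Proof.
move=> fi f0; rewrite -lee_fin RintegralE//.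
rewrite (@ae_eq_integral _ _ _ mu setT (fun x => `|f x|%:E))//.
- exact: integral_ge0.
- exact: measurable_int fi.
- apply/measurable_EFinP/measurableT_comp => //; exact: integrable_measurable.
- by apply: filterS f0 => x x0 _ /=; rewrite ger0_norm.
Qed.

Lemma le_Rintegral_ae f g : int f -> int g -> {ae mu, forall x, f x <= g x} ->
  \int[mu]_x f x <= \int[mu]_x g x.
Proof.
move=> fi gi fg; rewrite -subr_ge0 -RintegralB//; apply: Rintegral_ae_ge0.
  by rewrite (_ : EFin \o _ = (EFin \o g) \- (EFin \o f))%E//; exact: integrableB.
by apply: filterS fg => x; rewrite subr_ge0.
Qed.

Lemma integrable_lin a b f g : int f -> int g -> int (fun x => a * f x + b * g x).
Proof.
move=> fi gi.
rewrite (_ : EFin \o _ = (fun x => a%:E * (EFin \o f) x + b%:E * (EFin \o g) x)%E)//.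
by apply: integrableD => //; exact: integrableZl.
Qed.

Lemma Rintegral_lin a b f g : int f -> int g ->
  \int[mu]_x (a * f x + b * g x) = a * \int[mu]_x f x + b * \int[mu]_x g x.
Proof.
move=> fi gi; rewrite RintegralD//; last 2 first.
- by rewrite (_ : EFin \o _ = (fun x => a%:E * (EFin \o f) x)%E)//; exact: integrableZl.
- by rewrite (_ : EFin \o _ = (fun x => b%:E * (EFin \o g) x)%E)//; exact: integrableZl.
by rewrite !RintegralZl.
Qed.

Definition square_integrable f :=
  measurable_fun [set: T] f /\ int (fun x => f x ^+ 2).

Definition norm2 f := Num.sqrt (\int[mu]_x (f x ^+ 2)).

Lemma square_integrableP f : measurable_fun [set: T] f ->
  (\int[mu]_x (f x ^+ 2)%:E < +oo)%E -> square_integrable f.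
Proof.
move=> mf foo; split => //; apply/integrableP; split.
  by apply/measurable_EFinP; exact: measurable_funX.
by under eq_integral do rewrite gee0_abs ?lee_fin ?sqr_ge0//.
Qed.

Lemma norm2_ge0 f : 0 <= norm2 f. Proof. exact: sqrtr_ge0. Qed.

Lemma sqr_norm2 f : norm2 f ^+ 2 = \int[mu]_x (f x ^+ 2).
Proof. by rewrite sqr_sqrtr// Rintegral_ge0// => x _; exact: sqr_ge0. Qed.

Lemma integral_sqr f : square_integrable f ->
  (\int[mu]_x (f x ^+ 2)%:E = (norm2 f ^+ 2)%:E)%E.
Proof. by case=> _ fi; rewrite sqr_norm2 RintegralE. Qed.

Lemma integrableM2 f g : square_integrable f -> square_integrable g ->
  int (fun x => f x * g x).
Proof.
move=> [mf fi] [mg gi].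
apply: (@integrable_le _ (fun x => 1 * f x ^+ 2 + 1 * g x ^+ 2)).
- exact: measurable_funM.
- exact: integrable_lin.
move=> x; rewrite !mul1r normrM -[f x ^+ 2]real_normK ?num_real// -[g x ^+ 2]real_normK ?num_real//.
have := sqr_ge0 (`|f x| - `|g x|); have := normr_ge0 (f x); have := normr_ge0 (g x).
by move: `|f x| `|g x| => u v; nra.
Qed.

Lemma square_integrable_lin a b f g : square_integrable f -> square_integrable g ->
  square_integrable (fun x => a * f x + b * g x).
Proof.
move=> L2f L2g; have fgi := integrableM2 L2f L2g.
move: L2f L2g => [mf fi] [mg gi]; split.
  by apply: measurable_funD; exact: measurable_funM.
apply: (@integrable_le _ (fun x => 2 * a ^+ 2 * f x ^+ 2 + 2 * b ^+ 2 * g x ^+ 2)).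
- by apply: measurable_funX; apply: measurable_funD; exact: measurable_funM.
- exact: integrable_lin.
move=> x; rewrite ger0_norm ?sqr_ge0//.
have := sqr_ge0 (a * f x - b * g x); nra.
Qed.

Lemma square_integrableD f g : square_integrable f -> square_integrable g ->
  square_integrable (fun x => f x + g x).
Proof.
move=> Lf Lg; have := square_integrable_lin 1 1 Lf Lg.
by rewrite (_ : (fun _ => _) = (fun x => f x + g x))//; apply/funext => x; rewrite !mul1r.
Qed.

Lemma square_integrableB f g : square_integrable f -> square_integrable g ->
  square_integrable (fun x => f x - g x).
Proof.
move=> Lf Lg; have := square_integrable_lin 1 (-1) Lf Lg.
by rewrite (_ : (fun _ => _) = (fun x => f x - g x))//; apply/funext => x; rewrite mul1r mulN1r.
Qed.

Lemma square_integrable_norm f : square_integrable f ->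
  square_integrable (fun x => `|f x|) /\ norm2 (fun x => `|f x|) = norm2 f.
Proof.
have E : (fun x => `|f x| ^+ 2) = (fun x => f x ^+ 2).
  by apply/funext => x; rewrite real_normK ?num_real.
move=> [mf fi]; split; last by rewrite /norm2 E.
by split; [exact: measurableT_comp|rewrite E].
Qed.

Lemma norm2_lin_sqr a b f g : square_integrable f -> square_integrable g ->
  norm2 (fun x => a * f x + b * g x) ^+ 2 =
  a ^+ 2 * norm2 f ^+ 2 + 2 * a * b * \int[mu]_x (f x * g x) + b ^+ 2 * norm2 g ^+ 2.
Proof.
move=> Lf Lg; have fg := integrableM2 Lf Lg; have [_ fi] := Lf; have [_ gi] := Lg.
rewrite !sqr_norm2.
transitivity (\int[mu]_x (1 * (a ^+ 2 * f x ^+ 2 + (2 * a * b) * (f x * g x)) + b ^+ 2 * g x ^+ 2)).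
  by congr (Rintegral _ _ _); apply/funext => x; ring.
rewrite Rintegral_lin//; last exact: integrable_lin.
by rewrite Rintegral_lin// mul1r.
Qed.

(** Nonnegativity of the quadratic form [H]; the coefficients [v] and [- u] give the inequality
    after division by [u * v]. *)
Lemma cauchy_schwarz_Rintegral f g : square_integrable f -> square_integrable g ->
  \int[mu]_x (f x * g x) <= norm2 f * norm2 g.
Proof.
move=> Lf Lg; set p := \int[mu]_x _.
have H a b : 0 <= a ^+ 2 * norm2 f ^+ 2 + 2 * a * b * p + b ^+ 2 * norm2 g ^+ 2.
  by rewrite -norm2_lin_sqr// sqr_ge0.
have := norm2_ge0 f; have := norm2_ge0 g; move: (norm2 f) (norm2 g) H => u v H v0 u0.
have [p0|p0] := leP p 0; first by apply: le_trans p0 _; exact: mulr_ge0.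
have pK w : w / (2 * p) * p = w / 2 by field; rewrite gt_eqF.
(* If a norm vanished, the form would lose one square, and the large coefficient chosen on that side
   would make its value -1. *)
have uv0 : 0 < u * v.
  rewrite lt_neqAle mulr_ge0// andbT eq_sym mulf_eq0 negb_or; apply/andP; split; apply/negP => /eqP E.
    by have := H (- ((v ^+ 2 + 1) / (2 * p))) 1; rewrite E; have := pK (v ^+ 2 + 1); nra.
  by have := H 1 (- ((u ^+ 2 + 1) / (2 * p))); rewrite E; have := pK (u ^+ 2 + 1); nra.
have := H v (- u); rewrite (_ : _ + _ = 2 * (u * v) * (u * v - p)); last by ring.
by rewrite pmulr_rge0 ?subr_ge0// mulr_gt0.
Qed.

Lemma cauchy_schwarz_abs f g : square_integrable f -> square_integrable g ->
  \int[mu]_x `|f x * g x| <= norm2 f * norm2 g.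
Proof.
move=> /square_integrable_norm[Lf <-] /square_integrable_norm[Lg <-].
by under eq_Rintegral do rewrite normrM; exact: cauchy_schwarz_Rintegral.
Qed.

Lemma norm2D f g : square_integrable f -> square_integrable g ->
  norm2 (fun x => f x + g x) <= norm2 f + norm2 g.
Proof.
move=> Lf Lg; rewrite -(@ler_pXn2r _ 2)// ?nnegrE ?addr_ge0 ?norm2_ge0//.
have := norm2_lin_sqr 1 1 Lf Lg; have := cauchy_schwarz_Rintegral Lf Lg.
rewrite (_ : (fun x => 1 * f x + 1 * g x) = (fun x => f x + g x)); last first.
  by apply/funext => x; rewrite !mul1r.
by move=> cs ->; nra.
Qed.

Lemma norm2N f : norm2 (fun x => - f x) = norm2 f.
Proof. by rewrite /norm2; under eq_Rintegral do rewrite sqrrN. Qed.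

End SquareIntegrable.

(** * Tonelli's theorem for sigma-finite measures *)

Section Tonelli.
Context d1 d2 (T1 : measurableType d1) (T2 : measurableType d2) (R : realType).
Local Open Scope ereal_scope.

Lemma measurable_integral2 (m2 : {measure set T2 -> \bar R}) (f : T1 * T2 -> \bar R) :
  sigma_finite setT m2 -> measurable_fun setT f -> (forall x, 0 <= f x) ->
  measurable_fun setT (fun x => \int[m2]_y f (x, y)).
Proof.
move=> s2 mf f0.
pose H2 := isSFinite.Build _ _ _ _ (sfinite_measure_sigma_finite s2).
pose H2' := isSigmaFinite.Build _ _ _ _ s2.
pose m2' := HB.pack_for (SigmaFiniteMeasure.type T2 R) (Measure.sort m2) H2 H2'.
exact: (@measurable_fun_fubini_tonelli_F _ _ _ _ _ m2' f).
Qed.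

Lemma tonelli (m1 : {measure set T1 -> \bar R}) (m2 : {measure set T2 -> \bar R})
    (f : T1 * T2 -> \bar R) :
  sigma_finite setT m1 -> sigma_finite setT m2 ->
  measurable_fun setT f -> (forall x, 0 <= f x) ->
  \int[m1]_x \int[m2]_y f (x, y) = \int[m2]_y \int[m1]_x f (x, y).
Proof.
move=> s1 s2 mf f0.
pose H1 := isSFinite.Build _ _ _ _ (sfinite_measure_sigma_finite s1).
pose H1' := isSigmaFinite.Build _ _ _ _ s1.
pose m1' := HB.pack_for (SigmaFiniteMeasure.type T1 R) (Measure.sort m1) H1 H1'.
pose H2 := isSFinite.Build _ _ _ _ (sfinite_measure_sigma_finite s2).
pose H2' := isSigmaFinite.Build _ _ _ _ s2.
pose m2' := HB.pack_for (SigmaFiniteMeasure.type T2 R) (Measure.sort m2) H2 H2'.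
exact: (@fubini_tonelli _ _ _ _ _ m1' m2' f).
Qed.

End Tonelli.

(** * Weighted shifts *)

(** Both signs follow from [e^t - 1 - t <= t (e^t - 1)]: for [t >= 0] bound [e^t - 1] by [t e^t],
    for [t < 0] use [e^t - 1 >= t]. The absolute value in the exponent makes the remainder monotone
    in [|t|]. *)
Lemma expR_le_quadratic (R : realType) (t : R) :
  expR t <= 1 + t + t ^+ 2 * expR `|t|.
Proof.
have e0 := expR_gt0 t.
have h1 : expR t - 1 <= t * expR t.
  have := expR_ge1Dx (- t); rewrite expRN -(ler_pM2r e0) mulVf ?gt_eqF//; nra.
have h2 := expR_ge1Dx t.
have [t0|t0] := leP 0 t.
  by rewrite ger0_norm//; nra.
have : 1 <= expR `|t| by rewrite -expR0 ler_expR.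
move: (expR `|t|) => z z1; nra.
Qed.

Section Increments.
Variables (R : realType) (G : topGroupType).
Hypothesis sc : @second_countable G.
Variable mu : {measure set (borel G) -> \bar R}.
Hypothesis hmu : left_haar_measure mu.
Variable U : set G.
Hypothesis hG : connected [set: G].
Hypothesis hU : admissible_nbhd U.
Local Notation rho := (rho R U).
Local Notation int f := (mu.-integrable [set: borel G] (EFin \o (f : borel G -> R))).
Local Notation meas f := (measurable_fun [set: borel G] (f : borel G -> R)).

Lemma measurable_translateR (a : G) (f : G -> R) : meas f -> meas (fun x => f (a * x)%g).
Proof. by move=> mf; exact: (measurableT_comp mf (measurable_mulgl a)). Qed.

Lemma integral_translate_signed (a : G) (f : borel G -> \bar R) :
  measurable_fun setT f ->
  (\int[mu]_x f (a * x)%g = \int[mu]_x f x)%E.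
Proof.
move=> mf; rewrite [LHS]integralE [RHS]integralE; congr (_ - _)%E.
  have := integral_translate hmu a (measurable_funepos mf) (funepos_ge0 f) => <-.
  by apply: eq_integral => x _; rewrite !funeposE.
have := integral_translate hmu a (measurable_funeneg mf) (funeneg_ge0 f) => <-.
  by apply: eq_integral => x _; rewrite !funenegE.
Qed.

Lemma integrable_translate (a : G) (f : G -> R) : int f -> int (fun x => f (a * x)%g).
Proof.
move=> fi; have mf := integrable_measurable fi.
apply/integrableP; split.
  by apply/measurable_EFinP; exact: (measurable_translateR a mf).
have /integrableP[_] := fi.
have mg : measurable_fun [set: borel G] (fun x : borel G => `|(f x)%:E|%E).
  by apply: measurableT_comp => //; exact/measurable_EFinP.
by rewrite -(integral_translate hmu a mg (fun x => abse_ge0 _)).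
Qed.

Lemma Rintegral_translate (a : G) (f : G -> R) : meas f ->
  \int[mu]_x f (a * x)%g = \int[mu]_x f x.
Proof.
move=> mf; rewrite /Rintegral; congr fine.
apply: (@integral_translate_signed a (EFin \o f)).
exact/measurable_EFinP.
Qed.

Lemma square_integrable_translate (a : G) (f : G -> R) :
  square_integrable mu (f : borel G -> R) ->
  square_integrable mu (fun x : borel G => f (a * x)%g).
Proof.
move=> [mf fi]; split; first exact: (measurable_translateR a mf).
exact: (@integrable_translate a (fun x => f x ^+ 2) fi).
Qed.

Lemma norm2_translate (a : G) (f : G -> R) : meas f ->
  norm2 mu (fun x : borel G => f (a * x)%g) = norm2 mu (f : borel G -> R).
Proof.
move=> mf; rewrite /norm2 (@Rintegral_translate a (fun x => f x ^+ 2))//.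
exact: measurable_funX.
Qed.

Section Shift.
Variable phi : G -> R.
Hypothesis phi2 : square_integrable mu (phi : borel G -> R).
Local Notation N := (norm2 mu (phi : borel G -> R)).

Definition shift_dist (h : G) : R := norm2 mu (fun x : borel G => phi (h^-1 * x)%g - phi x).

Lemma shift_diff2 h k :
  square_integrable mu (fun x : borel G => phi (h * x)%g - phi (k * x)%g).
Proof. by apply: square_integrableB; exact: square_integrable_translate. Qed.

Lemma shift_diff2' h :
  square_integrable mu (fun x : borel G => phi (h * x)%g - phi x).
Proof. by apply: square_integrableB => //; exact: square_integrable_translate. Qed.

Lemma norm2_shift_diff h k :
  norm2 mu (fun x : borel G => phi (h^-1 * x)%g - phi (k^-1 * x)%g) = shift_dist (h^-1 * k)%g.
Proof.
rewrite -(norm2_translate h (proj1 (shift_diff2 h^-1%g k^-1%g))).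
rewrite /shift_dist -[RHS]norm2N; congr (norm2 _ _); apply/funext => x.
by rewrite mulKg invgM invgK -mulgA opprB.
Qed.

Lemma shift_dist_ge0 h : 0 <= shift_dist h. Proof. exact: norm2_ge0. Qed.

Lemma shift_distV h : shift_dist h^-1%g = shift_dist h.
Proof.
have := norm2_shift_diff h 1%g; rewrite mulg1 => <-; rewrite invg1.
by rewrite /shift_dist; congr (norm2 _ _); apply/funext => x; rewrite mul1g.
Qed.

(** Left translation is an isometry of L2. Thus [shift_dist] behaves like a length, symmetric and
    subadditive, and bounds on a neighbourhood propagate along words. *)
Lemma shift_distM h k : shift_dist (h * k)%g <= shift_dist h + shift_dist k.
Proof.
rewrite {1}/shift_dist.
rewrite (_ : (fun _ => _) = (fun x : borel G => (phi (k^-1 * (h^-1 * x))%g - phi (h^-1 * x)%g) + (phi (h^-1 * x)%g - phi x))); last first.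
  by apply/funext => x; rewrite subrKA invgM mulgA.
have L1 := shift_diff2' k^-1%g.
apply: (le_trans (norm2D (square_integrable_translate h^-1%g L1) (shift_diff2' _))).
by rewrite addrC lerD2l (norm2_translate h^-1%g (proj1 L1)).
Qed.

Lemma shift_dist_le2 h : shift_dist h <= 2 * N.
Proof.
rewrite /shift_dist.
have L2 : square_integrable mu (fun x : borel G => - phi x).
  have [mf fi] := phi2; split; first exact: measurable_funN.
  by under eq_fun do rewrite /= sqrrN.
apply: (le_trans (norm2D (square_integrable_translate h^-1%g phi2) L2)).
by rewrite norm2_translate ?norm2N; [lra|case: phi2].
Qed.

Lemma shift_dist_rho (s : R) : (forall u, U u -> shift_dist u <= s) ->
  forall h, shift_dist h <= rho h * s.
Proof.
move=> Us; apply: (rho_ind hG hU (P := fun h x => shift_dist h <= x * s)).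
  by move=> u Uu; rewrite mul1r Us.
move=> u g x Uu gx IH; rewrite mulrDl mul1r addrC.
by apply: (le_trans (shift_distM _ _)); rewrite lerD// Us.
Qed.

Variable psi : G -> R.
Hypothesis mpsi : meas psi.
Hypothesis psi_lip : forall u, U u ->
  {ae mu, forall x : borel G, `|psi (u^-1 * x)%g - psi x| <= 1}.

(** The null set depends on [g]: a word for [g] meets only finitely many null sets, each moved by a
    left translation, which preserves null sets. *)
Lemma weight_lip g : {ae mu, forall x : borel G, `|psi (g * x)%g - psi x| <= rho g}.
Proof.
rewrite -[g]invgK rhoV//; move: g^-1%g => {}g.
apply: (rho_ind hG hU (P := fun g r => {ae mu, forall x : borel G, `|psi (g^-1 * x)%g - psi x| <= r})) => //.
move=> u {}g x Uu gx IH.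
apply: (ae_imply2 (ae_translate hmu u^-1%g IH) (psi_lip Uu)) => y a b.
rewrite invgM -mulgA (_ : _ - _ = (psi (g^-1 * (u^-1 * y))%g - psi (u^-1 * y)%g) + (psi (u^-1 * y)%g - psi y)); last by rewrite subrKA.
by rewrite (le_trans (ler_normD _ _))// lerD.
Qed.

Lemma weight_lip2 g h : {ae mu, forall x : borel G,
  `|psi (g * x)%g - psi (h * x)%g| <= rho g + rho h}.
Proof.
apply: (ae_imply2 (weight_lip g) (weight_lip h)) => x a b.
rewrite (_ : _ - _ = (psi (g * x)%g - psi x) - (psi (h * x)%g - psi x)); last by lra.
by rewrite (le_trans (ler_normB _ _))// lerD.
Qed.

Lemma integrable_weight g h (f : G -> R) : int f -> (forall x, 0 <= f x) ->
  int (fun x => (psi (g * x)%g - psi (h * x)%g) * f x).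
Proof.
move=> fi f0; have mf := integrable_measurable fi.
apply: (@integrable_ae_le _ _ _ _ _ (fun x : borel G => (rho g + rho h) * f x + 0 * f x)).
- by apply: measurable_funM => //; apply: measurable_funB; exact: measurable_translateR.
- exact: integrable_lin.
apply: filterS (weight_lip2 g h) => x le.
by rewrite mul0r addr0 normrM (ger0_norm (f0 x)) ler_wpM2r.
Qed.

Definition weight_drift (k : G) : R := \int[mu]_x ((psi (k * x)%g - psi x) * phi x ^+ 2).
Local Notation F := weight_drift.

Lemma phi_sq_int : int (fun x => phi x ^+ 2). Proof. by case: phi2. Qed.

Lemma integrable_drift k : int (fun x => (psi (k * x)%g - psi x) * phi x ^+ 2).
Proof.
have := integrable_weight k 1%g phi_sq_int (fun x => sqr_ge0 _).
by under [X in _.-integrable _ X -> _]eq_fun do rewrite /= mul1g.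
Qed.

Lemma weight_drift_bound k : `|F k| <= N ^+ 2 * rho k.
Proof.
apply: (le_trans (le_normr_Rintegral _ (integrable_drift k))) => //.
apply: (@le_trans _ _ (\int[mu]_x (rho k * phi x ^+ 2 + 0 * phi x ^+ 2))).
  apply: le_Rintegral_ae.
  - exact: (integrable_normr (integrable_drift k)).
  - by apply: integrable_lin; exact: phi_sq_int.
  - apply: filterS (weight_lip k) => x le.
    by rewrite mul0r addr0 normrM (ger0_norm (sqr_ge0 _)) ler_wpM2r// sqr_ge0.
rewrite Rintegral_lin; try exact: phi_sq_int.
by rewrite mul0r addr0 sqr_norm2 mulrC.
Qed.

(** A change of variables turns [F (k h) - F h] into [F k] with [phi] translated by [h]. What
    remains is an integral against a difference of two squares; factor it and apply Cauchy-Schwarz,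
    the difference giving [shift_dist h] and the sum at most [2 ||phi||]. *)
Lemma weight_drift_quasi k h : `|F (k * h)%g - F k - F h| <= 2 * N * rho k * shift_dist h.
Proof.
have [mphi _] := phi2.
pose q (x : G) := (psi (k * x)%g - psi x) * phi (h^-1 * x)%g ^+ 2.
have L := square_integrable_translate h^-1%g phi2.
have qi : int q.
  have := integrable_weight k 1%g (proj2 L) (fun x => sqr_ge0 _).
  by under [X in _.-integrable _ X -> _]eq_fun do rewrite /= mul1g.
have qE : \int[mu]_x q x = F (k * h)%g - F h.
  rewrite -(Rintegral_translate h); last exact: integrable_measurable qi.
  transitivity (\int[mu]_x (1 * ((psi (k * h * x)%g - psi x) * phi x ^+ 2) + (-1) * ((psi (h * x)%g - psi x) * phi x ^+ 2))).
    by congr (Rintegral _ _ _); apply/funext => x; rewrite /q mulKg mulgA; ring.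
  by rewrite Rintegral_lin; [rewrite /weight_drift; lra|exact: integrable_drift..].
have -> : F (k * h)%g - F k - F h = \int[mu]_x (1 * q x + (-1) * ((psi (k * x)%g - psi x) * phi x ^+ 2)).
  by rewrite Rintegral_lin ?qE//; [rewrite -/(F k); lra|exact: integrable_drift].
have ii : int (fun x : borel G => 1 * q x + (-1) * ((psi (k * x)%g - psi x) * phi x ^+ 2)).
  by apply: integrable_lin => //; exact: integrable_drift.
apply: (le_trans (le_normr_Rintegral _ ii)) => //.
have L1 := shift_diff2' h^-1%g; have L2 := square_integrableD L phi2.
have M12 := integrableM2 L1 L2.
have M12' := integrable_normr M12.
apply: (@le_trans _ _ (\int[mu]_x (rho k * `|(phi (h^-1 * x)%g - phi x) * (phi (h^-1 * x)%g + phi x)| + 0 * 0))).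
  apply: le_Rintegral_ae.
  - exact: (integrable_normr ii).
  - by apply: integrable_lin => //; exact: integrable_cst0.
  apply: filterS (weight_lip k) => x le.
  rewrite mul0r addr0 (_ : 1 * q x + _ = (psi (k * x)%g - psi x) * ((phi (h^-1 * x)%g - phi x) * (phi (h^-1 * x)%g + phi x))); last by rewrite /q; ring.
  by rewrite normrM ler_wpM2r.
rewrite Rintegral_lin//; last by exact: integrable_cst0.
rewrite mul0r addr0 [2 * N * _]mulrC -mulrA ler_wpM2l ?rho_ge0//.
apply: (le_trans (cauchy_schwarz_abs L1 L2)); rewrite mulrC ler_wpM2r ?norm2_ge0//.
apply: (le_trans (norm2D L phi2)); rewrite norm2_translate//; lra.
Qed.

(** This is [e^(lambda psi) L(h) (e^(- lambda psi) phi)]: its average over [h] with density [K] is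
    the conjugated convolution of [phi]. *)
Definition weighted_shift (lambda : R) (h x : G) : R :=
  expR (lambda * (psi x - psi (h^-1 * x)%g)) * phi (h^-1 * x)%g.

Lemma ae_weight_inv h : {ae mu, forall x : borel G, `|psi x - psi (h^-1 * x)%g| <= rho h}.
Proof.
by apply: filterS (weight_lip h^-1%g) => x; rewrite rhoV// distrC.
Qed.

Lemma measurable_weighted_shift lambda h : meas (weighted_shift lambda h).
Proof.
apply: measurable_funM; last by apply: measurable_translateR; case: phi2.
apply: measurableT_comp => //; apply: measurable_funM => //.
by apply: measurable_funB => //; exact: measurable_translateR.
Qed.

Lemma weighted_shiftM lambda h k x : weighted_shift lambda h x * weighted_shift lambda k x =
  expR (lambda * ((psi x - psi (h^-1 * x)%g) + (psi x - psi (k^-1 * x)%g))) *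
  (phi (h^-1 * x)%g * phi (k^-1 * x)%g).
Proof. by rewrite mulrDr expRD /weighted_shift; ring. Qed.

Lemma ae_weight_exp lambda h k : {ae mu, forall x : borel G,
  `|lambda * ((psi x - psi (h^-1 * x)%g) + (psi x - psi (k^-1 * x)%g))| <= `|lambda| * (rho h + rho k)}.
Proof.
apply: (ae_imply2 (ae_weight_inv h) (ae_weight_inv k)) => x a b.
by rewrite normrM ler_wpM2l// (le_trans (ler_normD _ _))// lerD.
Qed.

Lemma ae_weighted_shiftM lambda h k : {ae mu, forall x : borel G,
  `|weighted_shift lambda h x * weighted_shift lambda k x| <=
  expR (`|lambda| * (rho h + rho k)) * `|phi (h^-1 * x)%g * phi (k^-1 * x)%g|}.
Proof.
apply: filterS (ae_weight_exp lambda h k) => x le.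
rewrite weighted_shiftM normrM ger0_norm ?expR_ge0// ler_wpM2r// ler_expR.
by apply: le_trans le; exact: ler_norm.
Qed.

Lemma integrable_shiftM h k : int (fun x => phi (h^-1 * x)%g * phi (k^-1 * x)%g).
Proof. by apply: integrableM2; exact: square_integrable_translate. Qed.

Lemma integrable_weighted_shiftM lambda h k :
  int (fun x => weighted_shift lambda h x * weighted_shift lambda k x).
Proof.
apply: (@integrable_ae_le _ _ _ _ _ (fun x : borel G => expR (`|lambda| * (rho h + rho k)) * `|phi (h^-1 * x)%g * phi (k^-1 * x)%g| + 0 * 0)).
- by apply: measurable_funM; exact: measurable_weighted_shift.
- apply: integrable_lin; last exact: integrable_cst0.
  exact: (integrable_normr (integrable_shiftM h k)).
- by apply: filterS (ae_weighted_shiftM lambda h k) => x; rewrite mul0r addr0.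
Qed.

(** No cancellation is exploited: both shifts have norm [||phi||], and the weights are at most
    [e^(|lambda| rho)] almost everywhere. This serves large [lambda]. *)
Lemma weighted_shiftM_large lambda h k :
  \int[mu]_x (weighted_shift lambda h x * weighted_shift lambda k x) <=
  expR (`|lambda| * (rho h + rho k)) * N ^+ 2.
Proof.
have ia := integrable_normr (integrable_shiftM h k).
apply: (@le_trans _ _ (\int[mu]_x (expR (`|lambda| * (rho h + rho k)) * `|phi (h^-1 * x)%g * phi (k^-1 * x)%g| + 0 * 0))).
  apply: le_Rintegral_ae; first exact: integrable_weighted_shiftM.
    by apply: integrable_lin => //; exact: integrable_cst0.
  apply: filterS (ae_weighted_shiftM lambda h k) => x; rewrite mul0r addr0.
  by apply: le_trans; exact: ler_norm.
rewrite Rintegral_lin//; last exact: integrable_cst0.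
rewrite mul0r addr0 ler_wpM2l ?expR_ge0//.
have [mphi _] := phi2.
apply: (le_trans (cauchy_schwarz_abs (square_integrable_translate h^-1%g phi2) (square_integrable_translate k^-1%g phi2))).
by rewrite !norm2_translate// -expr2.
Qed.

Lemma drift_shift h k :
  int (fun x => (psi x - psi (k^-1 * x)%g) * phi (h^-1 * x)%g ^+ 2) /\
  \int[mu]_x ((psi x - psi (k^-1 * x)%g) * phi (h^-1 * x)%g ^+ 2) =
  F h - F (k^-1 * h)%g.
Proof.
have L := square_integrable_translate h^-1%g phi2.
have qi : int (fun x => (psi x - psi (k^-1 * x)%g) * phi (h^-1 * x)%g ^+ 2).
  have := integrable_weight 1%g k^-1%g (proj2 L) (fun x => sqr_ge0 _).
  by under [X in _.-integrable _ X -> _]eq_fun do rewrite /= mul1g.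
split=> //; rewrite -(Rintegral_translate h); last exact: integrable_measurable qi.
transitivity (\int[mu]_x (1 * ((psi (h * x)%g - psi x) * phi x ^+ 2) + (-1) * ((psi (k^-1 * h * x)%g - psi x) * phi x ^+ 2))).
  by congr (Rintegral _ _ _); apply/funext => x; rewrite mulKg mulgA; ring.
by rewrite Rintegral_lin; [rewrite /weight_drift; lra|exact: integrable_drift..].
Qed.

(** The product of two shifts is half the sum of their squares minus half the square of their
    difference. The exponential is bounded above by its second-order expansion on the first part,
    whose linear term integrates to drifts, and below by [e^(- a)] on the second, which is the
    loss. *)
Lemma weighted_shiftM_small lambda h k (a := rho h + rho k) : `|lambda| <= 1 ->
  \int[mu]_x (weighted_shift lambda h x * weighted_shift lambda k x)
    + 2^-1 * expR (- a) * shift_dist (h^-1 * k)%g ^+ 2 <=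
  N ^+ 2 * (1 + lambda ^+ 2 * a ^+ 2 * expR a)
    + 2^-1 * lambda * (2 * F h - F (k^-1 * h)%g + (2 * F k - F (h^-1 * k)%g)).
Proof.
move=> l1; have [mphi _] := phi2.
have a0 : 0 <= a by rewrite addr_ge0// rho_ge0.
pose X (x : G) := phi (h^-1 * x)%g; pose X' (x : G) := phi (k^-1 * x)%g.
pose Y (x : G) := psi x - psi (h^-1 * x)%g; pose Y' (x : G) := psi x - psi (k^-1 * x)%g.
have [_ iX] : square_integrable mu X by exact: square_integrable_translate.
have [_ iX'] : square_integrable mu X' by exact: square_integrable_translate.
have nX : \int[mu]_x X x ^+ 2 = N ^+ 2 by rewrite -sqr_norm2 norm2_translate.
have nX' : \int[mu]_x X' x ^+ 2 = N ^+ 2 by rewrite -sqr_norm2 norm2_translate.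
have [iYX eYX] := drift_shift h h; have [iY'X eY'X] := drift_shift h k.
have [iYX' eYX'] := drift_shift k h; have [iY'X' eY'X'] := drift_shift k k.
(* As [F 1 = 0], the four integrals of the linear term are [F h], [F h - F (k^-1 h)],
   [F k - F (h^-1 k)] and [F k], whence the combination in the statement. *)
have F1 : F 1%g = 0.
  rewrite /weight_drift; under eq_Rintegral do rewrite mul1g subrr mul0r.
  by rewrite /Rintegral integral0.
rewrite !mulVg F1 !subr0 in eYX eY'X eYX' eY'X'.
have [mD iD] := shift_diff2 h^-1%g k^-1%g.
have iw := integrable_weighted_shiftM lambda h k.
rewrite -norm2_shift_diff// [X in _ + X <= _](congr1 _ (sqr_norm2 _ _)).
set c := expR (- a); set M := lambda ^+ 2 * a ^+ 2 * expR a.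
have M0 : 0 <= M by apply: mulr_ge0; rewrite ?expR_ge0// mulr_ge0// sqr_ge0.
have i1 := integrable_lin 1 1 iX iX'.
have i2 := integrable_lin 1 1 iYX iY'X.
have i3 := integrable_lin 1 1 iYX' iY'X'.
have i4 := integrable_lin 1 1 i2 i3.
apply: (@le_trans _ _ (\int[mu]_x (1 * (weighted_shift lambda h x * weighted_shift lambda k x) +
    2^-1 * c * (phi (h^-1 * x)%g - phi (k^-1 * x)%g) ^+ 2))).
  by rewrite Rintegral_lin// mul1r.
apply: (@le_trans _ _ (\int[mu]_x (2^-1 * (1 + M) * (1 * X x ^+ 2 + 1 * X' x ^+ 2) +
   2^-1 * lambda * (1 * (1 * (Y x * X x ^+ 2) + 1 * (Y' x * X x ^+ 2))
                   + 1 * (1 * (Y x * X' x ^+ 2) + 1 * (Y' x * X' x ^+ 2)))))); last first.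
  by rewrite !Rintegral_lin// nX nX' eYX eY'X eYX' eY'X' le_eqVlt; apply/orP; left; apply/eqP; field.
apply: le_Rintegral_ae.
- by apply: integrable_lin.
- by apply: integrable_lin.
apply: filterS (ae_weight_exp lambda h k) => x.
rewrite weighted_shiftM -/(X x) -/(X' x) -/(Y x) -/(Y' x) -/a; set t := lambda * (Y x + Y' x) => tle.
have ta : `|t| <= a by apply: le_trans tle _; rewrite ler_piMl.
have la : `|lambda * a| = `|lambda| * a by rewrite normrM (ger0_norm a0).
have tM : expR t <= 1 + t + M.
  apply: (le_trans (expR_le_quadratic t)); rewrite lerD2l /M ler_pM ?sqr_ge0 ?expR_ge0//; last by rewrite ler_expR.
  by rewrite -exprMn -[t ^+ 2]real_normK ?num_real// -(real_normK (num_real (lambda * a))) la ler_pXn2r// nnegrE mulr_ge0.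
have tc : c <= expR t by rewrite ler_expR; have := ler_norm (- t); rewrite normrN; lra.
have XX := sqr_ge0 (X x - X' x); have XY : 0 <= X x ^+ 2 + X' x ^+ 2 by rewrite addr_ge0 ?sqr_ge0.
have E1 := ler_wpM2r XY tM; have E2 := ler_wpM2r XX tc.
rewrite (_ : 2^-1 * (1 + M) * _ + _ = 2^-1 * ((1 + t + M) * (X x ^+ 2 + X' x ^+ 2))); last by rewrite /t; ring.
rewrite (_ : _ + _ = 2^-1 * (expR t * (X x ^+ 2 + X' x ^+ 2) - expR t * (X x - X' x) ^+ 2 + c * (X x - X' x) ^+ 2)); last by field.
by lra.
Qed.

End Shift.
End Increments.

(** * Control of small shifts by the energy *)

Section NbhdSquareRoot.
Variable G : topGroupType.

Lemma open_sqrt (V : set G) : open V -> V 1%g -> exists V' : set G,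
  [/\ open V', V' 1%g, forall x, V' x -> V' x^-1%g & forall x y, V' x -> V' y -> V (x * y)%g].
Proof.
move=> oV V1.
have nV : nbhs (1 * 1 : G)%g V by rewrite mulg1; exact: open_nbhs_nbhs.
have [[P Q] /= [nP nQ] PQV] := @mulg_continuous G (1%g, 1%g) V nV.
pose V0 := (P `&` Q)°.
have oV0 : open V0 by exact: open_interior.
have V01 : V0 1%g by exact: filterI.
have V0s : V0 `<=` P `&` Q by exact: interior_subset.
exists (V0 `&` [set x | V0 x^-1%g]); split.
- by apply: openI => //; apply: open_comp => // x _; exact: invg_continuous.
- by split => //=; rewrite invg1.
- by move=> x [a b]; split => //=; rewrite invgK.
- by move=> x y [/V0s[a _] _] [/V0s[_ b] _]; apply: (PQV (x, y)).
Qed.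

End NbhdSquareRoot.

Section Bounds.
Variables (R : realType) (G : topGroupType).
Hypothesis sc : @second_countable G.
Variable mu : {measure set (borel G) -> \bar R}.
Hypothesis hmu : left_haar_measure mu.
Variable U : set G.
Hypothesis hG : connected [set: G].
Hypothesis hU : admissible_nbhd U.
Local Notation rho := (rho R U).
Local Notation int f := (mu.-integrable [set: borel G] (EFin \o (f : borel G -> R))).
Local Notation meas f := (measurable_fun [set: borel G] (f : borel G -> R)).

Lemma additive_map_bound (eta : G -> R) : additive_map eta ->
  exists2 M : R, 0 <= M & forall g, `|eta g| <= M * rho g.
Proof.
move=> [ceta etaM].
have cI : compact (eta @` closure U).
  apply: continuous_compact; first exact: continuous_subspaceT.
  exact: admissible_compact.
have [M [_ HM]] := compact_bounded cI.
exists `|M + 1|; first exact: normr_ge0.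
have q0 : quasi_additive U 0 eta by move=> g h; rewrite etaM !mul0r normr_le0; apply/eqP; lra.
move=> g; have := @quasi_additive_growth R G U hG hU 0 `|M + 1| eta (lexx 0) q0.
rewrite mulrC => H; have := H _ g; rewrite mul0r addr0; apply => u Uu.
have M1 : M < M + 1 by lra.
apply: le_trans (ler_norm _); apply: (HM _ M1); exists u => //; exact: subset_closure.
Qed.

(** Completing the square, [- b x^2 + (t + D) x <= (t + D)^2 / (4 b) <= (t^2 + D^2) / (2 b)], where
    [e^(- D rho)] is integrable. The constant is uniform in [K] and [t]. *)
Lemma exp_moment (c b : R) : 0 < c -> 0 < b -> exists2 C, 1 <= C &
  forall K : G -> R, meas K -> (forall g, 0 <= K g) ->
    (forall g, K g <= c * expR (- b * rho g ^+ 2)) ->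
    forall t, int (fun g => K g * expR (t * rho g)) /\
      \int[mu]_g (K g * expR (t * rho g)) <= C * expR (t ^+ 2 / (2 * b)).
Proof.
move=> c0 b0; have [D D0 eD] := integrable_exp_rho hmu hG hU.
have mrho : meas rho by exact: measurable_rho.
have mexp t : meas (fun g => expR (t * rho g)).
  by apply: measurableT_comp => //; exact: measurable_funM.
have iD : int (fun g => expR (- D * rho g)).
  apply/integrableP; split; first by apply/measurable_EFinP.
  by under eq_integral do rewrite gee0_abs ?lee_fin ?expR_ge0//.
have ID0 : 0 <= \int[mu]_g expR (- D * rho g) by apply: Rintegral_ge0 => g _; exact: expR_ge0.
(* Adding 1 gives [C >= 1], so that its logarithm is nonnegative and can be put into the
   exponent. *)
exists (1 + c * expR (D ^+ 2 / (2 * b)) * \int[mu]_g expR (- D * rho g)).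
  by rewrite lerDl !mulr_ge0 ?expR_ge0// ltW.
move=> K mK K0 Kup t.
have le g : K g * expR (t * rho g) <=
    c * expR (D ^+ 2 / (2 * b)) * expR (t ^+ 2 / (2 * b)) * expR (- D * rho g) + 0 * 0.
  rewrite mul0r addr0 -!mulrA -!expRD.
  apply: (le_trans (ler_wpM2r (expR_ge0 _) (Kup g))).
  rewrite -mulrA -expRD ler_pM2l// ler_expR.
  have := sqr_ge0 (2 * b * rho g - (t + D)); have := sqr_ge0 (t - D).
  move: (rho g) => x h1 h2.
  rewrite -(ler_pM2r (_ : 0 < 4 * b)); last by lra.
  rewrite [X in _ <= X](_ : _ = 2 * D ^+ 2 + 2 * t ^+ 2 - 4 * b * D * x); last by field; rewrite gt_eqF.
  nra.
have i1 : int (fun g => c * expR (D ^+ 2 / (2 * b)) * expR (t ^+ 2 / (2 * b)) * expR (- D * rho g) + 0 * 0).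
  by apply: integrable_lin => //; exact: integrable_cst0.
have i2 : int (fun g => K g * expR (t * rho g)).
  apply: (integrable_le _ i1); first exact: measurable_funM.
  by move=> g; rewrite ger0_norm ?mulr_ge0 ?expR_ge0.
split => //; apply: le_trans.
  by apply: (le_Rintegral_ae i2 i1); exact: aeW.
rewrite Rintegral_lin//; last exact: integrable_cst0.
by rewrite mul0r addr0 mulrAC ler_wpM2r ?expR_ge0// lerDr.
Qed.

(** Otherwise every base set inside a translate of [V] is null. These sets are countably many and
    cover the group, which would then be null. *)
Lemma mu_open_gt0 (V : set G) : open V -> V 1%g -> (0 < mu V)%E.
Proof.
move=> oV V1; rewrite lt0e measure_ge0 andbT; apply/eqP => V0.
have [muT _ _] := hmu; move/eqP : muT; apply.
have [B cB [Bo Bb]] := sc.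
have mV : measurable (V : set (borel G)) by exact: open_borel.
have null A : B A -> (exists x, A `<=` [set y | V (x^-1 * y)%g]) -> mu A = 0%E.
  move=> BA [x Ax]; apply/eqP; rewrite -measure_le0 -V0 -(haar_translate hmu x^-1%g mV).
  by apply: le_measure; rewrite ?inE//; [apply: open_borel; exact: Bo|exact: measurable_translate].
pose B' := [set A | B A /\ exists x, A `<=` [set y | V (x^-1 * y)%g]].
have cB' : countable B' by apply: sub_countable cB; apply: subset_card_le => A [].
have BT : [set: G] = \bigcup_(A in B') A.
  apply/seteqP; split=> // x _.
  have nx : nbhs x [set y | V (x^-1 * y)%g] by apply: nbhs_translate; exact: open_nbhs_nbhs.
  have [A [BA Ax] AV] := Bb x _ nx.
  by exists A => //; split => //; exists x.
move: cB' => /pfcard_geP[B0|[f]].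
  by move: BT; rewrite B0 bigcup_set0 => /seteqP[/(_ 1%g I)].
have fE : [set: G] = \bigcup_n f n.
  rewrite BT; apply/seteqP; split=> x [A BA Ax]; last by exists (f A) => //; exact: funS.
  by have [n _ fn] := @surj _ _ _ _ f A BA; exists n => //; rewrite fn.
apply/eqP; rewrite -measure_le0 fE.
have fB n : B' (f n) by exact: funS.
have mf n : measurable (f n : set (borel G)) by apply: open_borel; apply: Bo; case: (fB n).
apply: (le_trans (@measure_sigma_subadditive _ _ _ mu _ (fun n => f n) mf _ (subset_refl _))).
  by apply: bigcup_measurable => n _; exact: mf.
  by [].
by rewrite eseries0// => n _ _ /=; apply: null; case: (fB n).
Qed.

Lemma mu_lty (V : set G) : open V -> V `<=` U -> (mu V < +oo)%E.
Proof.
move=> oV VU; apply: le_lt_trans (mu_admissible_lty hmu hU).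
by apply: le_measure; rewrite ?inE//; apply: open_borel => //; exact: admissible_open.
Qed.

Lemma measurable_shift2 (f : G -> R) : meas f ->
  measurable_fun [set: borel G * borel G]
    (fun z : borel G * borel G => f ((z.1 : G)^-1 * (z.2 : G))%g).
Proof.
move=> mf.
have m1 : measurable_fun [set: borel G * borel G]
    (fun z : borel G * borel G => ((z.1 : G)^-1%g : borel G, z.2)).
  apply/measurable_fun_pairP; split; last exact: measurable_snd.
  by apply: (measurableT_comp (@measurable_invg G)); exact: measurable_fst.
have m2 := measurableT_comp (measurable_mulg sc) m1.
exact: (measurableT_comp mf m2).
Qed.

Section LowerBound.
Variable phi : G -> R.
Hypothesis phi2 : square_integrable mu (phi : borel G -> R).
Local Notation D := (shift_dist mu phi).

Lemma integral_shift_dist h :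
  (\int[mu]_x ((phi (h^-1 * x)%g - phi x) ^+ 2)%:E = (D h ^+ 2)%:E)%E.
Proof. by rewrite integral_sqr//; exact: shift_diff2'. Qed.

Lemma measurable_shift_dist : meas (fun h => D h ^+ 2).
Proof.
have [mphi _] := phi2.
apply/measurable_EFinP.
rewrite (_ : EFin \o _ = fun h : borel G => (\int[mu]_x ((phi ((h : G)^-1 * x)%g - phi x) ^+ 2)%:E)%E); last first.
  by apply/funext => h; rewrite integral_shift_dist.
apply: (@measurable_integral2 _ _ (borel G) (borel G) R mu (fun z => ((phi ((z.1 : G)^-1 * z.2)%g - phi z.2) ^+ 2)%:E)).
- exact: (haar_sigma_finite hmu hG hU).
- apply/measurable_EFinP; apply: measurable_funX; apply: measurable_funB.
    exact: measurable_shift2.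
  exact: (measurableT_comp mphi measurable_snd).
- by move=> z; rewrite lee_fin sqr_ge0.
Qed.

Definition shift_energy (K : G -> R) : \bar R :=
  (\int[mu]_h \int[mu]_k (K h * K k * expR (- (rho h + rho k)) * D (h^-1 * k)%g ^+ 2)%:E)%E.

Lemma shift_dist_set_power (V : set G) (s : R) : 0 <= s ->
  (forall v, V v -> D v <= s) ->
  forall n g, (0 < n)%N -> set_power V n g -> D g <= n%:R * s.
Proof.
move=> s0 Vs; elim=> // -[|n] IH g _.
  move=> /set_powerS[a [b [Va [u [_ ->]] ->]]]; rewrite big_ord0 mulg1 mul1r.
  exact: Vs.
move=> /set_powerS[a [b [Va Vb ->]]]; rewrite -natr1 mulrDl mul1r addrC.
apply: (le_trans (shift_distM hmu phi2 a b)).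
by apply: lerD; [exact: Vs|exact: IH].
Qed.

End LowerBound.

Lemma set_power_cover (V : set G) : open V -> V 1%g -> (forall x, V x -> V x^-1%g) ->
  exists2 m : nat, (0 < m)%N & U `<=` set_power V m.
Proof.
move=> oV V1 VV.
have [s sU] := compact_translates (admissible_compact hU) oV V1.
have [m ms] : exists m : nat, forall x, x \in s -> set_power V m.+1 x.
  elim: s {sU} => [|x s [m ms]]; first by exists 0%N.
  have [n n0 Vn] := connected_set_power hG oV V1 VV x.
  exists (n + m)%N => y; rewrite inE => /predU1P[->|/ms].
    by apply: set_power_le Vn => //; rewrite -addnS leq_addr.
  by apply: set_power_le => //; rewrite -addnS leq_addl.
exists (m.+1 + 1)%N => // u Uu; have [x xs Vx] := sU u (subset_closure Uu).
rewrite -(mulVKg x u); apply: set_powerD; first exact: ms.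
exact: set_power1.
Qed.

(** Averaging turns an integral bound into a pointwise one. The energy controls [P], the integral of
    [D^2] over [V2]; since [D v <= D (v k) + D k], averaging over [k] in [V3] bounds [D v] for [v]
    in [V3]; finally [U] lies in a fixed power of [V3] and [D] is subadditive. *)
Lemma shift_energy_lower (W : set G) (e : R) : nbhs (1%g : G) W -> 0 < e ->
  exists2 C, 0 < C & forall (K phi : G -> R) (Q : R),
    meas K -> (forall g, 0 <= K g) -> (forall g, W g -> e <= K g) ->
    square_integrable mu (phi : borel G -> R) ->
    (shift_energy phi K <= Q%:E)%E ->
    forall u, U u -> shift_dist mu phi u ^+ 2 <= C * Q.
Proof.
move=> nW e0.
pose W0 := W° `&` U.
have oW0 : open W0 by apply: openI; [exact: open_interior|exact: admissible_open hU].
have W01 : W0 1%g by split; [exact: nW|exact: admissible1 hU].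
have [V2 [oV2 V21 V2V V22]] := open_sqrt oW0 W01.
have [V3 [oV3 V31 V3V V33]] := open_sqrt oV2 V21.
have [m m0 mU] := set_power_cover oV3 V31 V3V.
have V2W x : V2 x -> W0 x by move=> V2x; rewrite -[x]mulg1; exact: V22.
have V3V2 x : V3 x -> V2 x by move=> V3x; rewrite -[x]mulg1; exact: V33.
have WU : W0 `<=` U by move=> x [].
have mV2 : measurable (V2 : set (borel G)) by exact: open_borel.
have mV3 : measurable (V3 : set (borel G)) by exact: open_borel.
have V2fin : (mu V2 < +oo)%E by apply: mu_lty => // x /V2W/WU.
have V3fin : (mu V3 < +oo)%E by apply: mu_lty => // x /V3V2/V2W/WU.
pose a2 := fine (mu V2); pose a3 := fine (mu V3).
have a20 : 0 < a2 by rewrite fine_gt0// V2fin mu_open_gt0.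
have a30 : 0 < a3 by rewrite fine_gt0// V3fin mu_open_gt0.
(* For [h] in [V2] and [k] in [h V2] both points lie in [W0], where [K >= e] and [rho = 1]: the
   integrand is at least [e ^+ 2 * expR (- 2) * D (h^-1 k) ^+ 2]. Integration over [k] and then over
   [h] gives [c * P]. *)
pose c := e ^+ 2 * expR (- 2) * a2.
have c0 : 0 < c by rewrite !mulr_gt0 ?exprn_gt0 ?expR_gt0.
exists (m%:R ^+ 2 * (4 / (a3 * c))).
  by rewrite mulr_gt0 ?exprn_gt0 ?ltr0n// divr_gt0// mulr_gt0.
move=> K phi Q mK K0 We phi2 KQ.
have mD := measurable_shift_dist phi2.
pose D := shift_dist mu phi.
have [P PE] : exists P, P = (\int[mu]_k (\1_V2 k * D k ^+ 2)%:E)%E by eexists.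
have mind (A : set G) : measurable (A : set (borel G)) ->
    measurable_fun [set: borel G] (fun k : borel G => (\1_A k * D k ^+ 2)%:E).
  by move=> mA; apply/measurable_EFinP; apply: measurable_funM => //; exact: measurable_indic.
have ind0 (A : set G) k : (0 <= (\1_A k * D k ^+ 2)%:E)%E by rewrite lee_fin mulr_ge0 ?sqr_ge0.
have P0 : (0 <= P)%E by rewrite PE; apply: integral_ge0.
have mW0 : measurable (W0 : set (borel G)) by exact: open_borel.
have mDh h : meas (fun k => D (h^-1 * k)%g ^+ 2).
  exact: (@measurable_translateR R G h^-1%g (fun k => D k ^+ 2) mD).
pose q := e ^+ 2 * expR (- 2).
have q0 : 0 < q by rewrite mulr_gt0 ?exprn_gt0 ?expR_gt0.
have qP : (q%:E * P = \int[mu]_k (q%:E * (\1_V2 k * D k ^+ 2)%:E))%E.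
  by rewrite PE ge0_integralZl// ?lee_fin ?(ltW q0)//; exact: mind.
have E0 h k : 0 <= K h * K k * expR (- (rho h + rho k)) * D (h^-1 * k)%g ^+ 2.
  apply: mulr_ge0; last exact: sqr_ge0.
  by apply: mulr_ge0; [exact: mulr_ge0|exact: expR_ge0].
have inner h : ((q * \1_V2 h)%:E * P <=
    \int[mu]_k (K h * K k * expR (- (rho h + rho k)) * D (h^-1 * k)%g ^+ 2)%:E)%E.
  have mk : meas (fun k => K h * K k * expR (- (rho h + rho k)) * D (h^-1 * k)%g ^+ 2).
    apply: measurable_funM => //; apply: measurable_funM; first exact: measurable_funM.
    apply: measurableT_comp => //; apply: measurable_funN; apply: measurable_funD => //.
    exact: measurable_rho.
  rewrite indicE; case: (boolP (h \in V2)) => [|_]; last first.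
    rewrite mulr0 mul0e; apply: integral_ge0 => k _.
    by rewrite lee_fin E0.
  rewrite inE => V2h; rewrite mulr1 qP.
  pose f (k : G) := (q * (\1_W0 k * D (h^-1 * k)%g ^+ 2))%:E.
  have mf : measurable_fun [set: borel G] (f : borel G -> \bar R).
    by apply/measurable_EFinP; do 2 apply: measurable_funM => //; exact: measurable_indic.
  have f0 k : (0 <= f k)%E by rewrite lee_fin mulr_ge0 ?(ltW q0)// mulr_ge0 ?sqr_ge0.
  apply: (@le_trans _ _ (\int[mu]_k f (h * k)%g)%E).
    apply: ge0_le_integral => //.
    - by move=> k _; rewrite mule_ge0// lee_fin ltW.
    - by apply: measurable_funeM; exact: mind.
    - exact: (measurableT_comp mf (measurable_mulgl h)).
    move=> k _; rewrite -EFinM lee_fin ler_wpM2l ?(ltW q0)// mulKg ler_wpM2r ?sqr_ge0//.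
    rewrite !indicE ler_nat; case: (boolP (k \in V2)) => // /[!inE] V2k.
    by rewrite mem_set//; exact: V22.
  rewrite (integral_translate hmu h mf f0).
  apply: ge0_le_integral => //.
  - by apply/measurable_EFinP.
  move=> k _; rewrite lee_fin indicE; case: (boolP (k \in W0)) => [|_]; last first.
    by rewrite mul0r mulr0 E0.
  rewrite inE mul1r => W0k; rewrite ler_wpM2r ?sqr_ge0// (rhoU R hG hU (WU _ W0k)).
  have W0h := V2W _ V2h; rewrite (rhoU R hG hU (WU _ W0h)) ler_wpM2r ?expR_ge0//.
  have Wi x : W0 x -> W x by move=> [/interior_subset].
  by rewrite expr2 ler_pM ?(ltW e0)// We//; exact: Wi.
have step1 : (c%:E * P <= Q%:E)%E.
  apply: le_trans KQ; rewrite /shift_energy.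
  apply: (@le_trans _ _ (\int[mu]_h ((q * \1_V2 h)%:E * P))%E).
    rewrite ge0_integralZr//; last 2 first.
    - by apply/measurable_EFinP; apply: measurable_funM => //; exact: measurable_indic.
    - by move=> h _; rewrite lee_fin mulr_ge0 ?(ltW q0).
    rewrite lee_wpmul2r//.
    under eq_integral do rewrite EFinM.
    rewrite ge0_integralZl ?lee_fin ?(ltW q0)//; last first.
      by apply/measurable_EFinP; exact: measurable_indic.
    by rewrite integral_indic// setIT -(@fineK _ (mu V2)) ?ge0_fin_numE.
  apply: ge0_le_integral => //.
  - by move=> h _; rewrite mule_ge0// lee_fin mulr_ge0 ?(ltW q0).
  - have mi : measurable_fun [set: borel G] (fun h : borel G => (q * \1_V2 h)%:E).
      by apply/measurable_EFinP; apply: measurable_funM => //; exact: measurable_indic.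
    by apply: emeasurable_funM => //; exact: measurable_cst.
  have sf := haar_sigma_finite hmu hG hU.
  apply: (@measurable_integral2 _ _ (borel G) (borel G) R mu (fun z => (K z.1 * K z.2 * expR (- (rho z.1 + rho z.2)) * D ((z.1 : G)^-1 * z.2)%g ^+ 2)%:E) sf).
    apply/measurable_EFinP; apply: measurable_funM.
      have mr : meas rho by exact: measurable_rho.
      apply: measurable_funM.
        by apply: measurable_funM; [exact: (measurableT_comp mK measurable_fst)|exact: (measurableT_comp mK measurable_snd)].
      apply: measurableT_comp => //; apply: measurable_funN; apply: measurable_funD.
        exact: (measurableT_comp mr measurable_fst).
      exact: (measurableT_comp mr measurable_snd).
    exact: (@measurable_shift2 (fun k => D k ^+ 2) mD).
  by move=> z; rewrite lee_fin E0.
have Pfin : P \is a fin_num.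
  rewrite ge0_fin_numE// ltNge leye_eq; apply/negP => /eqP Py.
  by move: step1; rewrite Py mulry gtr0_sg// mul1e leye_eq.
(* In the factor 4, one 2 comes from the square of a sum and the other from the two integrals, each
   at most [P] because [V3] and [V3 V3] lie in [V2]. *)
have step2 v : V3 v -> D v ^+ 2 <= 4 * fine P / a3.
  move=> V3v; have f3 : mu V3 \is a fin_num by rewrite ge0_fin_numE.
  rewrite ler_pdivlMr// -lee_fin !EFinM /a3 !fineK//.
  pose i3 (k : G) : R := \1_V3 k.
  have mi3 : meas i3 by exact: measurable_indic.
  pose f (k : G) := (i3 (v^-1 * k)%g * D k ^+ 2)%:E.
  have mf : measurable_fun [set: borel G] (f : borel G -> \bar R).
    apply/measurable_EFinP; apply: measurable_funM => //.
    exact: (measurable_translateR v^-1%g mi3).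
  have f0 k : (0 <= f k)%E by rewrite lee_fin mulr_ge0 ?sqr_ge0 /i3.
  have fP : (\int[mu]_k f (v * k)%g <= P)%E.
    rewrite (integral_translate hmu v mf f0) PE; apply: ge0_le_integral => //.
      exact: mind.
    move=> k _; rewrite lee_fin ler_wpM2r ?sqr_ge0// /i3 !indicE ler_nat.
    case: (boolP (_ \in V3)) => // /[!inE] V3k; rewrite mem_set// -(mulVKg v k).
    exact: V33.
  apply: (@le_trans _ _ (\int[mu]_k (2%:E * f (v * k)%g + 2%:E * (\1_V3 k * D k ^+ 2)%:E))%E); last first.
    rewrite ge0_integralD//; last 4 first.
    - by move=> k _; rewrite mule_ge0.
    - by apply: measurable_funeM; exact: (measurableT_comp mf (measurable_mulgl v)).
    - by move=> k _; rewrite mule_ge0.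
    - by apply: measurable_funeM; exact: mind.
    rewrite !ge0_integralZl//; last 2 first.
    - exact: mind.
    - exact: (measurableT_comp mf (measurable_mulgl v)).
    have -> : (4%:E * P = 2%:E * P + 2%:E * P)%E.
      by rewrite -(fineK Pfin) -!EFinM -EFinD; congr _%:E; ring.
    apply: leeD; (apply: lee_wpmul2l; first by rewrite lee_fin); first exact: fP.
    rewrite PE; apply: ge0_le_integral => //; [exact: mind|exact: mind|].
    move=> k _; rewrite lee_fin ler_wpM2r ?sqr_ge0// !indicE ler_nat.
    by case: (boolP (_ \in V3)) => // /[!inE] V3k; rewrite mem_set//; exact: V3V2.
  have DvE : ((D v ^+ 2)%:E * mu V3 = \int[mu]_k ((D v ^+ 2)%:E * (\1_V3 k)%:E))%E.
    rewrite ge0_integralZl ?lee_fin ?sqr_ge0//; last first.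
      by apply/measurable_EFinP; exact: measurable_indic.
    by rewrite integral_indic// setIT.
  rewrite DvE; apply: ge0_le_integral.
  - exact: measurableT.
  - by move=> k _; rewrite mule_ge0// lee_fin sqr_ge0.
  - by apply: measurable_funeM; apply/measurable_EFinP; exact: measurable_indic.
  - apply: emeasurable_funD; apply: measurable_funeM; last exact: mind.
    exact: (measurableT_comp mf (measurable_mulgl v)).
  move=> k _; rewrite -!EFinM -EFinD lee_fin mulKg /i3.
  rewrite indicE; case: (k \in V3); last by rewrite !mul0r !mulr0 addr0.
  rewrite !mul1r mulr1.
  have := shift_distM hmu phi2 (v * k)%g k^-1%g; rewrite mulgK shift_distV// -/D.
  have := shift_dist_ge0 mu phi v; rewrite -/D.
  move: (D v) (D (v * k)%g) (D k) => x y z x0 xyz.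
  have : x ^+ 2 <= (y + z) ^+ 2 by rewrite ler_pXn2r// nnegrE (le_trans x0).
  have := sqr_ge0 (y - z); lra.
have fP0 : 0 <= fine P by exact: fine_ge0.
have step1' : c * fine P <= Q by rewrite -lee_fin EFinM fineK.
move=> u Uu; pose s := Num.sqrt (4 * fine P / a3).
have s0 : 0 <= s by exact: sqrtr_ge0.
have s2 : s ^+ 2 = 4 * fine P / a3 by rewrite sqr_sqrtr// divr_ge0 ?(ltW a30)// mulr_ge0.
have Vs v : V3 v -> D v <= s.
  move=> V3v; rewrite -(@ler_pXn2r _ 2)// ?nnegrE ?shift_dist_ge0// s2; exact: step2.
have Du := shift_dist_set_power phi2 s0 Vs m0 (mU _ Uu).
apply: (@le_trans _ _ ((m%:R * s) ^+ 2)).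
  by rewrite ler_pXn2r// ?nnegrE ?shift_dist_ge0// mulr_ge0.
have PQ : fine P <= c^-1 * Q by rewrite ler_pdivlMl.
rewrite exprMn s2 (_ : _ * (4 * fine P / a3) = m%:R ^+ 2 * (4 / a3) * fine P); last by ring.
rewrite invfM (_ : _ * Q = m%:R ^+ 2 * (4 / a3) * (c^-1 * Q)); last by ring.
by rewrite ler_wpM2l// mulr_ge0 ?exprn_ge0// divr_ge0// ltW.
Qed.

End Bounds.

(** * The one-step estimate *)

Section Kernel.
Variables (R : realType) (G : topGroupType).
Hypothesis sc : @second_countable G.
Variable mu : {measure set (borel G) -> \bar R}.
Hypothesis hmu : left_haar_measure mu.
Variable U : set G.
Hypothesis hG : connected [set: G].
Hypothesis hU : admissible_nbhd U.
Variables (q r : nat) (theta : abelianization G -> 'rV[R]_q * 'rV[circle R]_r).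
Hypothesis htheta : is_abelianization_iso theta.
Variables (c b : R).
Hypothesis (c0 : 0 < c) (b0 : 0 < b).
Local Notation rho := (rho R U).
Local Notation int f := (mu.-integrable [set: borel G] (EFin \o (f : borel G -> R))).
Local Notation meas f := (measurable_fun [set: borel G] (f : borel G -> R)).

Lemma additive_map_pi1_coord (i : 'I_q) : additive_map (pi1 theta i).
Proof.
have [thetaM ctheta _] := htheta; split; last first.
  by move=> g h; rewrite /pi1 thetaM !mxE.
move=> g; apply: (@cvg_comp _ _ _ (fun g : G => (theta (pi0 g)).1) (fun v : 'rV[R]_q => v ord0 i) _ (nbhs (theta (pi0 g)).1)); last exact: coord_continuous.
apply: (@cvg_comp _ _ _ (fun g : G => theta (pi0 g)) fst _ (nbhs (theta (pi0 g)))); last exact: cvg_fst.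
apply: (@cvg_comp _ _ _ (@pi0 G) theta _ (nbhs (pi0 g))); last exact: ctheta.
exact: pi_continuous.
Qed.

Record gaussian_kernel (K : G -> R) := GaussianKernel {
  kernel_density : probability_density mu K ;
  kernel_centered : centered mu theta K ;
  kernel_bound : forall g, K g <= c * expR (- b * rho g ^+ 2) }.

Section OneKernel.
Variable K : G -> R.
Hypothesis hK : gaussian_kernel K.

Lemma kernel_meas : meas K. Proof. by case: hK => -[]. Qed.
Lemma kernel_ge0 g : 0 <= K g. Proof. by case: hK => -[]. Qed.
Lemma kernel_int : int K.
Proof.
apply/integrableP; split; first by apply/measurable_EFinP; exact: kernel_meas.
under eq_integral do rewrite gee0_abs ?lee_fin ?kernel_ge0//.
by have [[_ _ ->] _ _] := hK; rewrite ltry.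
Qed.
Lemma kernel_mass : \int[mu]_g K g = 1.
Proof. by have [[_ _ K1] _ _] := hK; rewrite /Rintegral K1. Qed.

Lemma kernel_exp_int t : int (fun g => K g * expR (t * rho g)).
Proof.
have [C _ HC] := exp_moment hmu hG hU c0 b0.
by have [] := HC K kernel_meas kernel_ge0 (kernel_bound hK) t.
Qed.

Lemma rho_le_exp g : rho g <= expR (1 * rho g).
Proof. by rewrite mul1r; have := expR_ge1Dx (rho g); lra. Qed.

Lemma kernel_additive_int (eta : G -> R) : additive_map eta -> int (fun g => K g * eta g).
Proof.
move=> ha; have [M M0 etaM] := additive_map_bound hG hU ha.
have i1 := integrable_lin M 0 (kernel_exp_int 1) (integrable_cst0 _).
apply: (integrable_le _ i1).
  apply: measurable_funM; first exact: kernel_meas.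
  by apply: continuous_borel; case: ha.
move=> g; rewrite mulr0 addr0 normrM (ger0_norm (kernel_ge0 g)) mulrCA ler_wpM2l ?kernel_ge0//.
by apply: (le_trans (etaM g)); rewrite ler_wpM2l// rho_le_exp.
Qed.

Lemma kernel_additive (eta : G -> R) : additive_map eta -> \int[mu]_g (K g * eta g) = 0.
Proof.
move=> ha; have [a etaE] := additive_map_pi1 ha htheta.
have Kpi i : int (fun g => K g * pi1 theta i g).
  by apply: kernel_additive_int; exact: additive_map_pi1_coord.
have Kpi0 i : \int[mu]_g (K g * pi1 theta i g) = 0.
  by have := kernel_centered hK i; rewrite /Rintegral => ->.
have H (s : seq 'I_q) : int (fun g => \sum_(i <- s) a i * (K g * pi1 theta i g)) /\
    \int[mu]_g (\sum_(i <- s) a i * (K g * pi1 theta i g)) = 0.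
  elim: s => [|i s [IH1 IH2]].
    under [X in mu.-integrable _ (EFin \o X)]eq_fun do rewrite big_nil.
    split; first exact: integrable_cst0.
    by under eq_Rintegral do rewrite big_nil; rewrite /Rintegral integral0.
  have E : (fun g : borel G => \sum_(i <- i :: s) a i * (K g * pi1 theta i g)) =
      (fun g : borel G => a i * (K g * pi1 theta i g) + 1 * \sum_(i <- s) a i * (K g * pi1 theta i g)).
    by apply/funext => g; rewrite big_cons mul1r.
  rewrite E; split; first exact: integrable_lin.
  by rewrite Rintegral_lin// Kpi0 IH2 !mulr0 addr0.
rewrite -(H (index_enum 'I_q)).2; congr (Rintegral _ _ _); apply/funext => g.
by rewrite etaE mulr_sumr; apply: eq_bigr => i _; rewrite mulrCA.
Qed.

(** The two terms in [eta] vanish by centering and the last one factorises. With [eta = 0] and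
    [lambda = beta = 0] it also gives the total mass of a constant, used to bound the energy. *)
Lemma kernel_double (alpha lambda beta : R) (eta : G -> R) (Q := fun g : G => expR (2 * rho g)) :
  additive_map eta ->
  (\int[mu]_h \int[mu]_k (K h * K k * (alpha + lambda * eta h + lambda * eta k + beta * (Q h * Q k)))%:E =
   (alpha + beta * (\int[mu]_g (K g * Q g)) ^+ 2)%:E)%E.
Proof.
move=> ha; set p := Rintegral _ _ _.
have iK := kernel_int; have iQ := kernel_exp_int 2; have ie := kernel_additive_int ha.
have e0 := kernel_additive ha.
have lin x y z : int (fun g => 1 * (x * K g + y * (K g * eta g)) + z * (K g * Q g)) /\
    \int[mu]_g (1 * (x * K g + y * (K g * eta g)) + z * (K g * Q g)) = x + z * p.
  have i1 := integrable_lin x y iK ie.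
  split; first exact: integrable_lin.
  by rewrite Rintegral_lin// Rintegral_lin// kernel_mass e0 mulr0 addr0 mulr1 mul1r.
transitivity (\int[mu]_h (1 * (alpha * K h + lambda * (K h * eta h)) + beta * p * (K h * Q h))%:E)%E.
  apply: eq_integral => h _.
  have [il el] := lin (K h * (alpha + lambda * eta h)) (K h * lambda) (K h * beta * Q h).
  transitivity (\int[mu]_k (1 * (K h * (alpha + lambda * eta h) * K k + K h * lambda * (K k * eta k)) + K h * beta * Q h * (K k * Q k))%:E)%E.
    by apply: eq_integral => k _; congr _%:E; ring.
  by rewrite -RintegralE// el; congr _%:E; ring.
have [il el] := lin alpha lambda (beta * p).
by rewrite -RintegralE// el; congr _%:E; ring.
Qed.

End OneKernel.
End Kernel.

(** * The squared norm as a correlation integral *)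

Section OneStep.
Variables (R : realType) (G : topGroupType).
Hypothesis sc : @second_countable G.
Variable mu : {measure set (borel G) -> \bar R}.
Hypothesis hmu : left_haar_measure mu.
Variable U : set G.
Hypothesis hG : connected [set: G].
Hypothesis hU : admissible_nbhd U.
Variables (q r : nat) (theta : abelianization G -> 'rV[R]_q * 'rV[circle R]_r).
Hypothesis htheta : is_abelianization_iso theta.
Variables (c b : R).
Hypothesis (c0 : 0 < c) (b0 : 0 < b).
Local Notation rho := (rho R U).
Local Notation int f := (mu.-integrable [set: borel G] (EFin \o (f : borel G -> R))).
Local Notation meas f := (measurable_fun [set: borel G] (f : borel G -> R)).
Local Notation gaussian_kernel := (gaussian_kernel mu U theta c b).

Section Fixed.
Variables (K phi psi : G -> R).
Hypothesis hK : gaussian_kernel K.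
Hypothesis phi2 : square_integrable mu (phi : borel G -> R).
Hypothesis phi0 : forall x, 0 <= phi x.
Hypothesis mpsi : meas psi.
Hypothesis psi_lip : forall u, U u ->
  {ae mu, forall x : borel G, `|psi (u^-1 * x)%g - psi x| <= 1}.
Variable lambda : R.
Local Notation N := (norm2 mu (phi : borel G -> R)).
Local Notation D := (shift_dist mu phi).
Local Notation ws := (weighted_shift phi psi lambda).
Let K0 := kernel_ge0 hK.

(** The integral over the first variable is the conjugated convolution of [phi], evaluated at the
    second. *)
Definition step_fun (z : borel G * borel G) : R := K z.1 * ws z.1 z.2.

Lemma step_fun_ge0 z : 0 <= step_fun z.
Proof. by rewrite mulr_ge0 ?K0// mulr_ge0 ?expR_ge0. Qed.

Lemma measurable_step_fun : measurable_fun setT step_fun.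
Proof.
have [mphi _] := phi2.
apply: measurable_funM; first exact: (measurableT_comp (kernel_meas hK) measurable_fst).
apply: measurable_funM; last exact: measurable_shift2.
apply: measurableT_comp => //; apply: measurable_funM => //; apply: measurable_funB.
  exact: (measurableT_comp mpsi measurable_snd).
exact: measurable_shift2.
Qed.

Definition step_corr (h k : G) : R := \int[mu]_x (ws h x * ws k x).

Lemma step_corr_ge0 h k : 0 <= step_corr h k.
Proof.
apply: Rintegral_ge0 => x _.
by apply: mulr_ge0; apply: mulr_ge0; rewrite ?expR_ge0.
Qed.

Let triple (z : borel G * borel G * borel G) : \bar R :=
  (step_fun (z.1.2, z.1.1) * step_fun (z.2, z.1.1))%:E.

Let measurable_triple : measurable_fun setT triple.
Proof.
apply/measurable_EFinP; apply: measurable_funM.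
  apply: (measurableT_comp measurable_step_fun); apply/measurable_fun_pairP; split => /=.
    exact: (measurableT_comp measurable_snd measurable_fst).
  exact: (measurableT_comp measurable_fst measurable_fst).
apply: (measurableT_comp measurable_step_fun); apply/measurable_fun_pairP; split => /=.
  exact: measurable_snd.
exact: (measurableT_comp measurable_fst measurable_fst).
Qed.

Let triple_ge0 z : (0 <= triple z)%E.
Proof. by rewrite lee_fin mulr_ge0 ?step_fun_ge0. Qed.

(** Nonnegativity lets Tonelli move the integral over [x] inside two others before any of them is
    known to be finite; only the innermost one, of a product of two L2 functions, is then converted
    to a real number. *)
Lemma integral_step_fun_sqr :
  (\int[mu]_x ((\int[mu]_h (step_fun (h, x))%:E) * (\int[mu]_h (step_fun (h, x))%:E)) =
   \int[mu]_h \int[mu]_k (K h * K k * step_corr h k)%:E)%E.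
Proof.
have sf := haar_sigma_finite hmu hG hU.
have ms x : measurable_fun [set: borel G] (fun h : borel G => (step_fun (h, x))%:E).
  by apply/measurable_EFinP; exact: (measurableT_comp measurable_step_fun (pair2_measurable (x : borel G))).
have s0 x h : (0 <= (step_fun (h, x))%:E)%E by rewrite lee_fin step_fun_ge0.
transitivity (\int[mu]_x \int[mu]_h \int[mu]_k triple (x, h, k))%E.
  apply: eq_integral => x _.
  rewrite -ge0_integralZr//; last by apply: integral_ge0.
  apply: eq_integral => h _.
  by rewrite -ge0_integralZl.
rewrite (@tonelli _ _ (borel G) (borel G) R mu mu (fun z => \int[mu]_k triple (z, k))%E)//; last 2 first.
- exact: (@measurable_integral2 _ _ _ (borel G) R mu triple sf).
- by move=> z; apply: integral_ge0.
apply: eq_integral => h _.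
rewrite (@tonelli _ _ (borel G) (borel G) R mu mu (fun z => triple (z.1, h, z.2)))//; last first.
  apply: (measurableT_comp measurable_triple); apply/measurable_fun_pairP; split => /=; last exact: measurable_snd.
  apply/measurable_fun_pairP; split => /=; last exact: measurable_cst.
  exact: measurable_fst.
apply: eq_integral => k _.
transitivity (\int[mu]_x ((K h * K k)%:E * (ws h x * ws k x)%:E))%E.
  by apply: eq_integral => x _; rewrite /triple /step_fun /= -EFinM; congr _%:E; ring.
have iw := integrable_weighted_shiftM hmu hG hU phi2 mpsi psi_lip lambda h k.
by rewrite integralZl// -RintegralE.
Qed.

Lemma measurable_corr :
  measurable_fun [set: borel G * borel G]
    (fun z : borel G * borel G => (K z.1 * K z.2 * step_corr z.1 z.2)%:E).
Proof.
have sf := haar_sigma_finite hmu hG hU.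
pose t (z : borel G * borel G * borel G) : \bar R := triple (z.2, z.1.1, z.1.2).
have mt : measurable_fun setT t.
  apply: (measurableT_comp measurable_triple); apply/measurable_fun_pairP; split => /=.
    apply/measurable_fun_pairP; split => /=; first exact: measurable_snd.
    exact: (measurableT_comp measurable_fst measurable_fst).
  exact: (measurableT_comp measurable_snd measurable_fst).
have := @measurable_integral2 _ _ _ (borel G) R mu t sf mt (fun z => triple_ge0 _).
apply: eq_measurable_fun => -[h k] _ /=.
transitivity (\int[mu]_x ((K h * K k)%:E * (ws h x * ws k x)%:E))%E.
  by apply: eq_integral => x _; rewrite /t /triple /step_fun /= -EFinM; congr _%:E; ring.
have iw := integrable_weighted_shiftM hmu hG hU phi2 mpsi psi_lip lambda h k.
by rewrite integralZl// -RintegralE.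
Qed.

(** The estimate [weighted_shiftM_large] factorises in [h] and [k], so integration gives the square
    of one exponential moment. *)
Lemma step_large (p := \int[mu]_g (K g * expR (`|lambda| * rho g))) :
  (\int[mu]_h \int[mu]_k (K h * K k * step_corr h k)%:E <= (p ^+ 2 * N ^+ 2)%:E)%E.
Proof.
have sf := haar_sigma_finite hmu hG hU.
have ie := kernel_exp_int hmu hG hU c0 b0 hK `|lambda|.
have mr : meas rho by exact: measurable_rho.
pose E (g : G) := K g * expR (`|lambda| * rho g).
have E0 g : 0 <= E g by rewrite mulr_ge0 ?expR_ge0 ?K0.
have p0 : 0 <= p by apply: Rintegral_ge0 => g _; exact: E0.
have mE : meas E by exact: integrable_measurable ie.
have IE a : (\int[mu]_k (a%:E * (E k)%:E) = (a * p)%:E)%E by rewrite integralZl// -RintegralE.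
have inner h : (\int[mu]_k (K h * K k * step_corr h k)%:E <= (E h * N ^+ 2 * p)%:E)%E.
  apply: (@le_trans _ _ (\int[mu]_k ((E h * N ^+ 2)%:E * (E k)%:E))%E).
    apply: ge0_le_integral => //.
    - by move=> k _; rewrite lee_fin mulr_ge0 ?step_corr_ge0// mulr_ge0 ?K0.
    - exact: (measurableT_comp measurable_corr (pair1_measurable (h : borel G))).
    - by apply: measurable_funeM; apply/measurable_EFinP.
    move=> k _; rewrite -EFinM lee_fin.
    have := weighted_shiftM_large hmu hG hU phi2 mpsi psi_lip lambda h k.
    rewrite mulrDr expRD => le.
    apply: (le_trans (ler_wpM2l (mulr_ge0 (K0 h) (K0 k)) le)).
    by rewrite /E le_eqVlt; apply/orP; left; apply/eqP; ring.
  by rewrite IE.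
apply: (@le_trans _ _ (\int[mu]_h ((N ^+ 2 * p)%:E * (E h)%:E))%E).
  apply: ge0_le_integral => //.
  - by move=> h _; apply: integral_ge0 => k _; rewrite lee_fin mulr_ge0 ?step_corr_ge0// mulr_ge0 ?K0.
  - apply: (@measurable_integral2 _ _ (borel G) (borel G) R mu (fun z => (K z.1 * K z.2 * step_corr z.1 z.2)%:E) sf measurable_corr).
    by move=> z; rewrite lee_fin mulr_ge0 ?step_corr_ge0// mulr_ge0 ?K0.
  - by apply: measurable_funeM; apply/measurable_EFinP.
  by move=> h _; apply: (le_trans (inner h)); rewrite -EFinM lee_fin -mulrA mulrC.
by rewrite IE lee_fin le_eqVlt; apply/orP; left; apply/eqP; ring.
Qed.

Let p := \int[mu]_g (K g * expR (2 * rho g)).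

Lemma measurable_energy :
  measurable_fun [set: borel G * borel G]
    (fun z : borel G * borel G => (K z.1 * K z.2 * expR (- (rho z.1 + rho z.2)) * D ((z.1 : G)^-1 * z.2)%g ^+ 2)%:E).
Proof.
have mr : meas rho by exact: measurable_rho.
have mK := kernel_meas hK.
apply/measurable_EFinP; apply: measurable_funM; last first.
  exact: (@measurable_shift2 R G sc (fun k => D k ^+ 2) (measurable_shift_dist sc hmu hG hU phi2)).
apply: measurable_funM.
  by apply: measurable_funM; [exact: (measurableT_comp mK measurable_fst)|exact: (measurableT_comp mK measurable_snd)].
apply: measurableT_comp => //; apply: measurable_funN; apply: measurable_funD.
  exact: (measurableT_comp mr measurable_fst).
exact: (measurableT_comp mr measurable_snd).
Qed.

Lemma energy_ge0 h k : 0 <= K h * K k * expR (- (rho h + rho k)) * D (h^-1 * k)%g ^+ 2.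
Proof.
apply: mulr_ge0; last exact: sqr_ge0.
by apply: mulr_ge0; [apply: mulr_ge0; exact: K0|exact: expR_ge0].
Qed.

(** Follows from [shift_dist <= 2 ||phi||]. What matters is finiteness: the energy can be treated as
    a real number when it absorbs the error. *)
Lemma shift_energy_bound : (shift_energy mu U phi K <= (4 * N ^+ 2)%:E)%E.
Proof.
have sf := haar_sigma_finite hmu hG hU.
have h0 : additive_map (fun _ : G => 0 : R) by split=> [x|g h]; [exact: cvg_cst|rewrite addr0].
have := kernel_double hmu hG hU htheta c0 b0 hK (4 * N ^+ 2) 0 0 h0.
rewrite [in X in _ = X -> _]mul0r [in X in _ = X -> _]addr0 => <-.
have le h k : K h * K k * expR (- (rho h + rho k)) * D (h^-1 * k)%g ^+ 2 <=
    K h * K k * (4 * N ^+ 2 + 0 * 0 + 0 * 0 + 0 * (expR (2 * rho h) * expR (2 * rho k))).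
  rewrite !mul0r !addr0 -[X in X <= _]mulrA ler_wpM2l ?mulr_ge0 ?K0//.
  rewrite -[4 * _]mul1r ler_pM ?expR_ge0 ?sqr_ge0//.
    by rewrite expR_le1 oppr_le0 addr_ge0// rho_ge0.
  rewrite (_ : 4 * _ = (2 * N) ^+ 2); last by ring.
  rewrite ler_pXn2r// ?nnegrE ?shift_dist_ge0 ?mulr_ge0 ?norm2_ge0//.
  exact: shift_dist_le2.
have mR : measurable_fun [set: borel G * borel G] (fun z : borel G * borel G => (K z.1 * K z.2 * (4 * N ^+ 2 + 0 * 0 + 0 * 0 + 0 * (expR (2 * rho z.1) * expR (2 * rho z.2))))%:E).
  have mK := kernel_meas hK.
  under eq_fun do rewrite !mul0r !addr0.
  apply/measurable_EFinP; apply: measurable_funM => //.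
  by apply: measurable_funM; [exact: (measurableT_comp mK measurable_fst)|exact: (measurableT_comp mK measurable_snd)].
have R0 h k : 0 <= K h * K k * (4 * N ^+ 2 + 0 * 0 + 0 * 0 + 0 * (expR (2 * rho h) * expR (2 * rho k))).
  exact: le_trans (energy_ge0 h k) (le h k).
apply: ge0_le_integral => //.
- by move=> h _; apply: integral_ge0 => k _; rewrite lee_fin energy_ge0.
- apply: (@measurable_integral2 _ _ (borel G) (borel G) R mu _ sf measurable_energy) => z.
  by rewrite lee_fin energy_ge0.
- apply: (@measurable_integral2 _ _ (borel G) (borel G) R mu _ sf mR) => z.
  by rewrite lee_fin R0.
move=> h _; apply: ge0_le_integral => //.
- by move=> k _; rewrite lee_fin energy_ge0.
- exact: (measurableT_comp measurable_energy (pair1_measurable (h : borel G))).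
- exact: (measurableT_comp mR (pair1_measurable (h : borel G))).
by move=> k _; rewrite lee_fin.
Qed.

Lemma sqr_exp_le (a : R) : 0 <= a -> a ^+ 2 <= 2 * expR a.
Proof. by move=> a0; have := expR_ge1Dxn 1 a0; rewrite (_ : 2`!%:R = 2 :> R)//; lra. Qed.

Section Small.
Variables (C C1 p0 : R).
Hypothesis C_ge0 : 0 <= C.
Hypothesis C1_ge0 : 0 <= C1.
Hypothesis stable : forall (F : G -> R) delta M, 0 <= delta -> quasi_additive U delta F ->
    (forall g, `|F g| <= M * rho g) ->
    exists2 eta : G -> R, additive_map eta &
      forall g, `|F g - eta g| <= C * delta * rho g ^+ 2.
Hypothesis lower : forall Q : R, (shift_energy mu U phi K <= Q%:E)%E ->
  forall u, U u -> D u ^+ 2 <= C1 * Q.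
Hypothesis p_le : p <= p0.
Hypothesis l1 : `|lambda| <= 1.

(** Replacing the drift by a homomorphism [eta] turns [2 F h - F (k^-1 h) + 2 F k - F (h^-1 k)] into
    [2 eta h + 2 eta k], a sum without mixed terms that centering can annihilate. The error is
    bounded by a multiple of [e^(2 rho h) e^(2 rho k)], which factorises. *)
Lemma step_corr_bound (Q : R) : 0 <= Q -> (shift_energy mu U phi K <= Q%:E)%E ->
  exists2 eta : G -> R, additive_map eta & forall h k,
    step_corr h k + 2^-1 * (expR (- (rho h + rho k)) * D (h^-1 * k)%g ^+ 2) <=
    N ^+ 2 + lambda * eta h + lambda * eta k +
    (2 * N ^+ 2 * lambda ^+ 2 + 8 * C * `|lambda| * N * Num.sqrt (C1 * Q)) * (expR (2 * rho h) * expR (2 * rho k)).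
Proof.
move=> Q0 HQ; set s := Num.sqrt (C1 * Q).
have s0 : 0 <= s by exact: sqrtr_ge0.
have s2 : s ^+ 2 = C1 * Q by rewrite /s sqr_sqrtr// mulr_ge0.
have Us u : U u -> D u <= s.
  move=> Uu; rewrite -(@ler_pXn2r _ 2)// ?nnegrE ?shift_dist_ge0// s2.
  exact: (lower HQ Uu).
have N0 : 0 <= N by exact: norm2_ge0.
have delta0 : 0 <= 2 * N * s by rewrite !mulr_ge0.
have Fq : quasi_additive U (2 * N * s) (weight_drift mu phi psi).
  move=> g h; apply: (le_trans (weight_drift_quasi hmu hG hU phi2 mpsi psi_lip g h)).
  rewrite (_ : 2 * N * s * _ * _ = 2 * N * rho g * (rho h * s)); last by ring.
  rewrite ler_wpM2l ?(shift_dist_rho hmu hG hU phi2 Us)//.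
  by rewrite !mulr_ge0// rho_ge0.
have [eta ha etaE] := stable delta0 Fq (weight_drift_bound hmu hG hU phi2 mpsi psi_lip).
exists eta => // h k.
have := weighted_shiftM_small hmu hG hU phi2 mpsi psi_lip h k l1.
rewrite -/(step_corr h k); set a := rho h + rho k; set S := expR _ * _ ^+ 2.
set F := weight_drift mu phi psi.
have [_ etaM] := ha.
have etaV g : eta g^-1%g = - eta g by exact: additive_mapV.
have r0 g : 0 <= rho g by exact: rho_ge0.
have := etaE h; have := etaE k; have := etaE (h^-1 * k)%g; have := etaE (k^-1 * h)%g.
rewrite !etaM !etaV -/F.
set dl := C * (2 * N * s).
have dl0 : 0 <= dl by exact: mulr_ge0.
have rhk g g' : rho (g^-1 * g')%g <= rho g + rho g' by rewrite -(rhoV R hG hU g); exact: rhoM.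
have r1 : dl * rho (k^-1 * h)%g ^+ 2 <= dl * a ^+ 2.
  by rewrite ler_wpM2l// ler_pXn2r// ?nnegrE// ?addr_ge0// /a addrC.
have r2 : dl * rho (h^-1 * k)%g ^+ 2 <= dl * a ^+ 2.
  by rewrite ler_wpM2l// ler_pXn2r// ?nnegrE// ?addr_ge0.
have r3 : dl * rho h ^+ 2 + dl * rho k ^+ 2 <= dl * a ^+ 2.
  by rewrite -mulrDr ler_wpM2l// /a sqrrD; have := mulr_ge0 (r0 h) (r0 k); rewrite mulr2n; lra.
move=> /ler_normlP[h1 h2] /ler_normlP[h3 h4] /ler_normlP[h5 h6] /ler_normlP[h7 h8] main.
have a0 : 0 <= a by rewrite addr_ge0.
have QQ : expR (2 * rho h) * expR (2 * rho k) = expR a * expR a.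
  by rewrite -!expRD; congr expR; rewrite /a; ring.
have ea1 : 1 <= expR a by rewrite -expR0 ler_expR.
have a2 : a ^+ 2 <= 2 * (expR a * expR a).
  by apply: (le_trans (sqr_exp_le a0)); rewrite ler_pM2l// ler_peMr ?expR_ge0.
have a2e : a ^+ 2 * expR a <= 2 * (expR a * expR a).
  by rewrite mulrA ler_wpM2r ?expR_ge0//; exact: sqr_exp_le.
set T := 2 * F h - F (k^-1 * h)%g + (2 * F k - F (h^-1 * k)%g) in main.
(* The drifts at [h] and [k] enter twice and contribute together at most [2 dl a^2]; those at
   [k^-1 h] and [h^-1 k] contribute [dl a^2] each. With the factor 1/2, [dl = 2 C N s] and
   [a^2 <= 2 e^(2 a)], this yields the coefficient 8. *)
have Tle : `|T - (2 * eta h + 2 * eta k)| <= 4 * (dl * a ^+ 2).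
  by apply/ler_normlP; split; rewrite /T; lra.
have lT : lambda * T <= lambda * (2 * eta h + 2 * eta k) + `|lambda| * (4 * (dl * a ^+ 2)).
  have := ler_wpM2l (normr_ge0 lambda) Tle; rewrite -normrM mulrBr => /ler_normlP[_]; lra.
have lT2 : `|lambda| * (dl * a ^+ 2) <= `|lambda| * (dl * (2 * (expR a * expR a))).
  by rewrite ler_wpM2l// ler_wpM2l.
have lN : N ^+ 2 * lambda ^+ 2 * (a ^+ 2 * expR a) <= N ^+ 2 * lambda ^+ 2 * (2 * (expR a * expR a)).
  by rewrite ler_wpM2l// mulr_ge0 ?sqr_ge0.
rewrite QQ; move: main lT lT2 lN; rewrite /dl -/S -/a.
set E := expR a * expR a.
rewrite -!mulrA -/S.
set LT := lambda * T; set L := `|lambda|.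
nra.
Qed.

(** After integration the homomorphism is gone and [I + Q / 2 <= N^2 + B p^2], with [Q] the energy.
    The part of [B] linear in [|lambda|] contains [sqrt (C1 Q)], and [Q / 2] absorbs it at the price
    of a multiple of [lambda^2 N^2]. *)
Lemma step_small :
  (\int[mu]_h \int[mu]_k (K h * K k * step_corr h k)%:E <=
   (N ^+ 2 * (1 + (2 * p0 ^+ 2 + 32 * C ^+ 2 * p0 ^+ 4 * C1) * lambda ^+ 2))%:E)%E.
Proof.
have sf := haar_sigma_finite hmu hG hU.
set I := (X in (X <= _)%E).
have E0 : (0 <= shift_energy mu U phi K)%E.
  by apply: integral_ge0 => h _; apply: integral_ge0 => k _; rewrite lee_fin energy_ge0.
have Efin : shift_energy mu U phi K \is a fin_num.
  by rewrite ge0_fin_numE//; apply: le_lt_trans shift_energy_bound _; rewrite ltry.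
pose Q := fine (shift_energy mu U phi K).
have Q0 : 0 <= Q by exact: fine_ge0.
have QE : shift_energy mu U phi K = Q%:E by rewrite fineK.
have [|eta ha le] := step_corr_bound Q0; first by rewrite QE.
set B := 2 * N ^+ 2 * lambda ^+ 2 + _ in le.
have dbl := kernel_double hmu hG hU htheta c0 b0 hK (N ^+ 2) lambda B ha.
pose f1 (z : borel G * borel G) := (K z.1 * K z.2 * step_corr z.1 z.2)%:E.
pose f2 (z : borel G * borel G) := (K z.1 * K z.2 * expR (- (rho z.1 + rho z.2)) * D ((z.1 : G)^-1 * z.2)%g ^+ 2)%:E.
pose f3 (z : borel G * borel G) := (K z.1 * K z.2 * (N ^+ 2 + lambda * eta z.1 + lambda * eta z.2 + B * (expR (2 * rho z.1) * expR (2 * rho z.2))))%:E.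
have f10 z : (0 <= f1 z)%E by rewrite lee_fin mulr_ge0 ?step_corr_ge0// mulr_ge0 ?K0.
have f20 z : (0 <= f2 z)%E by rewrite lee_fin energy_ge0.
have mf1 : measurable_fun setT f1 by exact: measurable_corr.
have mf2 : measurable_fun setT f2 by exact: measurable_energy.
have f123 z : (f1 z + 2^-1%:E * f2 z <= f3 z)%E.
  rewrite -EFinM -EFinD lee_fin.
  have := ler_wpM2l (mulr_ge0 (K0 z.1) (K0 z.2)) (le z.1 z.2).
  by apply: le_trans; rewrite le_eqVlt; apply/orP; left; apply/eqP; ring.
have f30 z : (0 <= f3 z)%E by apply: le_trans (f123 z); rewrite adde_ge0// mule_ge0.
have mf3 : measurable_fun setT f3.
  have mr : meas rho by exact: measurable_rho.
  have mK := kernel_meas hK.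
  have me : meas eta by apply: continuous_borel; case: ha.
  have mQ : meas (fun g => expR (2 * rho g)) by apply: measurableT_comp => //; exact: measurable_funM.
  apply/measurable_EFinP; apply: measurable_funM.
    by apply: measurable_funM; [exact: (measurableT_comp mK measurable_fst)|exact: (measurableT_comp mK measurable_snd)].
  apply: measurable_funD.
    apply: measurable_funD.
      apply: measurable_funD => //; apply: measurable_funM => //.
      exact: (measurableT_comp me measurable_fst).
    by apply: measurable_funM => //; exact: (measurableT_comp me measurable_snd).
  apply: measurable_funM => //.
  by apply: measurable_funM; [exact: (measurableT_comp mQ measurable_fst)|exact: (measurableT_comp mQ measurable_snd)].
have slice f h : measurable_fun setT f -> measurable_fun [set: borel G] (fun k : borel G => f ((h : borel G), k) : \bar R).
  by move=> mf; exact: (measurableT_comp mf (pair1_measurable (h : borel G))).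
have m2 f : measurable_fun setT f -> (forall z, 0 <= f z)%E -> measurable_fun [set: borel G] (fun h : borel G => \int[mu]_k f (h, k))%E.
  exact: (@measurable_integral2 _ _ (borel G) (borel G) R mu f sf).
have main : (I + 2^-1%:E * shift_energy mu U phi K <= (N ^+ 2 + B * p ^+ 2)%:E)%E.
  rewrite -dbl /I /shift_energy.
  rewrite -ge0_integralZl ?lee_fin//; last 2 first.
  - exact: (m2 f2).
  - by move=> h _; apply: integral_ge0 => k _; exact: (f20 (h, k)).
  rewrite -ge0_integralD//; last 4 first.
  - by move=> h _; apply: integral_ge0 => k _; exact: (f10 (h, k)).
  - exact: (m2 f1).
  - by move=> h _; apply: mule_ge0 => //; apply: integral_ge0 => k _; exact: (f20 (h, k)).
  - by apply: measurable_funeM; exact: (m2 f2).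
  have inner h : (\int[mu]_k f1 ((h : borel G), k) + 2^-1%:E * \int[mu]_k f2 (h, k) <= \int[mu]_k f3 (h, k))%E.
    rewrite -ge0_integralZl ?lee_fin//; last exact: (slice f2).
    rewrite -ge0_integralD//; last 3 first.
    - exact: (slice f1).
    - by move=> k _; rewrite mule_ge0.
    - by apply: measurable_funeM; exact: (slice f2).
    apply: ge0_le_integral.
    - exact: measurableT.
    - by move=> k _; rewrite adde_ge0// mule_ge0.
    - by apply: emeasurable_funD; [exact: (slice f1)|apply: measurable_funeM; exact: (slice f2)].
    - exact: (slice f3).
    - by move=> k _; exact: f123.
  apply: ge0_le_integral.
  - exact: measurableT.
  - move=> h _; apply: adde_ge0; first by apply: integral_ge0 => k _; exact: (f10 (h, k)).
    by apply: mule_ge0 => //; apply: integral_ge0 => k _; exact: (f20 (h, k)).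
  - by apply: emeasurable_funD; [exact: (m2 f1)|apply: measurable_funeM; exact: (m2 f2)].
  - exact: (m2 f3).
  - by move=> h _; exact: inner.
have I0 : (0 <= I)%E by apply: integral_ge0 => h _; apply: integral_ge0 => k _; exact: (f10 (h, k)).
have Ifin : I \is a fin_num.
  rewrite ge0_fin_numE//; apply: (@le_lt_trans _ _ (N ^+ 2 + B * p ^+ 2)%:E); last exact: ltry.
  by apply: le_trans main; rewrite leeDl// mule_ge0.
move: main; rewrite -(fineK Ifin) QE -EFinM -EFinD !lee_fin.
have N0 : 0 <= N by exact: norm2_ge0.
have p_ge0 : 0 <= p by apply: Rintegral_ge0 => g _; rewrite mulr_ge0 ?K0 ?expR_ge0.
have p00 : 0 <= p0 by exact: le_trans p_le.
have s2 : Num.sqrt (C1 * Q) ^+ 2 = C1 * Q by rewrite sqr_sqrtr// mulr_ge0.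
have s0 := sqrtr_ge0 (C1 * Q).
have B0 : 0 <= B.
  apply: addr_ge0; first by rewrite mulr_ge0 ?sqr_ge0// mulr_ge0 ?sqr_ge0.
  by rewrite mulr_ge0 ?sqrtr_ge0// mulr_ge0 ?N0// mulr_ge0// mulr_ge0.
have pp2 : p ^+ 2 <= p0 ^+ 2 by rewrite ler_pXn2r.
have pp : B * p ^+ 2 <= B * p0 ^+ 2 by exact: ler_wpM2l.
have L2 : `|lambda| ^+ 2 = lambda ^+ 2 by rewrite real_normK ?num_real.
move: s2 s0 pp; rewrite /B -L2; set s := Num.sqrt _; move: (`|lambda|) => L s2 s0 pp main.
(* When [C1 * Q = 0] there is nothing to absorb, and [C1] could be zero; otherwise division by [C1]
   is allowed. *)
have [Q00|Qn0] := eqVneq (C1 * Q) 0.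
  have s00 : s = 0 by apply/eqP; rewrite -sqrf_eq0 s2 Q00.
  have h1 : 0 <= C ^+ 2 * p0 ^+ 4 * C1 * (L ^+ 2 * N ^+ 2).
    apply: mulr_ge0; last by rewrite mulr_ge0 ?sqr_ge0.
    by rewrite mulr_ge0// mulr_ge0 ?sqr_ge0// exprn_ge0.
  by move: pp main; rewrite s00; lra.
have C1p : 0 < C1.
  by rewrite lt_neqAle C1_ge0 andbT eq_sym; apply: contra_neq Qn0 => ->; rewrite mul0r.
(* [8 C p0^2 L N s <= s^2 / (2 C1) + 32 C1 (C p0^2 L N)^2] with [s^2 = C1 Q] *)
have amgm := sqr_ge0 (s - 8 * C1 * (C * p0 ^+ 2 * L * N)).
have Qs : Q = s ^+ 2 / C1 by rewrite s2 mulrC mulKf// gt_eqF.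
have {}amgm : 0 <= 2^-1 / C1 * (s - 8 * C1 * (C * p0 ^+ 2 * L * N)) ^+ 2.
  by rewrite mulr_ge0// divr_ge0// ltW.
rewrite (_ : _ * _ = 2^-1 * (s ^+ 2 / C1) - 8 * C * L * N * s * p0 ^+ 2 + 32 * C ^+ 2 * p0 ^+ 4 * C1 * (L ^+ 2 * N ^+ 2)) in amgm; last first.
  by field; rewrite gt_eqF.
by rewrite -Qs in amgm; lra.
Qed.

End Small.
End Fixed.

Theorem one_step (W : set G) (e : R) : nbhs (1%g : G) W -> 0 < e ->
  exists2 omega : R, 0 < omega &
    forall K phi psi : G -> R, gaussian_kernel K -> (forall g, W g -> e <= K g) ->
      square_integrable mu (phi : borel G -> R) -> (forall x, 0 <= phi x) ->
      meas psi ->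
      (forall u, U u -> {ae mu, forall x : borel G, `|psi (u^-1 * x)%g - psi x| <= 1}) ->
      forall lambda : R,
      (\int[mu]_x ((\int[mu]_h (step_fun K phi psi lambda (h, x))%:E) *
                   (\int[mu]_h (step_fun K phi psi lambda (h, x))%:E)) <=
       (expR (2 * omega * lambda ^+ 2) * norm2 mu (phi : borel G -> R) ^+ 2)%:E)%E.
Proof.
move=> nW e0.
have [C1 C10 HC1] := shift_energy_lower sc hmu hG hU nW e0.
have [C C0 HC] := quasi_additive_stable R hG hU.
have [C3 C31 HC3] := exp_moment hmu hG hU c0 b0.
pose p0 := C3 * expR (2 ^+ 2 / (2 * b)).
have C30 : 0 < C3 by exact: lt_le_trans C31.
have lnC3 : 0 <= ln C3 by rewrite ln_ge0.
pose m := 2 * p0 ^+ 2 + 32 * C ^+ 2 * p0 ^+ 4 * C1.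
have m0 : 0 <= m.
  apply: addr_ge0; first by rewrite mulr_ge0// sqr_ge0.
  by rewrite mulr_ge0 ?(ltW C10)// mulr_ge0 ?exprn_even_ge0// mulr_ge0 ?sqr_ge0.
have b1 : 0 < b^-1 by rewrite invr_gt0.
(* [m] is the coefficient of [lambda^2] in [step_small]. For [|lambda| > 1], squaring
   [C3 e^(lambda^2 / (2 b))] asks for [2 ln C3 + 1 / b] in [2 omega]. *)
exists (m + ln C3 + b^-1); first by rewrite ltr_wpDl// addr_ge0.
move=> K phi psi hK We phi2 phi0 mpsi psi_lip lambda.
have mK := kernel_meas hK; have K0 := kernel_ge0 hK; have Kb := kernel_bound hK.
rewrite integral_step_fun_sqr//.
have N2 : 0 <= norm2 mu (phi : borel G -> R) ^+ 2 by exact: sqr_ge0.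
have [l1|l1] := leP `|lambda| 1.
  have pl : \int[mu]_g (K g * expR (2 * rho g)) <= p0 by have [] := HC3 K mK K0 Kb 2.
  apply: (le_trans (@step_small K phi psi hK phi2 phi0 mpsi psi_lip lambda C C1 p0 (ltW C0) (ltW C10) HC _ pl l1)).
    by move=> Q HQ u Uu; exact: (HC1 K phi Q mK K0 We phi2 HQ u Uu).
  rewrite lee_fin mulrC ler_wpM2r//; apply: (le_trans (expR_ge1Dx _)); rewrite ler_expR.
  rewrite ler_wpM2r ?sqr_ge0// -/m; lra.
apply: (le_trans (@step_large K phi psi hK phi2 phi0 mpsi psi_lip lambda)).
have [_ pl] := HC3 K mK K0 Kb `|lambda|.
rewrite lee_fin ler_wpM2r//.
have p_ge0 : 0 <= \int[mu]_g (K g * expR (`|lambda| * rho g)).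
  by apply: Rintegral_ge0 => g _; rewrite mulr_ge0 ?K0 ?expR_ge0.
apply: (@le_trans _ _ ((C3 * expR (`|lambda| ^+ 2 / (2 * b))) ^+ 2)).
  by rewrite ler_pXn2r// nnegrE ?mulr_ge0 ?expR_ge0// ltW.
rewrite -{1}[C3]lnK ?posrE// -expRD -expRM_natl ler_expR real_normK ?num_real//.
have l2 : 1 <= lambda ^+ 2.
  by rewrite -(real_normK (num_real lambda)) expr_ge1// ltW.
rewrite (_ : 2 * (ln C3 + lambda ^+ 2 / (2 * b)) = 2 * ln C3 * 1 + b^-1 * lambda ^+ 2); last first.
  by field; rewrite gt_eqF.
have h1 : ln C3 * 1 <= ln C3 * lambda ^+ 2 by rewrite ler_wpM2l.
have h2 : 0 <= m * lambda ^+ 2 by rewrite mulr_ge0// sqr_ge0.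
have h3 : 0 <= b^-1 * lambda ^+ 2 by rewrite mulr_ge0 ?sqr_ge0// ltW.
by lra.
Qed.

End OneStep.

(** * Complex functions and iteration *)

Section L2norm.
Context (R : realType) (G : topGroupType).
Variable mu : {measure set (borel G) -> \bar R}.
Implicit Types f : G -> R[i].

Definition modulus f (x : G) : R := Normc.normc (f x).

Lemma modulus_ge0 f x : 0 <= modulus f x.
Proof. by rewrite /modulus /Normc.normc; case: (f x) => a b; exact: sqrtr_ge0. Qed.

Lemma modulusE f x :
  modulus f x = Num.sqrt (complex.Re (f x) ^+ 2 + complex.Im (f x) ^+ 2).
Proof. by rewrite /modulus; case: (f x). Qed.

Lemma measurable_modulus f :
  measurable_fun [set: borel G] (fun x : borel G => complex.Re (f x)) ->
  measurable_fun [set: borel G] (fun x : borel G => complex.Im (f x)) ->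
  measurable_fun [set: borel G] (modulus f : borel G -> R).
Proof.
move=> mre mim; rewrite (_ : modulus f = fun x => (complex.Re (f x) ^+ 2 + complex.Im (f x) ^+ 2) `^ 2^-1).
  have mS : measurable_fun [set: borel G] (fun x : borel G => complex.Re (f x) ^+ 2 + complex.Im (f x) ^+ 2).
    by apply: measurable_funD; exact: measurable_funX.
  exact: (measurableT_comp (measurable_powR 2^-1) mS).
by apply/funext => x; rewrite powR12_sqrt ?addr_ge0 ?sqr_ge0// modulusE.
Qed.

Lemma L2normE f : L2norm mu f = ((\int[mu]_x (modulus f x ^+ 2)%:E) `^ 2^-1)%E.
Proof.
rewrite /L2norm unlock; congr (_ `^ _)%E; apply: eq_integral => x _.
by rewrite poweR_EFin /= ger0_norm ?(modulus_ge0 f)// powR_mulrn ?(modulus_ge0 f).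
Qed.

Lemma L2norm_norm2 f : square_integrable mu (modulus f : borel G -> R) ->
  L2norm mu f = (norm2 mu (modulus f : borel G -> R))%:E.
Proof.
move=> f2; rewrite L2normE integral_sqr// poweR_EFin; congr _%:E.
by rewrite powR12_sqrt ?sqr_ge0// sqrtr_sqr ger0_norm ?norm2_ge0.
Qed.

Lemma inL2_square_integrable f : inL2 mu f -> square_integrable mu (modulus f : borel G -> R).
Proof.
move=> [mre mim]; rewrite L2normE => lt; apply: square_integrableP.
  exact: measurable_modulus.
rewrite ltNge leye_eq; apply/negP => /eqP E; move: lt.
by rewrite E poweRyr ?ltxx// gt_eqF.
Qed.

End L2norm.

Section ComplexStep.
Variables (R : realType) (G : topGroupType).
Hypothesis sc : @second_countable G.
Variable mu : {measure set (borel G) -> \bar R}.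
Hypothesis sf : sigma_finite setT mu.
Local Notation meas f := (measurable_fun [set: borel G] (f : borel G -> R)).

Lemma measurable_conv_kernel (K f : G -> R) : meas K -> meas f ->
  measurable_fun [set: borel G * borel G]
    (fun z : borel G * borel G => (K z.2 * f ((z.2 : G)^-1 * (z.1 : G))%g)%:E).
Proof.
move=> mK mf; apply/measurable_EFinP.
apply: measurable_funM; first exact: (measurableT_comp mK measurable_snd).
exact: (measurableT_comp (measurable_shift2 sc mf) (measurable_swap (T1 := borel G) (T2 := borel G))).
Qed.

Lemma measurable_convolution (K f : G -> R) : meas K -> meas f ->
  meas (convolution mu K f).
Proof.
move=> mK mf; rewrite /convolution /Rintegral.
pose g (z : borel G * borel G) := (K z.2 * f ((z.2 : G)^-1 * (z.1 : G))%g)%:E.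
have mg : measurable_fun setT g by exact: measurable_conv_kernel.
apply: measurableT_comp => //.
rewrite (_ : (fun x : borel G => _) = (fun x : borel G => \int[mu]_h g^\+ (x, h) - \int[mu]_h g^\- (x, h))%E).
  apply: emeasurable_funB.
    apply: (@measurable_integral2 _ _ (borel G) (borel G) R mu (g^\+)%E sf) => [|z]; last exact: funepos_ge0.
    exact: measurable_funepos.
  apply: (@measurable_integral2 _ _ (borel G) (borel G) R mu (g^\-)%E sf) => [|z]; last exact: funeneg_ge0.
  exact: measurable_funeneg.
apply/funext => x; rewrite integralE; congr (_ - _)%E.
  by apply: eq_integral => h _; rewrite !funeposE.
by apply: eq_integral => h _; rewrite !funenegE.
Qed.

Lemma measurable_conv_integrand (K f : G -> R) (x : G) : meas K -> meas f ->
  meas (fun h => K h * f (h^-1 * x)%g).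
Proof.
move=> mK mf; apply: measurable_funM => //.
exact: (measurableT_comp (measurable_shift2 sc mf) (pair2_measurable (x : borel G))).
Qed.

Lemma cauchy_schwarz_plane (a b u v : R) :
  u * a + v * b <= Num.sqrt (u ^+ 2 + v ^+ 2) * Num.sqrt (a ^+ 2 + b ^+ 2).
Proof.
rewrite -sqrtrM ?addr_ge0 ?sqr_ge0//.
apply: (le_trans (ler_norm _)); rewrite -sqrtr_sqr ler_wsqrtr//.
have := sqr_ge0 (u * b - v * a); nra.
Qed.

Section Modulus.
Variables (K : G -> R) (f : G -> R[i]) (x : G).
Hypothesis mK : meas K.
Hypothesis K0 : forall g, 0 <= K g.
Hypothesis mre : meas (fun x => complex.Re (f x)).
Hypothesis mim : meas (fun x => complex.Im (f x)).
Hypothesis fin : (\int[mu]_h (K h * modulus f (h^-1 * x)%g)%:E < +oo)%E.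
Local Notation int f := (mu.-integrable [set: borel G] (EFin \o (f : borel G -> R))).

Lemma conv_modulus_int : int (fun h => K h * modulus f (h^-1 * x)%g).
Proof.
apply/integrableP; split.
  by apply/measurable_EFinP; apply: measurable_conv_integrand => //; exact: measurable_modulus.
by under eq_integral do rewrite gee0_abs ?lee_fin ?mulr_ge0 ?K0 ?modulus_ge0//.
Qed.

Lemma conv_Re_int : int (fun h => K h * complex.Re (f (h^-1 * x)%g)).
Proof.
apply: (integrable_le _ conv_modulus_int); first exact: (@measurable_conv_integrand K (fun x => complex.Re (f x)) x).
move=> h; rewrite normrM ger0_norm ?K0// ler_wpM2l ?K0// modulusE -sqrtr_sqr.
by rewrite ler_wsqrtr// lerDl sqr_ge0.
Qed.

Lemma conv_Im_int : int (fun h => K h * complex.Im (f (h^-1 * x)%g)).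
Proof.
apply: (integrable_le _ conv_modulus_int); first exact: (@measurable_conv_integrand K (fun x => complex.Im (f x)) x).
move=> h; rewrite normrM ger0_norm ?K0// ler_wpM2l ?K0// modulusE -sqrtr_sqr.
by rewrite ler_wsqrtr// lerDr sqr_ge0.
Qed.

(** Pairing the complex number [(u, v)] with itself writes [n ^+ 2] as one real integral, whose
    integrand is at most [n] times [K] times the modulus; then divide by [n]. *)
Lemma modulus_cconvolution_fin :
  modulus (cconvolution mu K f) x <= \int[mu]_h (K h * modulus f (h^-1 * x)%g).
Proof.
rewrite modulusE /= /convolution.
have i1 := conv_Re_int; have i2 := conv_Im_int; have i0 := conv_modulus_int.
set u := Rintegral _ _ _; set v := Rintegral _ _ _; set n := Num.sqrt _.
have n0 : 0 <= n by exact: sqrtr_ge0.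
have n2 : n ^+ 2 = u ^+ 2 + v ^+ 2 by rewrite sqr_sqrtr// addr_ge0 ?sqr_ge0.
have [->|nn0] := eqVneq n 0.
  by apply: Rintegral_ge0 => h _; rewrite mulr_ge0 ?K0 ?modulus_ge0.
have n_gt0 : 0 < n by rewrite lt_neqAle eq_sym nn0.
rewrite -(ler_pM2l n_gt0) -expr2 n2.
have -> : u ^+ 2 + v ^+ 2 = \int[mu]_h (u * (K h * complex.Re (f (h^-1 * x)%g)) + v * (K h * complex.Im (f (h^-1 * x)%g))).
  by rewrite Rintegral_lin// -/u -/v !expr2.
rewrite -RintegralZl//.
apply: le_Rintegral_ae; first exact: integrable_lin.
  have := integrable_lin n 0 i0 i0.
  by under [X in mu.-integrable _ (EFin \o X) -> _]eq_fun do rewrite mul0r addr0.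
apply: aeW => h; rewrite modulusE.
have := ler_wpM2l (K0 h) (cauchy_schwarz_plane (complex.Re (f (h^-1 * x)%g)) (complex.Im (f (h^-1 * x)%g)) u v).
by rewrite -/n; move: (Num.sqrt (_ + _)) => w; lra.
Qed.

End Modulus.

Lemma modulus_cconvolution (K : G -> R) (f : G -> R[i]) (x : G) :
  meas K -> (forall g, 0 <= K g) ->
  meas (fun x => complex.Re (f x)) -> meas (fun x => complex.Im (f x)) ->
  ((modulus (cconvolution mu K f) x)%:E <= \int[mu]_h (K h * modulus f (h^-1 * x)%g)%:E)%E.
Proof.
move=> mK K0 mre mim.
have [fin|] := ltP (\int[mu]_h (K h * modulus f (h^-1 * x)%g)%:E)%E +oo%E; last by rewrite leye_eq => /eqP ->; rewrite leey.
rewrite -RintegralE; last exact: conv_modulus_int.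
by rewrite lee_fin; exact: modulus_cconvolution_fin.
Qed.

End ComplexStep.

Section Iteration.
Variables (R : realType) (G : topGroupType).
Hypothesis sc : @second_countable G.
Variable mu : {measure set (borel G) -> \bar R}.
Hypothesis hmu : left_haar_measure mu.
Variable U : set G.
Hypothesis hG : connected [set: G].
Hypothesis hU : admissible_nbhd U.
Local Notation rho := (rho R U).
Local Notation int f := (mu.-integrable [set: borel G] (EFin \o (f : borel G -> R))).
Local Notation meas f := (measurable_fun [set: borel G] (f : borel G -> R)).
Local Notation L2 f := (square_integrable mu (f : borel G -> R)).
Local Notation N f := (norm2 mu (f : borel G -> R)).

(** The null set may depend on [u], since the L^oo norm in [class_E] ignores null sets. *)
Definition almost_lipschitz (psi : G -> R) : Prop :=
  forall u, U u -> {ae mu, forall x : borel G, `|psi (u^-1 * x)%g - psi x| <= 1}.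

Lemma class_E_lipschitz psi : class_E mu U psi -> almost_lipschitz psi.
Proof.
move=> [mpsi _ sup1] u Uu.
have [mu0 _ _] := hmu.
have le1 : (Lnorm mu +oo (fun h : borel G => (psi (u^-1 * (h : G))%g - psi h)%:E) <= 1)%E.
  by apply: le_trans sup1; apply: ereal_sup_ubound; exists u.
(* The norm at [+oo] is the essential supremum because [mu] is not the zero measure. *)
move: le1; rewrite unlock lt0e mu0 measure_ge0 /=.
by move=> /ess_supP; apply: filterS => x /=; rewrite lee_fin.
Qed.

Lemma rho_lipschitz : almost_lipschitz rho.
Proof.
move=> u Uu; apply: aeW => x; rewrite ler_distl; apply/andP; split.
  have := rhoM R hG hU u (u^-1 * x)%g; rewrite mulgA mulgV mul1g (rhoU R hG hU Uu); lra.
have := rhoM R hG hU u^-1%g x; rewrite (rhoV R hG hU) (rhoU R hG hU Uu); lra.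
Qed.

(** The conclusion of [one_step] as a property of a single kernel: all that the iteration has to
    know about centering and the lower bound. *)
Definition step_growth (omega : R) (K : G -> R) : Prop :=
  forall phi psi : G -> R, L2 phi -> (forall x, 0 <= phi x) -> meas psi ->
    almost_lipschitz psi -> forall lambda : R,
      (\int[mu]_x ((\int[mu]_h (step_fun K phi psi lambda (h, x))%:E) *
                   (\int[mu]_h (step_fun K phi psi lambda (h, x))%:E)) <=
       (expR (2 * omega * lambda ^+ 2) * N phi ^+ 2)%:E)%E.

Section Step.
Variables (omega : R) (K f psi : G -> R) (lambda : R).
Hypothesis mK : meas K.
Hypothesis K0 : forall g, 0 <= K g.
Hypothesis hK : step_growth omega K.
Hypothesis mf : meas f.
Hypothesis f0 : forall g, 0 <= f g.
Hypothesis mpsi : meas psi.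
Hypothesis psi_lip : almost_lipschitz psi.
Let w (x : G) := expR (lambda * psi x).
Hypothesis wf2 : L2 (fun x => w x * f x).
Local Notation A x := (\int[mu]_h (K h * f (h^-1 * x)%g)%:E)%E.

Lemma measurable_weight : meas w.
Proof. by apply: measurableT_comp => //; exact: measurable_funM. Qed.

Lemma conv_term_ge0 x (h : G) : (0 <= (K h * f (h^-1 * x)%g)%:E)%E.
Proof. by rewrite lee_fin mulr_ge0. Qed.

(** Choosing [phi = w f] cancels the inner weight, so the average of the weighted shifts is the
    weighted convolution of [f] itself. *)
Lemma integral_step_fun x :
  (\int[mu]_h (step_fun K (fun y => w y * f y)  psi lambda (h, x))%:E = (w x)%:E * A x)%E.
Proof.
rewrite -ge0_integralZl_EFin//; last 3 first.
- by move=> h _; exact: conv_term_ge0.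
- by apply/measurable_EFinP; exact: measurable_conv_integrand.
- exact: expR_ge0.
apply: eq_integral => h _; rewrite -EFinM; congr _%:E.
rewrite /step_fun /weighted_shift /= /w mulrBr expRB.
by field; rewrite gt_eqF ?expR_gt0.
Qed.

Lemma measurable_conv_ge0 : measurable_fun [set: borel G] (fun x : borel G => A x).
Proof.
have sf := haar_sigma_finite hmu hG hU.
apply: (@measurable_integral2 _ _ (borel G) (borel G) R mu
  (fun z : borel G * borel G => (K z.2 * f ((z.2 : G)^-1 * (z.1 : G))%g)%:E) sf).
  exact: measurable_conv_kernel.
by move=> z; exact: conv_term_ge0.
Qed.

Let S (x : borel G) := ((w x)%:E * A x)%E.

Let mS : measurable_fun setT S.
Proof.
apply: emeasurable_funM; last exact: measurable_conv_ge0.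
by apply/measurable_EFinP; exact: measurable_weight.
Qed.

Let S0 x : (0 <= S x)%E.
Proof.
by apply: mule_ge0; [rewrite lee_fin expR_ge0|apply: integral_ge0 => h _; exact: conv_term_ge0].
Qed.

Let SS : (\int[mu]_x (S x * S x) <= (expR (2 * omega * lambda ^+ 2) * N (fun x => w x * f x) ^+ 2)%:E)%E.
Proof.
have := hK wf2 (fun x => mulr_ge0 (expR_ge0 _) (f0 x)) mpsi psi_lip lambda.
by under eq_integral do rewrite integral_step_fun.
Qed.

Let mSS : measurable_fun setT (fun x => S x * S x)%E.
Proof. exact: emeasurable_funM. Qed.

(** A square-integrable function is finite almost everywhere and the weight is positive. This yields
    the convergence required of each convolution. *)
Lemma conv_finite_ae : {ae mu, forall x : borel G, (A x < +oo)%E}.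
Proof.
have iSS : mu.-integrable setT (fun x => S x * S x)%E.
  apply/integrableP; split => //.
  rewrite (eq_integral (fun x => S x * S x)%E) => [|x _]; last by rewrite gee0_abs// mule_ge0.
  by apply: le_lt_trans SS _; rewrite ltry.
have := integrable_ae measurableT iSS; apply: filterS => x /(_ I) fin.
rewrite ltNge leye_eq; apply/negP => /eqP Ax.
by move: fin; rewrite /S Ax gt0_muley ?lte_fin ?expR_gt0//.
Qed.

(** Allowing any [g] below the convolution covers both the modulus of a complex convolution and a
    real convolution, which is 0 where the integral diverges. *)
Lemma weighted_conv_bound (g : G -> R) : meas g -> (forall x, 0 <= g x) ->
  (forall x, ((g x)%:E <= A x)%E) ->
  L2 (fun x => w x * g x) /\
  N (fun x => w x * g x) ^+ 2 <= expR (2 * omega * lambda ^+ 2) * N (fun x => w x * f x) ^+ 2.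
Proof.
move=> mg g0 gA.
have mwg : meas (fun x => w x * g x) by apply: measurable_funM => //; exact: measurable_weight.
have wg0 x : 0 <= w x * g x by rewrite mulr_ge0 ?expR_ge0.
have le : (\int[mu]_x ((w x * g x) ^+ 2)%:E <= (expR (2 * omega * lambda ^+ 2) * N (fun x => (w x * f x)%R) ^+ 2)%:E)%E.
  apply: le_trans SS; apply: ge0_le_integral => //.
  - by move=> x _; rewrite lee_fin sqr_ge0.
  - by apply/measurable_EFinP; exact: measurable_funX.
  move=> x _; rewrite expr2 EFinM.
  have wgS : ((w x * g x)%:E <= S x)%E by rewrite EFinM lee_wpmul2l ?lee_fin ?expR_ge0.
  by apply: lee_pmul => //; rewrite lee_fin.
have L2wg : L2 (fun x => w x * g x).
  by apply: square_integrableP => //; apply: le_lt_trans le _; rewrite ltry.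
by split => //; move: le; rewrite integral_sqr// lee_fin.
Qed.

End Step.

End Iteration.

Section Products.
Variables (R : realType) (G : topGroupType).
Hypothesis sc : @second_countable G.
Variable mu : {measure set (borel G) -> \bar R}.
Hypothesis hmu : left_haar_measure mu.
Variable U : set G.
Hypothesis hG : connected [set: G].
Hypothesis hU : admissible_nbhd U.
Variable omega : R.
Variable K : nat -> G -> R.
Local Notation rho := (rho R U).
Local Notation int f := (mu.-integrable [set: borel G] (EFin \o (f : borel G -> R))).
Local Notation meas f := (measurable_fun [set: borel G] (f : borel G -> R)).
Local Notation L2 f := (square_integrable mu (f : borel G -> R)).
Local Notation N f := (norm2 mu (f : borel G -> R)).
Hypothesis mK : forall n, (0 < n)%N -> meas (K n).
Hypothesis K0 : forall n, (0 < n)%N -> forall g, 0 <= K n g.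
Hypothesis hK : forall n, (0 < n)%N -> step_growth mu U omega (K n).

Lemma modulus_exp_weight (lambda : R) (psi : G -> R) (f : G -> R[i]) x :
  modulus (exp_weight lambda psi f) x = expR (lambda * psi x) * modulus f x.
Proof.
rewrite /modulus /exp_weight; case: (f x) => a b.
rewrite /Normc.normc /= !mul0r subr0 addr0 !exprMn -mulrDr sqrtrM ?sqr_ge0//.
by rewrite sqrtr_sqr ger0_norm ?expR_ge0.
Qed.

Lemma measurable_exp_weight (lambda : R) (psi : G -> R) (f : G -> R[i]) :
  meas psi -> meas (fun x => complex.Re (f x)) -> meas (fun x => complex.Im (f x)) ->
  meas (fun x => complex.Re (exp_weight lambda psi f x)) /\
  meas (fun x => complex.Im (exp_weight lambda psi f x)).
Proof.
move=> mpsi mre mim; have mw := measurable_weight lambda mpsi; split.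
  rewrite (_ : (fun x => _) = fun x => expR (lambda * psi x) * complex.Re (f x)).
    exact: measurable_funM.
  by apply/funext => x; rewrite /exp_weight; case: (f x) => a b /=; rewrite mul0r subr0.
rewrite (_ : (fun x => _) = fun x => expR (lambda * psi x) * complex.Im (f x)).
  exact: measurable_funM.
by apply/funext => x; rewrite /exp_weight; case: (f x) => a b /=; rewrite mul0r addr0.
Qed.

(** Only an inequality, since the real-valued integral takes the value 0 where the extended one is
    infinite. *)
Lemma convolution_le (f1 f2 : G -> R) x :
  (forall g, 0 <= f1 g) -> (forall g, 0 <= f2 g) ->
  ((convolution mu f1 f2 x)%:E <= \int[mu]_h (f1 h * f2 (h^-1 * x)%g)%:E)%E.
Proof.
move=> f10 f20; rewrite /convolution /Rintegral.
have : (0 <= \int[mu]_h (f1 h * f2 (h^-1 * x)%g)%:E)%E.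
  by apply: integral_ge0 => h _; rewrite lee_fin mulr_ge0.
by case: (\int[mu]_h _)%E => [r||]//= _; rewrite ?leey.
Qed.

Section Complex.
Variables (psi : G -> R) (lambda : R) (f : G -> R[i]) (m : nat).
Hypothesis mpsi : meas psi.
Hypothesis psi_lip : almost_lipschitz mu U psi.
Hypothesis hf : inL2 mu f.
Local Notation F n := (Tprod mu K m n (exp_weight (- lambda) psi f)).

(** The weights between consecutive factors cancel, so the induction follows [F n] under the single
    weight [e^(lambda psi)]. Convergence has to be part of it: each stage is defined almost
    everywhere because the previous one is square-integrable with the weight. *)
Lemma weighted_Tprod n :
  [/\ Tprod_defined mu K m n (exp_weight (- lambda) psi f),
      meas (fun x => complex.Re (F n x)), meas (fun x => complex.Im (F n x)),
      L2 (modulus (exp_weight lambda psi (F n))) &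
      N (modulus (exp_weight lambda psi (F n))) ^+ 2 <=
        expR (2 * omega * lambda ^+ 2) ^+ n * N (modulus f) ^+ 2].
Proof.
have [mre mim _] := hf.
have sf := haar_sigma_finite hmu hG hU.
elim: n => [|n [dF mreF mimF L2F NF]].
  have [? ?] := measurable_exp_weight (- lambda) mpsi mre mim.
  have E : modulus (exp_weight lambda psi (F 0)) = modulus f.
    apply/funext => x /=; rewrite !modulus_exp_weight mulrA -expRD.
    by rewrite mulNr addrN expR0 mul1r.
  by rewrite E expr0 mul1r; split => //; exact: inL2_square_integrable.
have n0 : (0 < m + n.+1)%N by rewrite addnS.
have mF := measurable_modulus mreF mimF.
have E : modulus (exp_weight lambda psi (F n)) = fun x => expR (lambda * psi x) * modulus (F n) x.
  by apply/funext => x; rewrite modulus_exp_weight.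
rewrite E in L2F NF.
have F0 x : 0 <= modulus (F n) x by exact: modulus_ge0.
have mre' : meas (fun x => complex.Re (F n.+1 x)) by exact: (measurable_convolution sc sf (mK n0) mreF).
have mim' : meas (fun x => complex.Im (F n.+1 x)) by exact: (measurable_convolution sc sf (mK n0) mimF).
have [|x|x|L2' N'] := weighted_conv_bound sc hmu hG hU (mK n0) (K0 n0) (hK n0) mF F0 mpsi psi_lip L2F (g := modulus (F n.+1)).
- exact: measurable_modulus.
- exact: modulus_ge0.
- exact: (modulus_cconvolution sc mu _ (mK n0) (K0 n0) mreF mimF).
have E' : modulus (exp_weight lambda psi (F n.+1)) = fun x => expR (lambda * psi x) * modulus (F n.+1) x.
  by apply/funext => x; rewrite modulus_exp_weight.
rewrite E'; split => //.
  split => //.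
  have := conv_finite_ae sc hmu hG hU (mK n0) (K0 n0) (hK n0) mF F0 mpsi psi_lip L2F.
  apply: filterS => x fin; split.
    exact: (conv_Re_int sc (mK n0) (K0 n0) mreF mimF fin).
  exact: (conv_Im_int sc (mK n0) (K0 n0) mreF mimF fin).
by apply: (le_trans N'); rewrite (exprS _ n) -[leRHS]mulrA ler_wpM2l ?expR_ge0.
Qed.

End Complex.

Lemma opnorm_weighted_Tprod (psi : G -> R) (lambda : R) (m n : nat) :
  meas psi -> almost_lipschitz mu U psi ->
  (opnorm22 mu (fun f => exp_weight lambda psi
     (Tprod mu K m n (exp_weight (- lambda) psi f))) <=
   (expR (omega * lambda ^+ 2 * n%:R))%:E)%E.
Proof.
move=> mpsi psi_lip; apply: ge_ereal_sup => _ [f [hf f1] <-].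
have [_ _ _ L2F NF] := weighted_Tprod lambda m mpsi psi_lip hf n.
rewrite L2norm_norm2// lee_fin.
rewrite L2norm_norm2 in f1; last exact: inL2_square_integrable.
rewrite lee_fin in f1.
rewrite -(@ler_pXn2r _ 2)// ?nnegrE ?expR_ge0 ?norm2_ge0//.
apply: (le_trans NF).
rewrite (_ : expR (2 * omega * lambda ^+ 2) ^+ n = expR (omega * lambda ^+ 2 * n%:R) ^+ 2); last first.
  by rewrite -!expRM_natl; congr expR; ring.
rewrite -[leRHS]mulr1 ler_wpM2l ?sqr_ge0//.
by rewrite expr_le1// norm2_ge0.
Qed.

(** The kernel of index [m.+1] is the starting function, not a step, so [n.+1] kernels cost the
    growth factor only [n] times. *)
Lemma weighted_convolutions (lambda : R) (m n : nat) :
  L2 (fun x => expR (lambda * rho x) * K m.+1 x) ->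
  [/\ meas (convolutions mu K m n.+1), forall g, 0 <= convolutions mu K m n.+1 g,
      L2 (fun x => expR (lambda * rho x) * convolutions mu K m n.+1 x) &
      N (fun x => expR (lambda * rho x) * convolutions mu K m n.+1 x) ^+ 2 <=
      expR (2 * omega * lambda ^+ 2) ^+ n * N (fun x => expR (lambda * rho x) * K m.+1 x) ^+ 2].
Proof.
have sf := haar_sigma_finite hmu hG hU.
move=> L2K; elim: n => [|n [mF F0 L2F NF]].
  by rewrite /= expr0 mul1r; split => //; [exact: mK|exact: K0].
have n0 : (0 < m + n.+2)%N by rewrite addnS.
have mF' : meas (convolutions mu K m n.+2) by exact: (measurable_convolution sc sf (mK n0) mF).
have F0' g : 0 <= convolutions mu K m n.+2 g.
  by apply: Rintegral_ge0 => h _; rewrite mulr_ge0 ?K0.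
have [L2' N'] := weighted_conv_bound sc hmu hG hU (mK n0) (K0 n0) (hK n0) mF F0
  (measurable_rho hG hU) (rho_lipschitz mu hG hU) L2F mF' F0'
  (fun x => convolution_le x (K0 n0) F0).
by split => //; apply: (le_trans N'); rewrite (exprS _ n) -[leRHS]mulrA ler_wpM2l ?expR_ge0.
Qed.

End Products.

(** * Pointwise decay *)

Section Pointwise.
Variables (R : realType) (G : topGroupType).
Hypothesis sc : @second_countable G.
Variable mu : {measure set (borel G) -> \bar R}.
Hypothesis hmu : left_haar_measure mu.
Variable Delta : G -> R.
Hypothesis hDelta : modular_function mu Delta.
Variable U : set G.
Hypothesis hG : connected [set: G].
Hypothesis hU : admissible_nbhd U.
Local Notation rho := (rho R U).
Local Notation int f := (mu.-integrable [set: borel G] (EFin \o (f : borel G -> R))).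
Local Notation meas f := (measurable_fun [set: borel G] (f : borel G -> R)).
Local Notation L2 f := (square_integrable mu (f : borel G -> R)).
Local Notation N f := (norm2 mu (f : borel G -> R)).
Local Notation ell x := (ln (Delta x)).

Lemma additive_ln_modular : additive_map (fun x => ell x).
Proof.
have [D0 DM cD _] := hDelta; split=> [x|g h]; last by rewrite DM lnM// posrE.
by apply: continuous_comp; [exact: cD|apply: continuous_ln; exact: D0].
Qed.

Lemma modular_powR g : Delta g `^ (- 2^-1) = expR (- 2^-1 * ell g).
Proof. by have [D0 _ _ _] := hDelta; rewrite /powR gt_eqF. Qed.

Section Weight.
Variable lambda : R.
Hypothesis lambda0 : 0 <= lambda.
Definition modular_weight (x : G) : R := expR (2^-1 * ell x + lambda * rho x).
Local Notation w := modular_weight.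

Lemma measurable_ln_modular : meas (fun x => ell x).
Proof. by apply: continuous_borel; have [] := additive_ln_modular. Qed.

Lemma measurable_modular_weight : meas w.
Proof.
apply: measurableT_comp => //; apply: measurable_funD.
  by apply: measurable_funM => //; exact: measurable_ln_modular.
by apply: measurable_funM => //; exact: measurable_rho.
Qed.

Lemma modular_weightM g h : w (g * h)%g <= w g * w h.
Proof.
have [_ lM] := additive_ln_modular; rewrite /w -expRD ler_expR lM.
have := ler_wpM2l lambda0 (rhoM R hG hU g h); lra.
Qed.

(* Inverting and translating turns the half power of the modular function in the
   weight into an unweighted norm. *)
Lemma norm2_modular_reflection (F : G -> R) (g : G) : meas F ->
  L2 (fun x => expR (lambda * rho x) * F x) ->
  L2 (fun h => w (h^-1 * g)%g * F (h^-1 * g)%g) /\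
  N (fun h => w (h^-1 * g)%g * F (h^-1 * g)%g) = N (fun x => expR (lambda * rho x) * F x).
Proof.
move=> mF L2F; have [D0 DM cD _] := hDelta.
pose B x := (w x * F x) ^+ 2.
have mwF : meas (fun x => w x * F x).
  by apply: measurable_funM => //; exact: measurable_modular_weight.
have mB : meas B by exact: measurable_funX.
have mwFi : meas (fun h => w (h^-1 * g)%g * F (h^-1 * g)%g).
  exact: (measurableT_comp (measurable_shift2 sc mwF) (pair2_measurable (g : borel G))).
have E : (\int[mu]_h ((w (h^-1 * g)%g * F (h^-1 * g)%g) ^+ 2)%:E =
          \int[mu]_x ((expR (lambda * rho x) * F x) ^+ 2)%:E)%E.
  have m1 : measurable_fun [set: borel G] (fun h : borel G => (B ((h : G)^-1 * g)%g)%:E).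
    by apply/measurable_EFinP; exact: (measurable_funX 2 mwFi).
  rewrite -(integral_translate hmu g m1); last by move=> x; rewrite lee_fin sqr_ge0.
  under eq_integral do rewrite invgM -mulgA mulVg mulg1.
  have m2 : measurable_fun [set: borel G] (fun h : borel G => (B h)%:E) by exact/measurable_EFinP.
  rewrite (integral_invg hDelta m2); last by move=> x; rewrite lee_fin sqr_ge0.
  apply: eq_integral => x _; rewrite -EFinM; congr _%:E.
  rewrite -[Delta _]lnK ?posrE//.
  have [_ lM] := additive_ln_modular.
  have -> : ell (x^-1)%g = - ell x by exact: (additive_mapV additive_ln_modular x).
  rewrite /B /w expRD !exprMn.
  rewrite (_ : expR (2^-1 * ell x) ^+ 2 = expR (ell x)); last by rewrite -expRM_natl; congr expR; lra.
  by rewrite expRN; field; rewrite gt_eqF ?expR_gt0.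
have L2i : L2 (fun h => w (h^-1 * g)%g * F (h^-1 * g)%g).
  by apply: square_integrableP => //; rewrite E integral_sqr// ltry.
split => //; move: E; rewrite !integral_sqr// => -[] E.
by apply/eqP; rewrite -(@eqrXn2 _ 2)// ?norm2_ge0// E.
Qed.

(** Submultiplicativity splits the weight at [g] between [h] and [h^-1 g]; Cauchy-Schwarz then
    applies, and the reflection identity removes the modular factor from the norm of [F]. *)
Lemma pointwise_convolution (K F : G -> R) (g : G) :
  meas K -> (forall x, 0 <= K x) -> meas F -> (forall x, 0 <= F x) ->
  L2 (fun x => w x * K x) -> L2 (fun x => expR (lambda * rho x) * F x) ->
  w g * convolution mu K F g <=
    N (fun x => w x * K x) * N (fun x => expR (lambda * rho x) * F x).
Proof.
move=> mK K0 mF F0 L2K L2F.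
have [L2i NE] := norm2_modular_reflection g mF L2F.
have ii := integrableM2 L2K L2i.
rewrite -NE -lee_fin EFinM.
have w0 x : 0 <= w x by exact: expR_ge0.
apply: (@le_trans _ _ ((w g)%:E * \int[mu]_h (K h * F (h^-1 * g)%g)%:E)%E).
  by rewrite lee_wpmul2l ?lee_fin//; exact: convolution_le.
rewrite -ge0_integralZl_EFin//; last 2 first.
- by move=> h _; rewrite lee_fin mulr_ge0.
- by apply/measurable_EFinP; exact: measurable_conv_integrand.
apply: (@le_trans _ _ (\int[mu]_h ((w h * K h) * (w (h^-1 * g)%g * F (h^-1 * g)%g))%:E)%E).
  apply: ge0_le_integral => //.
  - by move=> h _; rewrite -EFinM lee_fin mulr_ge0// mulr_ge0.
  - apply/measurable_EFinP; apply: measurable_funM => //; exact: measurable_conv_integrand.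
  - by apply: measurable_int ii.
  - move=> h _; rewrite -EFinM lee_fin.
    have := modular_weightM h (h^-1 * g)%g; rewrite mulgA mulgV mul1g => wM.
    have := ler_wpM2r (mulr_ge0 (K0 h) (F0 (h^-1 * g)%g)) wM.
    by rewrite (_ : w h * w _ * _ = w h * K h * (w (h^-1 * g)%g * F (h^-1 * g)%g))//; ring.
by rewrite -RintegralE// lee_fin cauchy_schwarz_Rintegral.
Qed.

End Weight.

Section Gaussian.
Variables (c b : R).
Hypothesis (c0 : 0 < c) (b0 : 0 < b).

(** Boundedness by [c] gives [K^2 <= c K], which reduces the weighted L2 norm to an exponential
    moment. The general exponent [v] covers both [lambda rho] and its sum with half the logarithm of
    [Delta]. *)
Lemma gaussian_L2 : exists2 C, 1 <= C &
  forall K : G -> R, meas K -> (forall g, 0 <= K g) ->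
    (forall g, K g <= c * expR (- b * rho g ^+ 2)) ->
    forall (v : G -> R) t, meas v -> (forall g, 2 * v g <= t * rho g) ->
      L2 (fun g => expR (v g) * K g) /\
      N (fun g => expR (v g) * K g) ^+ 2 <= c * (C * expR (t ^+ 2 / (2 * b))).
Proof.
have [C C1 HC] := exp_moment hmu hG hU c0 b0; exists C => // K mK K0 Kb v t mv vt.
have [ie le] := HC K mK K0 Kb t.
have ie' := integrable_lin c 0 ie ie.
have le1 g : (expR (v g) * K g) ^+ 2 <= c * (K g * expR (t * rho g)) + 0 * (K g * expR (t * rho g)).
  rewrite mul0r addr0 exprMn -expRM_natl.
  have h1 : K g <= c.
    apply: (le_trans (Kb g)); rewrite ger_pMr// -expR0 ler_expR.
    by rewrite mulNr oppr_le0 mulr_ge0 ?sqr_ge0// ltW.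
  have h2 : expR (2 * v g) <= expR (t * rho g) by rewrite ler_expR.
  rewrite [leLHS]mulrC [leRHS]mulrA expr2.
  apply: ler_pM => //; [exact: mulr_ge0|exact: ler_wpM2r].
have mL : meas (fun g => expR (v g) * K g).
  by apply: measurable_funM => //; exact: measurableT_comp.
have i2 : int (fun g => (expR (v g) * K g) ^+ 2).
  apply: (integrable_le _ ie'); first exact: measurable_funX.
  by move=> g; rewrite ger0_norm ?sqr_ge0.
split; first by split.
have le2 : \int[mu]_g ((expR (v g) * K g) ^+ 2) <=
    \int[mu]_g (c * (K g * expR (t * rho g)) + 0 * (K g * expR (t * rho g))).
  by apply: le_Rintegral_ae => //; exact: aeW.
rewrite sqr_norm2; apply: (le_trans le2).
by rewrite Rintegral_lin// mul0r addr0 ler_wpM2l// ltW.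
Qed.

End Gaussian.

End Pointwise.

Section Decay.
Variables (R : realType) (G : topGroupType).
Hypothesis sc : @second_countable G.
Variable mu : {measure set (borel G) -> \bar R}.
Hypothesis hmu : left_haar_measure mu.
Variable Delta : G -> R.
Hypothesis hDelta : modular_function mu Delta.
Variable U : set G.
Hypothesis hG : connected [set: G].
Hypothesis hU : admissible_nbhd U.
Variables (omega c b : R).
Hypothesis (omega0 : 0 < omega) (c0 : 0 < c) (b0 : 0 < b).
Variable K : nat -> G -> R.
Local Notation rho := (rho R U).
Local Notation meas f := (measurable_fun [set: borel G] (f : borel G -> R)).
Local Notation L2 f := (square_integrable mu (f : borel G -> R)).
Local Notation N f := (norm2 mu (f : borel G -> R)).
Hypothesis mK : forall n, (0 < n)%N -> meas (K n).
Hypothesis K0 : forall n, (0 < n)%N -> forall g, 0 <= K n g.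
Hypothesis hK : forall n, (0 < n)%N -> step_growth mu U omega (K n).
Hypothesis Kb : forall n, (0 < n)%N -> forall g, K n g <= c * expR (- b * rho g ^+ 2).
Local Notation ell x := (ln (Delta x)).

Lemma convolutions_decay : exists c' b' : R, [/\ 0 < c', 0 < b' &
  forall (m n : nat) (g : G), (0 < n)%N -> convolutions mu K m n g <=
    c' * Delta g `^ (- 2^-1) * expR (- b' * rho g ^+ 2 / n%:R)].
Proof.
have [C C1 HC] := gaussian_L2 hmu hG hU c0 b0.
have [M M0 HM] := additive_map_bound hG hU (additive_ln_modular hDelta).
have C0 : 0 < C by exact: lt_le_trans C1.
(* The two kernels outside the iteration contribute [(M + 2 l)^2 / (2 b)] and [(2 l)^2 / (2 b)] to
   the exponent of the squared bound. By [(M + 2 l)^2 <= 2 M^2 + 8 l^2] the part in [l^2] is at most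
   [6 l^2 / b], half of which gives [3 / b]. *)
pose o := omega + 3 / b.
have b1 : 0 < b^-1 by rewrite invr_gt0.
have o0 : 0 < o by rewrite /o addr_gt0// mulr_gt0.
have ob : 3 / b <= o by rewrite /o lerDr ltW.
exists (c * C * expR (M ^+ 2 / (2 * b))), (4 * o)^-1; split.
- by rewrite mulr_gt0 ?expR_gt0// mulr_gt0.
- by rewrite invr_gt0 mulr_gt0.
move=> m [//|n] g _.
have r0 := rho_ge0 R hG hU g; set r := rho g in r0 *.
have n1 : 1 <= n.+1%:R :> R by rewrite ler1n.
have n_gt0 : 0 < n.+1%:R :> R by exact: lt_le_trans n1.
rewrite (modular_powR hDelta).
suff : expR (2^-1 * ell g) * convolutions mu K m n.+1 g <=
    c * C * expR (M ^+ 2 / (2 * b)) * expR (- (4 * o)^-1 * r ^+ 2 / n.+1%:R).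
  move=> H; rewrite mulrAC -[leLHS]mulr1 -[X in _ * X <= _](expR0) -(subrr (2^-1 * ell g)).
  by rewrite expRD -mulNr mulrA ler_wpM2r ?expR_ge0// mulrC.
(* A single kernel involves no convolution: its Gaussian bound suffices, half of the decay paying
   for [Delta], which is at most exponential in [rho]. *)
case: n n1 n_gt0 => [|n] n1 n_gt0.
  have h1 : 2^-1 * ell g <= b / 2 * r ^+ 2 + M ^+ 2 / (2 * b).
    have := le_trans (ler_norm _) (HM g); rewrite -/r => le.
    apply: (@le_trans _ _ (2^-1 * (M * r))); first by rewrite ler_wpM2l.
    rewrite -subr_ge0 (_ : _ - _ = ((b * r - M / 2) ^+ 2 + 3 / 4 * M ^+ 2) / (2 * b)); last by field; rewrite gt_eqF.
    apply: mulr_ge0; last by rewrite invr_ge0 mulr_ge0// ltW.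
    by have := sqr_ge0 (b * r - M / 2); have := sqr_ge0 M; lra.
  have h2 : (4 * o)^-1 <= b / 2.
    have le1 : 2 * b^-1 <= 4 * o by lra.
    rewrite (_ : b / 2 = (2 * b^-1)^-1); last by field; rewrite gt_eqF.
    by rewrite lef_pV2// posrE mulr_gt0.
  rewrite divr1 /=.
  apply: (@le_trans _ _ (expR (2^-1 * ell g) * (c * expR (- b * r ^+ 2)))).
    by rewrite ler_wpM2l ?expR_ge0//; exact: Kb.
  rewrite mulrCA -!mulrA ler_wpM2l ?(ltW c0)// -[leLHS]mul1r.
  apply: ler_pM => //; rewrite -!expRD ?expR_ge0//.
  rewrite ler_expR; have := ler_wpM2r (sqr_ge0 r) h2; lra.
have mF : meas (K m.+1) by exact: mK.
have F0 x : 0 <= K m.+1 x by exact: K0.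
(* The minimiser of [o l^2 n - l r], with [n] standing for the number of kernels; the minimum
   [- r^2 / (4 o n)] is the origin of [b' = 1 / (4 o)]. *)
pose l := r / (2 * o * n.+2%:R).
have l0 : 0 <= l by rewrite divr_ge0// mulr_ge0 ?mulr_ge0 ?(ltW o0) ?(ltW n_gt0).
have mr : meas rho by exact: measurable_rho.
have [L2K1 NK1] : L2 (fun x => expR (l * rho x) * K m.+1 x) /\
    N (fun x => expR (l * rho x) * K m.+1 x) ^+ 2 <= c * (C * expR ((2 * l) ^+ 2 / (2 * b))).
  apply: (HC _ mF F0 (Kb _) (fun x => l * rho x)) => //; first exact: measurable_funM.
  by move=> x; rewrite mulrA.
have n0 : (0 < m + n.+2)%N by rewrite addnS.
have [L2K2 NK2] : L2 (fun x => modular_weight Delta U l x * K (m + n.+2)%N x) /\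
    N (fun x => modular_weight Delta U l x * K (m + n.+2)%N x) ^+ 2 <=
    c * (C * expR ((M + 2 * l) ^+ 2 / (2 * b))).
  apply: (HC _ (mK n0) (K0 n0) (Kb n0) (fun x => 2^-1 * ell x + l * rho x)).
    apply: measurable_funD; apply: measurable_funM => //; exact: (measurable_ln_modular hDelta).
  move=> x; have := le_trans (ler_norm _) (HM x); lra.
have [mFn Fn0 L2F NF] := weighted_convolutions sc hmu hG hU mK K0 hK n L2K1.
have := pointwise_convolution sc hmu hDelta hG hU l0 g (mK n0) (K0 n0) mFn Fn0 L2K2 L2F.
rewrite -[convolution _ _ _ _]/(convolutions mu K m n.+2 g).
move: NK1 NK2 NF.
set a1 := N _; set a2 := N _; set a3 := N _; set v := convolutions _ _ _ _ _.
move=> NK1 NK2 NF le.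
have a23 : a2 * a3 <= c * C * expR (M ^+ 2 / (2 * b) + o * l ^+ 2 * n.+2%:R).
  rewrite -(@ler_pXn2r _ 2)// ?nnegrE ?mulr_ge0 ?norm2_ge0 ?expR_ge0 ?(ltW c0) ?(ltW C0)//.
  rewrite exprMn.
  apply: (@le_trans _ _ (c * (C * expR ((M + 2 * l) ^+ 2 / (2 * b))) *
     (expR (2 * omega * l ^+ 2) ^+ n * (c * (C * expR ((2 * l) ^+ 2 / (2 * b))))))).
    apply: ler_pM; rewrite ?sqr_ge0//.
    by apply: (le_trans NF); rewrite ler_wpM2l// exprn_ge0// expR_ge0.
  rewrite [leRHS]exprMn -!expRM_natl.
  rewrite (_ : c * _ * _ = (c * C) ^+ 2 * (expR ((M + 2 * l) ^+ 2 / (2 * b)) * expR (n%:R * (2 * omega * l ^+ 2)) * expR ((2 * l) ^+ 2 / (2 * b)))); last by ring.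
  rewrite ler_wpM2l ?sqr_ge0// -!expRD ler_expR -subr_ge0.
  rewrite (_ : _ - _ = (M - 2 * l) ^+ 2 / (2 * b) + 4 * omega * l ^+ 2 + 6 / b * l ^+ 2 * n.+1%:R); last first.
    by rewrite /o -(natr1 n.+1) -(natr1 n); field; rewrite gt_eqF.
  have bi : 0 <= (2 * b)^-1 by rewrite invr_ge0 mulr_ge0 ?(ltW b0).
  rewrite !addr_ge0//; first by rewrite mulr_ge0 ?sqr_ge0.
    by rewrite mulr_ge0 ?sqr_ge0// mulr_ge0// ltW.
  by rewrite mulr_ge0// mulr_ge0 ?sqr_ge0// mulr_ge0// ltW.
have := le_trans le a23; rewrite /modular_weight expRD -/r => le2.
have := ler_wpM2r (expR_ge0 (- (l * r))) le2.
rewrite mulrAC -[_ * expR (- _)]mulrA -expRD subrr expR0 mulr1 => le3.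
apply: (le_trans le3); rewrite -!mulrA ler_wpM2l ?(ltW c0)// ler_wpM2l ?(ltW C0)//.
rewrite -!expRD ler_expR.
rewrite le_eqVlt; apply/orP; left; apply/eqP; rewrite /l.
by field; rewrite !gt_eqF.
Qed.

End Decay.

Theorem theorem1p11 (R : realType) (d : nat) (G : lieGroupType R d)
    (hG : connected [set: G])
    (mu : {measure set (borel G) -> \bar R}) (hmu : left_haar_measure mu)
    (Delta : G -> R) (hDelta : modular_function mu Delta)
    (U : set G) (hU : admissible_nbhd U)
    (q r : nat) (phi : abelianization G -> 'rV[R]_q * 'rV[circle R]_r)
    (hphi : is_abelianization_iso phi)
    (K : nat -> G -> R)
    (hK : forall n, (0 < n)%N -> probability_density mu (K n))
    (hKc : forall n, (0 < n)%N -> centered mu phi (K n))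
    (hlow : exists2 W : set G, nbhs (1%g : G) W &
       0 < inf [set x : R | exists n g, [/\ (0 < n)%N, W g & x = K n g]])
    (hup : exists c b : R, [/\ 0 < c, 0 < b &
       forall n g, (0 < n)%N -> K n g <= c * expR (- b * rho R U g ^+ 2)]) :
  exists omega c' b' : R,
    [/\ 0 < omega, 0 < c', 0 < b',
      forall (m n : nat) (lambda : R) (psi : G -> R),
        (0 < n)%N -> class_E mu U psi ->
        (forall f, inL2 mu f ->
           Tprod_defined mu K m n (exp_weight (- lambda) psi f)) /\
        (opnorm22 mu (fun f => exp_weight lambda psi
             (Tprod mu K m n (exp_weight (- lambda) psi f)))
           <= (expR (omega * lambda ^+ 2 * n%:R))%:E)%E
    & forall (m n : nat) (g : G), (0 < n)%N ->
        convolutions mu K m n g <=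
          c' * Delta g `^ (- 2^-1) * expR (- b' * rho R U g ^+ 2 / n%:R)].
Proof.
have sc : @second_countable G by exact: (@lie_second_countable R d G).
have [W nW e0] := hlow; have [c [b [c0 b0 Kb]]] := hup.
have [omega omega0 step] := one_step sc hmu hG hU hphi c0 b0 nW e0.
have gK n : (0 < n)%N -> gaussian_kernel mu U phi c b (K n).
  by move=> n0; split; [exact: hK|exact: hKc|move=> g; exact: Kb].
have mK n (n0 : (0 < n)%N) := kernel_meas (gK n n0).
have K0 n (n0 : (0 < n)%N) := kernel_ge0 (gK n n0).
have growth n : (0 < n)%N -> step_growth mu U omega (K n).
  move=> n0 f psi; apply: step; first exact: gK.
  move=> g Wg; apply: ge_inf; last by exists n, g.
  by exists 0 => _ [k [h [k0 _ ->]]]; exact: K0.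
have [c' [b' [c'0 b'0 decay]]] :=
  convolutions_decay sc hmu hDelta hG hU omega0 c0 b0 mK K0 growth (fun n n0 g => Kb n g n0).
exists omega, c', b'; split => // m n lambda psi n0 psiE.
have [mpsi _ _] := psiE; have psi_lip := class_E_lipschitz hmu psiE.
split; first by move=> f hf; have [] := weighted_Tprod sc hmu hG hU mK K0 growth lambda m mpsi psi_lip hf n.
exact: (opnorm_weighted_Tprod sc hmu hG hU mK K0 growth).
Qed.
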